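(* Let $(\Omega,\mathcal{B},\mu,\sigma)$ be an ergodic, invertible, probability-preserving transformation, and let $\epsilon_1,\epsilon_2:\Omega\to[0,1]$ be measurable functions, neither of which is $\mu$-a.e. equal to $0$, and both of which have countable range. For $\kappa\in(0,1]$ consider the cocycle of paired tent maps $T^{(n)}_{\kappa\epsilon_1(\omega),\kappa\epsilon_2(\omega)}$ over $\sigma$. Then there exists $c>0$ such that for all sufficiently small $\kappa$, the second-largest Lyapunov exponent $\lambda_2(\kappa)$ for the corresponding cocycle of Perron–Frobenius operators satisfies $$\lambda_2(\kappa)\le-c\kappa.$$ This estimate is sharp in the following sense. Set $\epsilon_1=\epsilon_2=1$ for all $\omega$. Then there is a sequence $(\kappa_n)_{n=1}^\infty\subset(0,1/2)$ such that $\kappa_n\to0$, each $T_{\kappa_n,\kappa_n}$ is Markov, and $\lambda_2(\kappa_n)$ is asymptotically equivalent to $-2\kappa_n$, i.e. $\lim_{n\to\infty}\lambda_2(\kappa_n)/(-2\kappa_n)=1$.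
   Context: For $\epsilon_1,\epsilon_2\in[0,1]$ the paired tent map $T_{\epsilon_1,\epsilon_2}:[-1,1]\to[-1,1]$ is $$T_{\epsilon_1,\epsilon_2}(x)=\begin{cases}2(1+\epsilon_1)(x+1)-1,&x\in[-1,-1/2],\\-2(1+\epsilon_1)x-1,&x\in[-1/2,0),\\0,&x=0,\\-2(1+\epsilon_2)x+1,&x\in(0,1/2],\\2(1+\epsilon_2)(x-1)+1,&x\in[1/2,1].\end{cases}$$ For fixed $\kappa$, with $T_\omega=T_{\kappa\epsilon_1(\omega),\kappa\epsilon_2(\omega)}$, the cocycle of maps is $T_\omega^{(n)}=T_{\sigma^{n-1}(\omega)}\circ\cdots\circ T_\omega$. Let $\lambda$ be normalized Lebesgue measure on $[-1,1]$. The Perron–Frobenius operator $L_\omega$ of $T_\omega$ is defined by $\int L_\omega f\cdot h\,d\lambda=\int f\cdot h\circ T_\omega\,d\lambda$ for $f\in L^1(\lambda)$, $h\in L^\infty(\lambda)$. The cocycle $L_\omega^{(n)}=L_{\sigma^{n-1}(\omega)}\circ\cdots\circ L_\omega$ is considered acting on the Banach space $BV[-1,1]$ of $\lambda$-a.e. equivalence classes of functions having a representative of bounded variation, with norm $\|f\|_{BV}=\|f\|_1+\operatorname{Var}(f)$, where $\operatorname{Var}(f)$ is the infimum of the variations of representatives of $f$. Lyapunov exponents are taken with respect to $\|\cdot\|_{BV}$ and are $\mu$-a.e. constant; $\lambda_2$ is the second-largest exponent counted with multiplicity, i.e. for $\mu$-a.e. $\omega$, $\lambda_2$ is the infimum over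 closed codimension-one subspaces $V\subset BV[-1,1]$ of $\limsup_{n\to\infty}\frac1n\log\|L_\omega^{(n)}|_V\|$. A piecewise monotone map $T$ of $[-1,1]$ is Markov if there is a finite partition of $[-1,1]$ into non-degenerate closed intervals with disjoint interiors such that $T$ is continuous and monotone on the interior of each partition interval and the image of each such interior is, up to finitely many points, a union of partition intervals. *)

(* Defs.v *)
From HB Require Import structures.
From mathcomp Require Import all_boot all_order all_algebra.
From mathcomp Require Import all_classical all_reals all_analysis.

Set Implicit Arguments.
Unset Strict Implicit.
Unset Printing Implicit Defensive.

Import Order.TTheory GRing.Theory Num.Theory.
Import numFieldNormedType.Exports.

Local Open Scope classical_set_scope.
Local Open Scope ring_scope.

Section dynamics.
Context d (Omega : measurableType d) (R : realType).

Definition ergodic_automorphism (mu : probability Omega R)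
    (sigma : Omega -> Omega) : Prop :=
  [/\ exists tau : Omega -> Omega,
        [/\ cancel sigma tau, cancel tau sigma & measurable_fun setT tau],
      measurable_fun setT sigma,
      forall A, measurable A -> mu (sigma @^-1` A) = mu A
    & forall A, measurable A -> sigma @^-1` A = A -> mu A = 0%E \/ mu A = 1%E].

End dynamics.

Fixpoint cocycle (Omega X : Type) (sigma : Omega -> Omega)
    (A : Omega -> X -> X) (n : nat) (omega : Omega) (x : X) : X :=
  if n is m.+1 then A (iter m sigma omega) (cocycle sigma A m omega x) else x.

Section tent.
Context (R : realType).
Implicit Types (e x : R) (T : R -> R).

(* Only the values on [-1, 1] matter. *)
Definition tent e1 e2 x : R :=
  if x == 0 then 0
  else if x <= - 2^-1 then 2 * (1 + e1) * (x + 1) - 1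
  else if x < 0 then - 2 * (1 + e1) * x - 1
  else if x <= 2^-1 then - 2 * (1 + e2) * x + 1
  else 2 * (1 + e2) * (x - 1) + 1.

Definition monotone_on (I : set R) T : Prop :=
  {in I &, {homo T : x y / x <= y}} \/ {in I &, {homo T : x y / x <= y >-> y <= x}}.

Definition Markov T : Prop :=
  (forall x, x \in `[-1, 1] -> T x \in `[-1, 1]) /\
  exists (n : nat) (a b : 'I_n -> R),
    [/\ forall i, a i < b i,
        \bigcup_i [set` `[a i, b i]] = [set` `[-1, 1]],
        trivIset setT (fun i => [set` `]a i, b i[])
      & forall i, let I := [set` `]a i, b i[] in
        [/\ {in I, continuous T},
            monotone_on I T
          & exists J : set 'I_n,
              let U := \bigcup_(j in J) [set` `[a j, b j]] in
              finite_set ((T @` I) `\` U) /\ finite_set (U `\` (T @` I))]].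

End tent.

Section BV.
Context (R : realType).
Implicit Types (f g h : R -> R) (T : R -> R) (V : set (R -> R)).

Lemma ltN11 : -1 < 1 :> R.
Proof. by rewrite gtrN ?ltr01. Qed.

Definition lam : probability (measurableTypeR R) R := uniform_prob ltN11.

(* Elements of L^1(lam) are represented by functions in [Lfun lam 1]; since
   lam is concentrated on [-1, 1], values outside [-1, 1] are irrelevant, and
   every notion below is invariant under lam-a.e. equality. *)

Definition Var f : \bar R :=
  ereal_inf [set total_variation (-1) 1 g | g in [set g | g = f %[ae lam]]].

Definition BVnorm f : \bar R := ('N[lam]_1[EFin \o f] + Var f)%E.

Definition BV : set (R -> R) :=
  [set f | f \in Lfun lam 1%E /\
    exists2 g, g = f %[ae lam] & bounded_variation (-1) 1 g].

Definition is_PF T f g : Prop :=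
  g \in Lfun lam 1%E /\
  forall h, h \in Lfun lam +oo%E ->
    (\int[lam]_x (g x * h x)%:E = \int[lam]_x (f x * h (T x))%:E)%E.

(* [is_PF T f] determines its member up to lam-a.e. equality and depends only
   on the class of f; it is inhabited for f in L^1 and T nonsingular. *)
Definition PF T f : R -> R := xget (cst 0) (is_PF T f).

(* Closedness makes V saturated for lam-a.e. equality inside BV, so V is a
   set of equivalence classes. *)
Record closed_hyperplane V : Prop := ClosedHyperplane {
  hyperplane_sub : V `<=` BV;
  hyperplane0 : V (cst 0);
  hyperplane_lin : forall (a : R) f g, V f -> V g -> V (a *: f + g);
  hyperplane_closed : forall f, BV f ->
    (forall r : R, 0 < r -> exists2 g, V g & (BVnorm (f - g)%R < r%:E)%E) -> V f;
  hyperplane_codim1 : exists e, [/\ BV e, ~ V e &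
    forall f, BV f -> exists a : R, V (f - a *: e)]
}.

Definition opnorm_on V (L : (R -> R) -> R -> R) : \bar R :=
  ereal_sup [set BVnorm (L f) | f in V `&` [set f | (BVnorm f <= 1)%E]].

End BV.

Section lyapunov.
Context d (Omega : measurableType d) (R : realType).
Implicit Types (mu : probability Omega R) (sigma : Omega -> Omega).
Implicit Types (eps : Omega -> R) (kappa : R) (omega : Omega).

Definition tent_family eps1 eps2 kappa omega : R -> R :=
  tent (kappa * eps1 omega) (kappa * eps2 omega).

Definition PF_cocycle sigma eps1 eps2 kappa (n : nat) omega :
    (R -> R) -> R -> R :=
  cocycle sigma (fun omega' => PF (tent_family eps1 eps2 kappa omega')) n omega.

(* [lne 0 = -oo]; the term n = 0 does not affect the limsup. *)
Definition growth_rate sigma eps1 eps2 kappa omega (V : set (R -> R)) : \bar R :=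
  limn_esup (fun n : nat => (n%:R^-1)%:E *
    lne (opnorm_on V (PF_cocycle sigma eps1 eps2 kappa n omega)))%E.

Definition second_exponent_at sigma eps1 eps2 kappa omega : \bar R :=
  ereal_inf [set growth_rate sigma eps1 eps2 kappa omega V
            | V in [set V | closed_hyperplane V]].

(* The second exponent is the mu-a.e. constant value of the infimum. *)
Definition is_lambda2 mu sigma eps1 eps2 kappa (l : \bar R) : Prop :=
  \forall omega \ae mu, second_exponent_at sigma eps1 eps2 kappa omega = l.

End lyapunov.

(* Main.v *)
(** A function f of mean zero has mass -a on [-1, 0] and a on [0, 1]. One step of
    the cocycle moves mass between the halves only through the images of two
    small windows around -1/2 and 1/2, so that a is multiplied by
    q = 1 - e1/(1 + e1) - e2/(1 + e2), up to an error governed by the variation.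
    The ordinary variation V does not contract well enough for this, because the
    leaked piece is truncated with a jump at distance e from 0. The variation N with weight
    sqrt (min (x, 1 - x) + kappa) does: expansion by a factor s >= 2 near the
    endpoints costs only sqrt s / s, and a jump at distance at most kappa from 0
    has size O(sqrt kappa). Hence Psi = |a| + 32 kappa N + kappa^2 V is multiplied
    by at most q + 200 kappa^(3/2), and conversely a shrinks by at least
    q - 240 kappa^(3/2) on the invariant cone N <= 60 sqrt(kappa) a. This gives
    the exponent on the hyperplane of mean-zero functions, which realizes the
    infimum, since every other hyperplane contains a function of nonzero mean.

    For the upper bound it remains to count visits to {eps1 >= eta}, whose
    frequency is bounded below almost surely by an elementary Keane-Weiss argument.
    For the sharpness the factor q is constant, and T is Markov when
    (2 (1 + kappa))^n kappa = 1/2, because then the orbit of the turning point is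
    finite. *)

Require Import Defs.
From HB Require Import structures.
From mathcomp Require Import all_boot all_order all_algebra.
From mathcomp Require Import all_classical all_reals all_analysis.
From mathcomp Require Import measurable_realfun ess_sup_inf ring lra.

Set Implicit Arguments.
Unset Strict Implicit.
Unset Printing Implicit Defensive.

Import Order.TTheory GRing.Theory Num.Theory.
Import numFieldNormedType.Exports.
Local Open Scope classical_set_scope.
Local Open Scope ring_scope.

(** * Weighted variation under folding and leaking *)

Section oscillation.
Context {R : realType}.
Implicit Types (r f g u w : R -> R) (s e c K : R).

(** The weight has to be small near 0, so that the jump is cheap, and still have an inverse that is
    integrable uniformly in [kappa]: only then does the mass of a half determine the value at its
    center up to O(N), hence also the mass of the leaking window up to O(kappa N). Any power
    strictly between 0 and 1 of the distance to the endpoints would do; 1/2 makes the primitive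
    elementary. The coordinates form a nearly triangular system: [N] receives sqrt(kappa) |a| and
    gives back kappa N, while [V] receives [a] and [N] and gives nothing back. It is carried along
    only to recover the BV norm. Variation is represented by a dominating function [w], so that sums
    and inverse branches act on [w] by algebra, without partitions. Two obstacles are not analytic.
    [PF] is a choice, known up to null sets, so estimates are made on pairs of genuine bounded
    functions that represent the cocycle. And operator norms are suprema over uncountable sets:
    their measurability in [omega] rests on the countable ranges, and the almost sure constancy of
    the exponent on a zero-one law for the sets where a given exponential bound holds. *)

Definition dominated_by r f w : Prop := forall x y, 0 <= x -> x <= y -> y <= 1 ->
  Num.min (r x) (r y) * `|f y - f x| <= w y - w x.

(* The variation of f on [0, 1] weighted by r is at most K; w is any function
   whose increments dominate it. *)
Definition osc r f K : Prop := exists2 w, dominated_by r f w & w 1 - w 0 <= K.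

Definition nonneg01 r : Prop := forall x, 0 <= x <= 1 -> 0 <= r x.

Lemma ler_normD_eq (x a b : R) : x = a + b -> `|x| <= `|a| + `|b|.
Proof. by move=> ->; exact: ler_normD. Qed.

Lemma dominated_le r f w x y : nonneg01 r -> dominated_by r f w ->
  0 <= x -> x <= y -> y <= 1 -> w x <= w y.
Proof.
move=> r0 fw x0 xy y1; rewrite -subr_ge0; apply: le_trans (fw x y x0 xy y1).
by rewrite mulr_ge0// le_min !r0//; lra.
Qed.

Lemma osc_ge0 r f K : nonneg01 r -> osc r f K -> 0 <= K.
Proof.
move=> r0 [w fw wK]; apply: le_trans wK; rewrite subr_ge0.
exact: (dominated_le r0 fw).
Qed.

Lemma osc_le r f K K' : K <= K' -> osc r f K -> osc r f K'.
Proof. by move=> KK' [w fw wK]; exists w => //; exact: le_trans KK'. Qed.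

Lemma osc_cst r c : osc r (fun=> c) 0.
Proof.
exists (fun=> 0); last by rewrite subrr.
by move=> x y _ _ _; rewrite !subrr normr0 mulr0.
Qed.

Lemma osc_add r f g K K' : nonneg01 r -> osc r f K -> osc r g K' ->
  osc r (fun x => f x + g x) (K + K').
Proof.
move=> r0 [w fw wK] [w' gw wK']; exists (fun x => w x + w' x); last lra.
move=> x y x0 xy y1; move: (fw _ _ x0 xy y1) (gw _ _ x0 xy y1) => h1 h2.
have m0 : 0 <= Num.min (r x) (r y) by rewrite le_min !r0//; lra.
have -> : w y + w' y - (w x + w' x) = (w y - w x) + (w' y - w' x) by ring.
apply: le_trans (lerD h1 h2); rewrite -mulrDr ler_wpM2l//.
by apply: ler_normD_eq; ring.
Qed.

Lemma osc_weight r r' f K : (forall x, 0 <= x <= 1 -> r' x <= r x) ->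
  osc r f K -> osc r' f K.
Proof.
move=> rr' [w fw wK]; exists w => // x y x0 xy y1.
apply: le_trans (fw x y x0 xy y1); rewrite ler_wpM2r//.
rewrite le_min !ge_min !rr' ?orbT//; lra.
Qed.

(* The transfer operator of t |-> 1 - s * min(t, 1 - t). *)
Definition Q s f y : R := s^-1 * (f ((1 - y) / s) + f (1 - (1 - y) / s)).

(** The image of the opposite half overshoots 0 by at most [e]. In the coordinate of that half the
    overshoot sits at [- y], where the formula of [Q] still lists the two preimages. The cut at [e]
    creates the jump. *)
Definition leak s e f y : R := if y <= e then Q s f (- y) else 0.

(** The inverse branches map [0, 1] onto [0, 1/s] and [1 - 1/s, 1], which do not overlap because
    [s >= 2]. The increments of [w] over both thus add up to at most [K]; what remains is the factor
    1/s of [Q] and the factor [c] from comparing weights. *)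
Lemma osc_Q s c r f K : 2 <= s -> 0 <= c -> nonneg01 r ->
  (forall y, 0 <= y <= 1 -> r y <= c * r ((1 - y) / s)) ->
  (forall y, 0 <= y <= 1 -> r y <= c * r (1 - (1 - y) / s)) ->
  osc r f K -> osc r (Q s f) (c / s * K).
Proof.
move=> s2 c0 r0 rc1 rc2 [w fw wK].
have s0 : 0 < s by lra.
have si0 : 0 < s^-1 by rewrite invr_gt0.
have si1 : s^-1 <= 2^-1 by rewrite lef_pV2 ?posrE//; lra.
have cs0 : 0 <= c / s by rewrite divr_ge0//; lra.
(* The branch (1 - y) / s reverses orientation, hence the minus sign. *)
exists (fun y => c / s * (w (1 - (1 - y) / s) - w ((1 - y) / s))); last first.
  rewrite -mulrBr ler_wpM2l// subrr mul0r !subr0 mul1r.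
  have := dominated_le r0 fw (x := s^-1) (y := 1 - s^-1).
  by move=> /(_ ltac:(lra) ltac:(lra) ltac:(lra)); lra.
move=> x y x0 xy y1; rewrite -mulrBr /Q -mulrBr normrM gtr0_norm//.
set a := (1 - x) / s; set b := (1 - y) / s.
have b0 : 0 <= b by rewrite mulr_ge0; lra.
have ba : b <= a by rewrite ler_wpM2r; lra.
have a1 : a <= 2^-1.
  by rewrite /a ler_pdivrMr//; lra.
have ha := fw b a b0 ba ltac:(lra).
have hb := fw (1 - a) (1 - b) ltac:(lra) ltac:(lra) ltac:(lra).
have m0 : 0 <= Num.min (r x) (r y) by rewrite le_min !r0//; lra.
have m1 : Num.min (r x) (r y) <= c * Num.min (r b) (r a).
  by rewrite minr_pMr// le_min !ge_min rc1 ?rc1 ?orbT//; lra.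
have m2 : Num.min (r x) (r y) <= c * Num.min (r (1 - a)) (r (1 - b)).
  by rewrite minr_pMr// le_min !ge_min rc2 ?rc2 ?orbT//; lra.
have -> : c / s * (w (1 - b) - w b - (w (1 - a) - w a)) =
  s^-1 * (c * (w a - w b) + c * (w (1 - b) - w (1 - a))) by ring.
rewrite mulrCA ler_wpM2l ?(ltW si0)//.
have tri : `|f b + f (1 - b) - (f a + f (1 - a))| <=
    `|f a - f b| + `|f (1 - b) - f (1 - a)|.
  rewrite (distrC (f a)); by apply: ler_normD_eq; ring.
apply: (le_trans (ler_wpM2l m0 tri)); rewrite mulrDr; apply: lerD.
  by apply: (le_trans (ler_wpM2r _ m1)) => //; rewrite -mulrA ler_wpM2l.
by apply: (le_trans (ler_wpM2r _ m2)) => //; rewrite -mulrA ler_wpM2l.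
Qed.

Lemma osc_window r f w t t' : (forall x, 2 / 5 <= x <= 3 / 5 -> 2^-1 <= r x) ->
  dominated_by r f w -> 2 / 5 <= t -> t <= t' -> t' <= 3 / 5 ->
  `|f t' - f t| <= 2 * (w t' - w t).
Proof.
move=> rh fw t0 tt t1; have h := fw t t' ltac:(lra) tt ltac:(lra).
have : 2^-1 * `|f t' - f t| <= w t' - w t.
  by apply: le_trans h; rewrite ler_wpM2r// le_min !rh//; lra.
lra.
Qed.

(** The leak samples [f] only near 1/2, where [rho] is at least 1/2, and lives on [0, e], where [r]
    is at most [delta]; the value at 1/2 pays for the jump at [e]. Two separate weights let one
    statement bound both the weighted and the flat variation of the leak by the weighted variation
    of [f]. *)
Lemma osc_leak r rho f e delta K : 0 <= e <= 4^-1 -> nonneg01 r ->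
  nonneg01 rho ->
  (forall x, 2 / 5 <= x <= 3 / 5 -> 2^-1 <= rho x) ->
  (forall y, 0 <= y <= e -> r y <= delta) -> 0 <= delta ->
  osc rho f K -> osc r (leak (2 * (1 + e)) e f) (delta * (K + `|f 2^-1|)).
Proof.
move=> e01 r0 rho0 rhoh rd d0 [w fw wK].
set s := 2 * (1 + e).
have s0 : 0 < s by rewrite /s; lra.
have si0 : 0 < s^-1 by rewrite invr_gt0.
have si1 : s^-1 <= 2^-1 by rewrite lef_pV2 ?posrE// /s; lra.
have si2 : 2 / 5 <= s^-1 by rewrite -[X in X <= _]invrK lef_pV2 ?posrE// invfM invrK /s; lra.
have sis : s^-1 * (1 + e) = 2^-1 by rewrite /s; field; lra.
have se : s^-1 * s = 1 by rewrite mulVf//; lra.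
(* At [y = e] both preimages meet at the turning point 1/2, so [om e = 0]. The factor 2 lost in
   [osc_window] is offset by 1/s <= 1/2. *)
pose om y := w ((1 + y) / s) - w (1 - (1 + y) / s).
have range y : 0 <= y <= e -> s^-1 <= (1 + y) / s <= 2^-1.
  move=> ye; rewrite -sis mulrC ler_pM2l// [X in _ && X]lerD2l.
  by rewrite -[X in X <= _]mulr1 ler_pM2l//; lra.
have step x y : 0 <= x -> x <= y -> y <= e ->
    `|Q s f (- y) - Q s f (- x)| <= om y - om x.
  move=> x0 xy ye; rewrite /Q /om !opprK -mulrBr normrM gtr0_norm//.
  have := range x ltac:(lra); have := range y ltac:(lra).
  have : (1 + x) / s <= (1 + y) / s by rewrite ler_pM2r//; lra.
  set a := (1 + x) / s; set b := (1 + y) / s => ab b1 a1.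
  have h1 := osc_window rhoh fw (t := a) (t' := b) ltac:(lra) ltac:(lra) ltac:(lra).
  have h2 := osc_window rhoh fw (t := 1 - b) (t' := 1 - a) ltac:(lra) ltac:(lra) ltac:(lra).
  rewrite distrC in h2.
  have tri : `|f b + f (1 - b) - (f a + f (1 - a))| <=
      `|f b - f a| + `|f (1 - b) - f (1 - a)|.
    by apply: ler_normD_eq; ring.
  have := ler_wpM2l (ltW si0) tri.
  have : s^-1 * (`|f b - f a| + `|f (1 - b) - f (1 - a)|) <=
    2^-1 * (`|f b - f a| + `|f (1 - b) - f (1 - a)|) by rewrite ler_wpM2r ?addr_ge0.
  lra.
have top : `|Q s f (- e)| <= `|f 2^-1|.
  rewrite /Q opprK; have -> : (1 + e) / s = 2^-1 by rewrite mulrC.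
  have -> : 1 - 2^-1 = 2^-1 :> R by field.
  have -> : s^-1 * (f 2^-1 + f 2^-1) = (2 * s^-1) * f 2^-1 by ring.
  by rewrite normrM ger0_norm ?ler_piMl//; lra.
have ome : om e = 0.
  by rewrite /om mulrC sis; have -> : 1 - 2^-1 = 2^-1 :> R by [field]; rewrite subrr.
have om_e y : 0 <= y -> y <= e -> om y <= om e.
  by move=> y0 ye; rewrite -subr_ge0; apply: le_trans (step _ _ y0 ye _).
exists (fun y => delta * (if y <= e then om y else om e + `|f 2^-1|)); last first.
  rewrite -mulrBr ler_wpM2l//; have -> : (1 <= e :> R) = false by apply/negP; lra.
  have -> : 0 <= e by lra.
  rewrite ome /om addr0 mul1r.
  have := dominated_le rho0 fw (x := 1 - s^-1) (y := 1).
  have := dominated_le rho0 fw (x := 0) (y := s^-1).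
  by move=> /(_ ltac:(lra) ltac:(lra) ltac:(lra)) ? /(_ ltac:(lra) ltac:(lra) ltac:(lra)) ?; lra.
move=> x y x0 xy y1; rewrite -mulrBr /leak.
case: (leP y e) => ye.
  rewrite (le_trans xy ye); apply: ler_pM => //; last exact: step.
  by rewrite le_min !r0//; lra.
  by rewrite ge_min rd//; lra.
case: (leP x e) => xe; last by rewrite !subrr normr0 !mulr0.
apply: ler_pM => //.
- by rewrite le_min !r0//; lra.
- by rewrite ge_min rd//; lra.
- rewrite sub0r normrN; have := step x e x0 xe (lexx _).
  have := ler_normB (Q s f (- e)) (Q s f (- e) - Q s f (- x)).
  have -> : Q s f (- e) - (Q s f (- e) - Q s f (- x)) = Q s f (- x) by ring.
  lra.
Qed.

End oscillation.

(** * Affine change of variables for Lebesgue measure *)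

Section affine_change_of_variable.
Context {R : realType}.
Local Notation leb := (@lebesgue_measure R).
Implicit Types (F : R -> \bar R) (a b : R).

Let aff a b : measurableTypeR R -> measurableTypeR R := fun x => a * x + b.

Let measurable_aff a b : measurable_fun setT (aff a b).
Proof.
apply: (@measurable_funD _ _ R setT (fun x => a * x) (cst b)); last exact: measurable_cst.
exact: mulrl_measurable.
Qed.

(** Uniqueness of Lebesgue measure reduces this to half-open intervals. For negative [a] the
    preimage is closed at the opposite end, which does not change its length. *)
Let pushforward_affine a b (A : set R) : a != 0 -> measurable A ->
  leb A = (`|a|%:E * pushforward leb (aff a b) A)%E.
Proof.
move=> a0 mA.
pose m := mscale (NngNum (normr_ge0 a)) (pushforward leb (aff a b)).
rewrite (_ : (_ * _)%E = m (measurable_aff a b) A)//.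
apply: (@lebesgue_measure_unique R (m (measurable_aff a b))) => //.
move=> _ [[c e]] _ <-.
rewrite [RHS](_ : _ = (`|a|%:E * leb (aff a b @^-1` `]c, e]))%E)//.
move: a0; rewrite neq_lt => /orP[a0|a0].
- have -> : aff a b @^-1` `]c, e] = `[(e - b) / a, (c - b) / a[%classic.
    apply/seteqP; split=> x /=; rewrite !in_itv/= /aff.
      by rewrite ler_ndivrMr// ltr_ndivlMr// [x * a]mulrC; lra.
    by rewrite ler_ndivrMr// ltr_ndivlMr// [x * a]mulrC; lra.
  rewrite !lebesgue_measure_itv/= !lte_fin ltr_nM2r ?invr_lt0// ltrD2r.
  case: ifPn => ce; last by rewrite mule0.
  rewrite -!EFinD -EFinM; congr EFin; rewrite ltr0_norm//.
  by field; rewrite lt_eqF.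
- have -> : aff a b @^-1` `]c, e] = `](c - b) / a, (e - b) / a]%classic.
    apply/seteqP; split=> x /=; rewrite !in_itv/= /aff.
      by rewrite ler_pdivlMr// ltr_pdivrMr// [x * a]mulrC; lra.
    by rewrite ler_pdivlMr// ltr_pdivrMr// [x * a]mulrC; lra.
  rewrite !lebesgue_measure_itv/= !lte_fin ltr_pM2r ?invr_gt0// ltrD2r.
  case: ifPn => ce; last by rewrite mule0.
  rewrite -!EFinD -EFinM; congr EFin; rewrite gtr0_norm//.
  by field; rewrite gt_eqF.
Qed.

Lemma ge0_integral_affine F a b : a != 0 -> measurable_fun setT F ->
  (forall x, 0 <= F x)%E ->
  (\int[leb]_x F x = `|a|%:E * \int[leb]_x F (a * x + b)%R)%E.
Proof.
move=> a0 mF F0.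
pose m := mscale (NngNum (normr_ge0 a)) (pushforward leb (aff a b)).
rewrite (_ : (\int[leb]_x F x = \int[m (measurable_aff a b)]_x F x)%E); last first.
  by apply: eq_measure_integral => // A mA _; exact: pushforward_affine.
rewrite ge0_integral_mscale//.
by rewrite ge0_integral_pushforward//; exact: measurable_aff.
Qed.

Lemma integral_affine F a b : a != 0 -> leb.-integrable setT F ->
  (\int[leb]_x F x = `|a|%:E * \int[leb]_x F (a * x + b)%R)%E /\
  leb.-integrable setT (fun x => F (a * x + b)%R).
Proof.
move=> a0 iF; have mF := measurable_int _ iF.
have mFa : measurable_fun setT (fun x => F (a * x + b)%R).
  by apply: (measurableT_comp mF); exact: measurable_aff.
have iFa : leb.-integrable setT (fun x => F (a * x + b)%R).
  apply/integrableP; split=> //.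
  have /integrableP[_] := iF.
  rewrite (@ge0_integral_affine (fun x => `|F x|%E) a b)//; last first.
    exact: measurableT_comp.
  by rewrite !ltey; apply: contra => /eqP ->; rewrite gt0_muley// lte_fin normr_gt0.
split=> //; rewrite integralE [in RHS]integralE.
rewrite (@ge0_integral_affine F^\+%E a b)//; last exact: measurable_funepos.
rewrite (@ge0_integral_affine F^\-%E a b)//; last exact: measurable_funeneg.
rewrite [in RHS]muleBr//; last first.
  by rewrite fin_num_adde_defl// fin_numN integrable_neg_fin_num.
by congr (_ * _ - _ * _)%E; apply: eq_integral => x _; rewrite /= ?funeposE ?funenegE.
Qed.

End affine_change_of_variable.

(** * Integration against normalized Lebesgue measure *)

Section normalized_lebesgue.
Context {R : realType}.
Local Notation leb := (@lebesgue_measure R).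
Local Notation lam := (lam R).
Implicit Types (f g h : R -> R).

Local Notation I11 := (`[-1, 1]%classic : set R).

Lemma ge0_lam_integral (F : R -> \bar R) :
  measurable_fun setT F -> (forall x, 0 <= F x)%E ->
  (\int[lam]_x F x = 2^-1%:E * \int[leb]_x ((\1_I11 x)%:E * F x))%E.
Proof.
move=> mF F0; rewrite integral_uniform// opprK.
have -> : 1 + 1 = 2 :> R by [].
congr (_ * _)%E; rewrite integral_mkcond; apply: eq_integral => x _.
by rewrite patchE indicE; case: (x \in I11); rewrite ?mul1e ?mul0e.
Qed.

Lemma lam_integrable f : measurable_fun setT f ->
  lam.-integrable setT (EFin \o f) <->
  leb.-integrable setT (fun x => (\1_I11 x * f x)%:E).
Proof.
move=> mf.
have m1f : measurable_fun setT (fun x => \1_I11 x * f x).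
  by apply: measurable_funM => //; exact: measurable_indic.
have E : (\int[lam]_x `|(f x)%:E| =
    2^-1%:E * \int[leb]_x `|(\1_I11 x * f x)%:E|)%E.
  rewrite ge0_lam_integral//; last first.
    by apply: measurableT_comp => //; apply/measurable_EFinP.
  congr (_ * _)%E; apply: eq_integral => x _.
  by rewrite EFinM abseM; congr (_ * _)%E; rewrite /= ger0_norm.
split=> /integrableP[_ fi]; apply/integrableP; split.
- exact/measurable_EFinP.
- move: fi; rewrite E !ltey; apply: contra => /eqP ->.
  by rewrite gt0_muley// lte_fin invr_gt0.
- exact/measurable_EFinP.
- rewrite E; move: fi; rewrite -ge0_fin_numE; last exact: integral_ge0.
  by move=> fi; rewrite ltey_eq fin_numM.
Qed.

Lemma lam_integral f : lam.-integrable setT (EFin \o f) ->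
  (\int[lam]_x (f x)%:E = 2^-1%:E * \int[leb]_x (\1_I11 x * f x)%:E)%E.
Proof.
move=> fi; have mf : measurable_fun setT f.
  by apply/measurable_EFinP; exact: (measurable_int _ fi).
have := fi; rewrite lam_integrable// => lfi.
rewrite integralE [in RHS]integralE [in RHS]muleBr//; last first.
  by rewrite fin_num_adde_defl// fin_numN integrable_neg_fin_num.
rewrite !ge0_lam_integral//; last 2 first.
- by apply: measurable_funeneg; apply/measurable_EFinP.
- by apply: measurable_funepos; apply/measurable_EFinP.
by congr (_ * _ - _ * _)%E; apply: eq_integral => x _;
  rewrite ?funeposE ?funenegE /= ?indicE; case: (x \in _);
  rewrite ?mul1e ?mul1r ?mul0e ?mul0r ?oppr0 ?maxxx ?oppe0 ?maxxx.
Qed.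

Lemma lam_ae (P : set R) : (forall x, -1 <= x <= 1 -> P x) ->
  \forall x \ae lam, P x.
Proof.
move=> hP; exists (~` I11); split => //; first exact: measurableC.
  rewrite /lam /= /uniform_prob integral_uniform_pdf setICl.
  exact: integral_set0.
by move=> x /= Px; rewrite in_itv/= => /hP.
Qed.

Lemma bounded_Lfun h (M : R) p : measurable_fun setT h ->
  (forall x, `|h x| <= M) -> (1 <= p)%E -> h \in Lfun lam p.
Proof.
move=> mh hM p1.
have hoo : h \in Lfun lam +oo%E.
  rewrite inE; apply/andP; split; rewrite inE//=.
  rewrite /finite_norm unlock /Lnorm.
  case: ifPn => // _; apply: (@le_lt_trans _ _ M%:E); last exact: ltry.
  by apply: ess_sup_ler => x; rewrite lee_fin.
apply: Lfun_subset hoo => //; rewrite ?leey//.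
exact: fin_num_measure.
Qed.

End normalized_lebesgue.

(** * The transfer operator on pairs of half-functions *)

Section duality.
Context {R : realType}.
Local Notation leb := (@lebesgue_measure R).
Local Notation lam := (lam R).
Implicit Types (f g h u v k : R -> R) (e s a b c d : R).

Local Notation I11 := (`[-1, 1]%classic : set R).
Local Notation int g := (\int[leb]_x (g x)%:E)%E.
Local Notation itg g := (leb.-integrable setT (fun x => (g x)%:E)).

(** Boundedness on the whole line is preserved by affine substitutions, products and gluing, and it
    implies integrability for [lam]. *)
Definition regular u := measurable_fun setT u /\ exists M : R, forall x, `|u x| <= M.

Lemma regular_bounded u : regular u -> [bounded u x | x in setT].
Proof.
move=> [_ [M uM]]; exists M; split; first exact: num_real.
by move=> x Mx y _ /=; apply: le_trans (uM y) (ltW Mx).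
Qed.

Lemma regular_cst c : regular (fun=> c).
Proof. by split; [exact: measurable_cst|exists `|c|]. Qed.

Lemma regularD f g : regular f -> regular g -> regular (fun x => f x + g x).
Proof.
move=> [mf [M fM]] [mg [N gN]]; split; first exact: measurable_funD.
by exists (M + N) => x; apply: le_trans (ler_normD _ _) (lerD (fM x) (gN x)).
Qed.

Lemma regularM f g : regular f -> regular g -> regular (fun x => f x * g x).
Proof.
move=> [mf [M fM]] [mg [N gN]]; split; first exact: measurable_funM.
by exists (M * N) => x; rewrite normrM ler_pM.
Qed.

Lemma regular_affine u a b : regular u -> regular (fun x => u (a * x + b)).
Proof.
move=> [mu [M uM]]; split; last by exists M => x.
apply: (measurableT_comp mu).
by apply: (@measurable_funD _ _ R setT ( *%R a) (cst b));
  [exact: mulrl_measurable|exact: measurable_cst].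
Qed.

Lemma regular_indic (A : set R) : measurable A -> regular (\1_A : R -> R).
Proof.
move=> mA; split; first exact: measurable_indic.
by exists 1 => x; rewrite indicE; case: (_ \in _); rewrite ?normr1 ?normr0.
Qed.

Lemma regular_if (A : set R) f g : measurable A -> regular f -> regular g ->
  regular (fun x => if x \in A then f x else g x).
Proof.
move=> mA rf rg.
have -> : (fun x => if x \in A then f x else g x) =
    (fun x => \1_A x * f x + \1_(~` A) x * g x).
  apply/funext => x; rewrite !indicE in_setC; case: (x \in A).
    by rewrite mul1r mul0r addr0.
  by rewrite mul0r mul1r add0r.
by apply: regularD; apply: regularM => //; apply: regular_indic => //;
  exact: measurableC.
Qed.

Lemma regular_ext f g : f =1 g -> regular f -> regular g.
Proof. by move=> /funext ->. Qed.

Lemma regular_Q s u : regular u -> regular (Q s u).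
Proof.
move=> ru; apply: (regularM (regular_cst s^-1)); apply: regularD.
  apply: regular_ext (regular_affine (- s^-1) s^-1 ru) => y.
  by congr u; ring.
apply: regular_ext (regular_affine (s^-1) (1 - s^-1) ru) => y.
by congr u; ring.
Qed.

Lemma regular_leak s e u : regular u -> regular (leak s e u).
Proof.
move=> ru; apply: (@regular_ext
   (fun x => if x \in `]-oo, e]%classic then Q s u (-1 * x + 0) else 0)).
  by move=> x; rewrite /leak mem_setE in_itv/= mulN1r addr0.
apply: (@regular_if _ (fun x => Q s u (-1 * x + 0)) (fun=> 0)) => //.
  exact/regular_affine/regular_Q.
exact: regular_cst.
Qed.

(* A function on [-1, 1] is encoded by its two halves read outward from 0. *)
Definition glue u v x : R := if x < 0 then u (- x) else v x.

Lemma regular_glue u v : regular u -> regular v -> regular (glue u v).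
Proof.
move=> ru rv; apply: (@regular_ext
   (fun x => if x \in `]-oo, 0[%classic then u (-1 * x + 0) else v x)).
  by move=> x; rewrite /glue mem_setE in_itv/= mulN1r addr0.
apply: (@regular_if _ (fun x => u (-1 * x + 0)) v) => //.
exact: regular_affine.
Qed.

Lemma itgM k h : regular k -> itg h -> itg (fun x => k x * h x).
Proof.
move=> rk ih; have := @integrableMr _ (measurableTypeR R) R leb setT measurableT k _ rk.1
  (regular_bounded rk) ih.
by apply: eq_integrable.
Qed.

Let int_affine a b g : a != 0 -> itg g ->
  int (fun x => g (a * x + b)) = (`|a|^-1%:E * int g)%E /\
  itg (fun x => g (a * x + b)).
Proof.
move=> a0 ig; have [E i] := integral_affine b a0 ig; split => //.
by rewrite E muleA -EFinM mulVf ?normr_eq0// mul1e.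
Qed.

Let intD f g : itg f -> itg g ->
  int (fun x => f x + g x) = (int f + int g)%E.
Proof. by move=> fi gi; rewrite -integralD. Qed.

Let itgD f g : itg f -> itg g -> itg (fun x => f x + g x).
Proof. by move=> fi gi; apply: eq_integrable (integrableD _ fi gi). Qed.

Let intZ f c : itg f -> int (fun x => c * f x) = (c%:E * int f)%E.
Proof. by move=> fi; rewrite -integralZl. Qed.

Let itgZ f c : itg f -> itg (fun x => c * f x).
Proof. by move=> fi; apply: eq_integrable (integrableZl _ c fi). Qed.

Definition step_right e1 e2 u v y : R :=
  Q (2 * (1 + e2)) v y + leak (2 * (1 + e1)) e1 u y.

(** Reading both halves outward from 0 makes the dynamics symmetric under exchange of the halves, so
    estimates for [step_right] cover this one too. *)
Definition step_left e1 e2 u v y : R := step_right e2 e1 v u y.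

Let finite_eq f g (S : set R) : finite_set S ->
  measurable_fun setT f -> measurable_fun setT g ->
  (forall x, ~ S x -> f x = g x) -> itg g -> itg f /\ int f = int g.
Proof.
move=> fS mf mg fg ig.
have nS : leb.-negligible S.
  exists S; split => //; last exact/countable_lebesgue_measure0/finite_set_countable.
  exact/countable_measurable/finite_set_countable.
have ae : ae_eq leb setT (fun x => (f x)%:E) (fun x => (g x)%:E).
  apply: negligibleS nS => x /= h; apply: contrapT => nSx; apply: h => _.
  by rewrite fg.
split; last first.
  by apply: ae_eq_integral => //; exact/measurable_EFinP.
apply/integrableP; split; first exact/measurable_EFinP.
have /integrableP[_] := ig.
rewrite [X in (X < _)%E -> _](@ae_eq_integral _ _ _ leb setT
  (fun x => `|(f x)%:E|)%E)//.
- by apply: measurableT_comp => //; exact/measurable_EFinP.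
- by apply: measurableT_comp => //; exact/measurable_EFinP.
- apply: filterS ae => x /= h _. by have [->] := h I.
Qed.

Let measurable_affine a b : measurable_fun (setT : set (measurableTypeR R)) (fun x : R => a * x + b).
Proof.
by apply: (@measurable_funD _ _ R setT ( *%R a) (cst b));
  [exact: mulrl_measurable|exact: measurable_cst].
Qed.

Lemma measurable_tent e1 e2 :
  measurable_fun (setT : set (measurableTypeR R)) (tent e1 e2).
Proof.
have mle c : measurable_fun (setT : set (measurableTypeR R)) (fun x : R => x <= c).
  by apply: measurable_fun_ler => //; exact: measurable_cst.
apply: measurable_fun_ifT; first by apply: measurable_fun_eqr => //; exact: measurable_cst.
  exact: measurable_cst.
apply: measurable_fun_ifT; first exact: mle.
  have -> : (fun t => 2 * (1 + e1) * (t + 1) - 1) =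
    (fun t => (2 * (1 + e1)) * t + (2 * (1 + e1) - 1)) by apply/funext => t; ring.
  exact: measurable_affine.
apply: measurable_fun_ifT; first by apply: measurable_fun_ltr => //; exact: measurable_cst.
  exact: measurable_affine.
apply: measurable_fun_ifT; first exact: mle.
  exact: measurable_affine.
have -> : (fun t => 2 * (1 + e2) * (t - 1) + 1) =
  (fun t => (2 * (1 + e2)) * t + (- (2 * (1 + e2)) + 1)) by apply/funext => t; ring.
exact: measurable_affine.
Qed.

Let restrict_itv c d y h (b : bool) t : -1 <= c -> d <= 1 ->
  (c <= y <= d) = b ->
  \1_(`[c, d]%classic) y * t * (\1_I11 y * h y) = b%:R * t * h y.
Proof.
move=> c1 d1 <-; rewrite !indicE !mem_setE !in_itv/=.
case: (boolP (c <= y <= d)) => cyd; last by rewrite !mul0r.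
have -> : -1 <= y <= 1 by lra.
by rewrite !mul1r.
Qed.

(** Boolean coefficients allow each branch to be integrated over the whole line. At the break points
    two closed branch domains meet and would be counted twice. *)
Lemma tent_split e1 e2 u v h x : x != - 2^-1 -> x != 0 -> x != 2^-1 ->
  (-1 <= x <= 1)%R%:R * (glue u v x * h (tent e1 e2 x)) =
  ((0 <= x <= 2^-1)%R%:R * v x * h (- (2 * (1 + e2)) * x + 1) +
   (2^-1 <= x <= 1)%R%:R * v x * h (2 * (1 + e2) * x + (1 - 2 * (1 + e2)))) +
  ((- 2^-1 <= x <= 0)%R%:R * u (- x) * h (- (2 * (1 + e1)) * x + -1) +
   (-1 <= x <= - 2^-1)%R%:R * u (- x) * h (2 * (1 + e1) * x + (2 * (1 + e1) - 1))).
Proof.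
move=> x1 x2 x3; rewrite /tent /glue (negbTE x2).
have -> : 2 * (1 + e1) * (x + 1) - 1 = 2 * (1 + e1) * x + (2 * (1 + e1) - 1) by ring.
have -> : - 2 * (1 + e1) * x - 1 = - (2 * (1 + e1)) * x + -1 by ring.
have -> : - 2 * (1 + e2) * x + 1 = - (2 * (1 + e2)) * x + 1 by ring.
have -> : 2 * (1 + e2) * (x - 1) + 1 = 2 * (1 + e2) * x + (1 - 2 * (1 + e2)) by ring.
have {}x1 : x < - 2^-1 \/ - 2^-1 < x by move: x1; rewrite neq_lt => /orP.
have {}x2 : x < 0 \/ 0 < x by move: x2; rewrite neq_lt => /orP.
have {}x3 : x < 2^-1 \/ 2^-1 < x by move: x3; rewrite neq_lt => /orP.
have [c|c] : x < -1 \/ -1 <= x by case: (ltP x (-1)); [left|right].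
  have -> : (-1 <= x <= 1) = false by apply/negP; lra.
  have -> : (0 <= x <= 2^-1) = false by apply/negP; lra.
  have -> : (2^-1 <= x <= 1) = false by apply/negP; lra.
  have -> : (- 2^-1 <= x <= 0) = false by apply/negP; lra.
  have -> : (-1 <= x <= - 2^-1) = false by apply/negP; lra.
  by rewrite !mul0r !addr0.
case: x1 => [c1|c1].
  have -> : (-1 <= x <= 1) = true by apply/idP; lra.
  have -> : (0 <= x <= 2^-1) = false by apply/negP; lra.
  have -> : (2^-1 <= x <= 1) = false by apply/negP; lra.
  have -> : (- 2^-1 <= x <= 0) = false by apply/negP; lra.
  have -> : (-1 <= x <= - 2^-1) = true by apply/idP; lra.
  have -> : (x <= - 2^-1) = true by apply/idP; lra.
  have -> : (x < 0) = true by apply/idP; lra.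
  by rewrite /= !mul0r !mul1r !add0r.
case: x2 => [c2|c2].
  have -> : (-1 <= x <= 1) = true by apply/idP; lra.
  have -> : (0 <= x <= 2^-1) = false by apply/negP; lra.
  have -> : (2^-1 <= x <= 1) = false by apply/negP; lra.
  have -> : (- 2^-1 <= x <= 0) = true by apply/idP; lra.
  have -> : (-1 <= x <= - 2^-1) = false by apply/negP; lra.
  have -> : (x <= - 2^-1) = false by apply/negP; lra.
  have -> : (x < 0) = true by apply/idP; lra.
  by rewrite /= !mul0r !mul1r !add0r addr0.
have -> : (- 2^-1 <= x <= 0) = false by apply/negP; lra.
have -> : (-1 <= x <= - 2^-1) = false by apply/negP; lra.
have -> : (x <= - 2^-1) = false by apply/negP; lra.
have -> : (x < 0) = false by apply/negP; lra.
case: x3 => [c3|c3].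
  have -> : (-1 <= x <= 1) = true by apply/idP; lra.
  have -> : (0 <= x <= 2^-1) = true by apply/idP; lra.
  have -> : (2^-1 <= x <= 1) = false by apply/negP; lra.
  have -> : (x <= 2^-1) = true by apply/idP; lra.
  by rewrite /= !mul0r !mul1r !addr0.
have -> : (0 <= x <= 2^-1) = false by apply/negP; lra.
have -> : (x <= 2^-1) = false by apply/negP; lra.
have [c4|c4] : x <= 1 \/ 1 < x by case: (leP x 1); [left|right].
  have -> : (-1 <= x <= 1) = true by apply/idP; lra.
  have -> : (2^-1 <= x <= 1) = true by apply/idP; lra.
  by rewrite /= !mul0r !mul1r !addr0 add0r.
have -> : (-1 <= x <= 1) = false by apply/negP; lra.
have -> : (2^-1 <= x <= 1) = false by apply/negP; lra.
by rewrite !mul0r !addr0.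
Qed.

(** The halves have images [-e2, 1] and [-1, e1]. Each image covers one half completely, and its
    remainder is the leak into the other. *)
Let glue_split e1 e2 y (p q : R) : 0 <= e1 <= 1 -> 0 <= e2 <= 1 ->
  (- e2 <= y <= 1)%R%:R * p + (-1 <= y <= e1)%R%:R * q =
  (-1 <= y <= 1)%R%:R * (if y < 0 then q + (if - y <= e2 then p else 0)
                       else p + (if y <= e1 then q else 0)).
Proof.
move=> e1b e2b; case: (ltP y 0) => y0.
  have -> : (-1 <= y <= e1) = (-1 <= y <= 1) by apply/idP/idP; lra.
  have -> : (- e2 <= y <= 1) = (-1 <= y <= 1) && (- y <= e2).
    by apply/idP/idP => [h|/andP[h1 h2]]; [apply/andP; split; lra|lra].
  by case: (-1 <= y <= 1); case: (- y <= e2); rewrite /= ?mul0r ?mul1r ?addr0 ?add0r // addrC.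
have -> : (- e2 <= y <= 1) = (-1 <= y <= 1) by apply/idP/idP; lra.
have -> : (-1 <= y <= e1) = (-1 <= y <= 1) && (y <= e1).
    by apply/idP/idP => [h|/andP[h1 h2]]; [apply/andP; split; lra|lra].
by case: (-1 <= y <= 1); case: (y <= e1); rewrite /= ?mul0r ?mul1r ?addr0 ?add0r.
Qed.

Section branches.
Variables (e x : R).
Let s := 2 * (1 + e).
Hypothesis s0 : 0 < s.

Let sE : 1 + e = s * 2^-1. Proof. by rewrite /s; field. Qed.

Lemma branch_right1 : (- e <= - s * x + 1 <= 1) = (0 <= x <= 2^-1).
Proof.
rewrite andbC; congr (_ && _).
  by rewrite -(pmulr_rge0 x s0); apply/idP/idP; lra.
by rewrite -[in RHS](ler_pM2l s0) -sE; apply/idP/idP; lra.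
Qed.

Lemma branch_right2 : (- e <= s * x + (1 - s) <= 1) = (2^-1 <= x <= 1).
Proof.
congr (_ && _); rewrite -[in RHS](ler_pM2l s0).
  by rewrite -sE /s; apply/idP/idP; lra.
by apply/idP/idP; lra.
Qed.

Lemma branch_left1 : (-1 <= - s * x + -1 <= e) = (- 2^-1 <= x <= 0).
Proof.
rewrite andbC; congr (_ && _).
  by rewrite -[in RHS](ler_pM2l s0) mulrN -sE; apply/idP/idP; lra.
by rewrite -(pmulr_rle0 x s0); apply/idP/idP; lra.
Qed.

Lemma branch_left2 : (-1 <= s * x + (s - 1) <= e) = (-1 <= x <= - 2^-1).
Proof.
congr (_ && _); rewrite -[in RHS](ler_pM2l s0).
  by apply/idP/idP; lra.
by rewrite mulrN -sE /s; apply/idP/idP; lra.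
Qed.
End branches.

(** One change of variables per branch: [G1] to [G4] are the four contributions as functions of the
    image point. Composed with the branches they give the right-hand integrand ([FE]); weighted by
    the inverse slopes they give the left-hand one ([GE]). *)
Lemma tent_duality e1 e2 u v h : 0 <= e1 <= 1 -> 0 <= e2 <= 1 ->
  regular u -> regular v -> lam.-integrable setT (EFin \o h) ->
  (\int[lam]_x (glue (step_left e1 e2 u v) (step_right e1 e2 u v) x * h x)%:E =
  \int[lam]_x (glue u v x * h (tent e1 e2 x))%:E)%E.
Proof.
move=> e1b e2b ru rv hi.
set s1 := 2 * (1 + e1); set s2 := 2 * (1 + e2).
have s1p : 0 < s1 by rewrite /s1; lra.
have s2p : 0 < s2 by rewrite /s2; lra.
have ne2 : -1 <= - e2 by lra.
have le1 : e1 <= 1 by lra.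
have P2 : s2 != 0 by rewrite gt_eqF.
have P1 : s1 != 0 by rewrite gt_eqF.
have N2 : - s2 != 0 by rewrite oppr_eq0.
have N1 : - s1 != 0 by rewrite oppr_eq0.
have mh : measurable_fun setT h.
  by apply/measurable_EFinP; exact: (measurable_int _ hi).
pose H x := \1_I11 x * h x.
have iH : itg H by move: hi; rewrite lam_integrable.
pose A := `[- e2, 1]%classic : set R; pose B := `[-1, e1]%classic : set R.
pose G1 y := \1_A y * v (- s2^-1 * y + s2^-1) * H y.
pose G2 y := \1_A y * v (s2^-1 * y + (1 - s2^-1)) * H y.
pose G3 y := \1_B y * u (s1^-1 * y + s1^-1) * H y.
pose G4 y := \1_B y * u (- s1^-1 * y + (1 - s1^-1)) * H y.
have mA : measurable A by exact: measurable_itv.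
have mB : measurable B by exact: measurable_itv.
have i1 : itg G1 by apply: itgM => //; apply: regularM; [exact: regular_indic|exact: regular_affine].
have i2 : itg G2 by apply: itgM => //; apply: regularM; [exact: regular_indic|exact: regular_affine].
have i3 : itg G3 by apply: itgM => //; apply: regularM; [exact: regular_indic|exact: regular_affine].
have i4 : itg G4 by apply: itgM => //; apply: regularM; [exact: regular_indic|exact: regular_affine].
have [E1 j1] := @int_affine (- s2) 1 G1 N2 i1.
have [E2 j2] := @int_affine s2 (1 - s2) G2 P2 i2.
have [E3 j3] := @int_affine (- s1) (-1) G3 N1 i3.
have [E4 j4] := @int_affine s1 (s1 - 1) G4 P1 i4.
pose F x := (G1 (- s2 * x + 1) + G2 (s2 * x + (1 - s2))) +
            (G3 (- s1 * x + -1) + G4 (s1 * x + (s1 - 1))).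
have iF : itg F by apply: itgD; apply: itgD.
have FE x : ~ [set - 2^-1; 0; 2^-1] x ->
    \1_I11 x * (glue u v x * h (tent e1 e2 x)) = F x.
  move=> /= xS; rewrite /F /G1 /G2 /G3 /G4 /H.
  rewrite (@restrict_itv _ _ _ _ _ _ ne2 (lexx 1) (branch_right1 _ s2p)).
  rewrite (@restrict_itv _ _ _ _ _ _ ne2 (lexx 1) (branch_right2 _ s2p)).
  rewrite (@restrict_itv _ _ _ _ _ _ (lexx _) le1 (branch_left1 _ s1p)).
  rewrite (@restrict_itv _ _ _ _ _ _ (lexx _) le1 (branch_left2 _ s1p)).
  have -> : - s2^-1 * (- s2 * x + 1) + s2^-1 = x by field.
  have -> : s2^-1 * (s2 * x + (1 - s2)) + (1 - s2^-1) = x by field.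
  have -> : s1^-1 * (- s1 * x + -1) + s1^-1 = - x by field.
  have -> : - s1^-1 * (s1 * x + (s1 - 1)) + (1 - s1^-1) = - x by field.
  have x1 : x != - 2^-1 by apply/eqP => xE; apply: xS; left; left.
  have x2 : x != 0 by apply/eqP => xE; apply: xS; left; right.
  have x3 : x != 2^-1 by apply/eqP => xE; apply: xS; right.
  by rewrite indicE mem_setE in_itv/= tent_split.
have GE y : s2^-1 * G1 y + s2^-1 * G2 y + (s1^-1 * G3 y + s1^-1 * G4 y) =
    \1_I11 y * (glue (step_left e1 e2 u v) (step_right e1 e2 u v) y * h y).
  rewrite /G1 /G2 /G3 /G4 /H !(@restrict_itv _ _ _ _ _ _ ne2 (lexx 1) erefl).
  rewrite !(@restrict_itv _ _ _ _ _ _ (lexx _) le1 erefl).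
  rewrite indicE mem_setE in_itv/= /glue /step_left /step_right /leak.
  have -> : - s2^-1 * y + s2^-1 = (1 - y) / s2 by ring.
  have -> : s2^-1 * y + (1 - s2^-1) = 1 - (1 - y) / s2 by ring.
  have -> : s1^-1 * y + s1^-1 = (1 - - y) / s1 by ring.
  have -> : - s1^-1 * y + (1 - s1^-1) = 1 - (1 - - y) / s1 by ring.
  have := @glue_split e1 e2 y (Q s2 v y * h y) (Q s1 u (- y) * h y) e1b e2b.
  rewrite [RHS](_ : _ = (-1 <= y <= 1)%R%:R * ((if y < 0
     then Q s1 u (- y) + (if - y <= e2 then Q s2 v (- - y) else 0)
     else Q s2 v y + (if y <= e1 then Q s1 u (- y) else 0)) * h y)).
    by move=> <-; rewrite /Q; ring.
  rewrite opprK; congr (_ * _).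
  by case: ifP => _; case: ifP => _; rewrite ?addr0 ?mulrDl.
have rg : regular (glue (step_left e1 e2 u v) (step_right e1 e2 u v)).
  by apply: regular_glue; apply: regularD;
    [exact: regular_Q|exact: regular_leak|exact: regular_Q|exact: regular_leak].
have rf := regular_glue ru rv.
have mhT : measurable_fun setT (fun x => h (tent e1 e2 x)).
  exact: (measurableT_comp mh (measurable_tent e1 e2)).
have mf : measurable_fun setT (fun x => glue u v x * h (tent e1 e2 x)).
  by apply: measurable_funM => //; exact: rf.1.
have m1f : measurable_fun setT (fun x => \1_I11 x * (glue u v x * h (tent e1 e2 x))).
  by apply: measurable_funM => //; exact: measurable_indic.
have mF : measurable_fun setT F by apply/measurable_EFinP; exact: (measurable_int _ iF).
have [i1f EF] := finite_eq (finite_set3 _ _ _) m1f mF FE iF.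
rewrite lam_integral; last first.
  by have := @integrableMr _ (measurableTypeR R) R lam setT measurableT _ _ rg.1
    (regular_bounded rg) hi; apply: eq_integrable.
rewrite lam_integral; last exact/lam_integrable.
congr (_ * _)%E; rewrite EF.
have -> : int (fun x => \1_I11 x *
  (glue (step_left e1 e2 u v) (step_right e1 e2 u v) x * h x)) =
  int (fun y => s2^-1 * G1 y + s2^-1 * G2 y + (s1^-1 * G3 y + s1^-1 * G4 y)).
  by apply: eq_integral => y _; rewrite GE.
rewrite intD ?intD; try by repeat (apply: itgD || apply: itgZ).
rewrite !intZ// E1 E2 E3 E4.
by rewrite !normrN !gtr0_norm.
Qed.

End duality.

(** * Identification of the Perron-Frobenius operator *)

Section perron_frobenius.
Context {R : realType}.
Local Notation lam := (lam R).
Implicit Types (f g h u v : R -> R) (e : R) (T : R -> R).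

Lemma ae_imp (P P' : set R) : (forall x, P x -> P' x) ->
  (\forall x \ae lam, P x) -> \forall x \ae lam, P' x.
Proof.
move=> PP' [N [mN N0 PN]]; exists N; split => // x nP'.
by apply: PN => Px; apply: nP'; exact: PP'.
Qed.

Lemma ae_imp2 (P P' P'' : set R) : (forall x, P x -> P' x -> P'' x) ->
  (\forall x \ae lam, P x) -> (\forall x \ae lam, P' x) -> \forall x \ae lam, P'' x.
Proof.
move=> PP hP hP'; have := negligibleU hP hP'.
by apply: negligibleS => x /= nP; apply: contrapT => /not_orP[/contrapT p /contrapT p']; exact/nP/PP.
Qed.

Lemma ae_eqP f g : f = g %[ae lam] <-> \forall x \ae lam, f x = g x.
Proof. by split; apply: ae_imp => x //; apply. Qed.

Lemma Lfun1_measurable f : f \in Lfun lam 1%E -> measurable_fun setT f.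
Proof.
by move=> /Lfun1_integrable fi; apply/measurable_EFinP; exact: (measurable_int _ fi).
Qed.

(** The sign of [g1 - g2] is a bounded test function, and against it the difference integrates to
    its L1 norm. *)
Lemma is_PF_unique T f g1 g2 : is_PF T f g1 -> is_PF T f g2 -> g1 = g2 %[ae lam].
Proof.
move=> [Lg1 E1] [Lg2 E2].
have m1 := Lfun1_measurable Lg1; have m2 := Lfun1_measurable Lg2.
pose h x : R := if g2 x <= g1 x then 1 else -1.
have rh : regular h.
  split; last by exists 1 => x; rewrite /h; case: ifP; rewrite ?normrN normr1.
  by apply: measurable_fun_ifT; [exact: measurable_fun_ler|exact: measurable_cst..].
have Lh : h \in Lfun lam +oo%E.
  by have [mh [M hM]] := rh; apply: (bounded_Lfun mh hM); rewrite leey.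
have ih g : g \in Lfun lam 1%E -> lam.-integrable setT (fun x => (g x * h x)%:E).
  move=> /Lfun1_integrable gi.
  have := @integrableMl _ (measurableTypeR R) R lam setT measurableT _ _ gi rh.1
    (regular_bounded rh).
  by apply: eq_integrable.
have iD : lam.-integrable setT (fun x => (g1 x - g2 x)%:E).
  move: Lg1 Lg2 => /Lfun1_integrable i1 /Lfun1_integrable i2.
  by apply: eq_integrable (integrableB _ i1 i2).
have D0 : (\int[lam]_x `|(g1 x - g2 x)%:E| = 0)%E.
  transitivity (\int[lam]_x ((g1 x * h x)%:E - (g2 x * h x)%:E))%E.
    apply: eq_integral => x _; rewrite -EFinB -mulrBl /h /=; congr EFin.
    case: leP => g12; first by rewrite mulr1 ger0_norm// subr_ge0.
    by rewrite mulrN1 ltr0_norm// subr_lt0.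
  rewrite integralB//; [|exact: ih..].
  rewrite E1// E2// subee// -E2//; apply: integrable_fin_num => //; exact: ih.
move/(ae_eq_integral_abs lam measurableT (measurable_int _ iD)) : D0.
apply: ae_imp => x /= /(_ I)[] /eqP; rewrite subr_eq0 => /eqP xE _.
exact: xE.
Qed.

Lemma is_PF_glue e1 e2 u v f : 0 <= e1 <= 1 -> 0 <= e2 <= 1 ->
  regular u -> regular v -> f \in Lfun lam 1%E -> f = glue u v %[ae lam] ->
  is_PF (tent e1 e2) f (glue (step_left e1 e2 u v) (step_right e1 e2 u v)).
Proof.
move=> e1b e2b ru rv Lf fE; split.
  have [mg [M gM]] : regular (glue (step_left e1 e2 u v) (step_right e1 e2 u v)).
    by apply: regular_glue; apply: regularD;
      [exact: regular_Q|exact: regular_leak|exact: regular_Q|exact: regular_leak].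
  exact: (bounded_Lfun mg gM).
move=> h Lh.
have Lh1 : h \in Lfun lam 1%E.
  by apply: Lfun_subset Lh; rewrite ?leey//; exact: fin_num_measure.
have mh := Lfun1_measurable Lh1.
have hi : lam.-integrable setT (EFin \o h) by apply/Lfun1_integrable.
rewrite tent_duality//; apply/esym.
have mhT : measurable_fun setT (fun x => h (tent e1 e2 x)).
  exact: (measurableT_comp mh (measurable_tent e1 e2)).
apply: ae_eq_integral => //.
- by apply/measurable_EFinP; apply: measurable_funM => //; exact: Lfun1_measurable.
- by apply/measurable_EFinP; apply: measurable_funM => //; exact: (regular_glue ru rv).1.
- by apply: ae_imp fE => x /= h1 _; rewrite h1.
Qed.

(** The explicit pair provides the inhabitant without which [xget] would return its default. *)
Lemma PF_glue e1 e2 u v f : 0 <= e1 <= 1 -> 0 <= e2 <= 1 ->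
  regular u -> regular v -> f \in Lfun lam 1%E -> f = glue u v %[ae lam] ->
  PF (tent e1 e2) f \in Lfun lam 1%E /\
  PF (tent e1 e2) f = glue (step_left e1 e2 u v) (step_right e1 e2 u v) %[ae lam].
Proof.
move=> e1b e2b ru rv Lf fE; have P := is_PF_glue e1b e2b ru rv Lf fE.
have P' : is_PF (tent e1 e2) f (PF (tent e1 e2) f)
  by apply: xgetPex; exists (glue (step_left e1 e2 u v) (step_right e1 e2 u v)).
by split; [exact: P'.1|exact: is_PF_unique P' P].
Qed.

End perron_frobenius.

(** * Expectations and the square-root weight *)

Section expectation.
Context {R : realType}.
Local Notation leb := (@lebesgue_measure R).
Local Notation lam := (lam R).
Implicit Types (f g h u v : R -> R) (e c s kappa K : R).

Definition Ex f : R := (\int[lam]_x f x)%R.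

Lemma regular_integrable f : regular f -> lam.-integrable setT (EFin \o f).
Proof. by move=> [mf [M fM]]; apply/Lfun1_integrable/(bounded_Lfun mf fM). Qed.

Lemma ExE f : regular f -> (Ex f)%:E = (\int[lam]_x (f x)%:E)%E.
Proof.
move=> rf; rewrite /Ex /Rintegral fineK//.
exact: (integrable_fin_num _ (regular_integrable rf)).
Qed.

Lemma ExD f g : regular f -> regular g -> Ex (fun x => f x + g x) = Ex f + Ex g.
Proof. by move=> rf rg; rewrite /Ex RintegralD//; exact: regular_integrable. Qed.

Lemma ExZ c f : regular f -> Ex (fun x => c * f x) = c * Ex f.
Proof. by move=> rf; rewrite /Ex RintegralZl//; exact: regular_integrable. Qed.

Lemma Ex_ae f g : measurable_fun setT f -> measurable_fun setT g ->
  (\forall x \ae lam, f x = g x) -> Ex f = Ex g.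
Proof.
move=> mf mg fg; rewrite /Ex /Rintegral; congr fine.
apply: ae_eq_integral => //; [exact/measurable_EFinP..|].
by apply: ae_imp fg => x /= -> _.
Qed.

Lemma lam_ae_finite (P : set R) (S : set R) : finite_set S ->
  (forall x, -1 <= x <= 1 -> ~ S x -> P x) -> \forall x \ae lam, P x.
Proof.
move=> fS hP.
have h1 : \forall x \ae lam, -1 <= x <= 1 by exact: lam_ae.
have h2 : \forall x \ae lam, ~ S x.
  exists S; split => [| |x /= /contrapT//].
    exact/countable_measurable/finite_set_countable.
  have /null_content_dominatesP := @dominates_uniform_prob R (-1) 1 (ltN11 R).
  apply; first exact/countable_measurable/finite_set_countable.
  exact/countable_lebesgue_measure0/finite_set_countable.
by apply: ae_imp2 h1 h2.
Qed.

Lemma Ex_eq f g (S : set R) : finite_set S -> regular f -> regular g ->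
  (forall x, -1 <= x <= 1 -> ~ S x -> f x = g x) -> Ex f = Ex g.
Proof.
move=> fS rf rg fg; apply: Ex_ae; [exact: rf.1|exact: rg.1|].
exact: lam_ae_finite fS fg.
Qed.

Lemma Ex_le f g : regular f -> regular g ->
  (forall x, -1 <= x <= 1 -> f x <= g x) -> Ex f <= Ex g.
Proof.
move=> rf rg fg.
have r1 : regular (\1_(`[-1, 1]%classic : set R) : R -> R) by exact: regular_indic.
have E k : regular k -> Ex k = Ex (fun x => \1_(`[-1, 1]%classic : set R) x * k x).
  move=> rk; apply: (@Ex_eq _ _ set0) => //; first exact: regularM.
  by move=> x x1 _; rewrite indicE mem_setE in_itv/= x1 mul1r.
rewrite E// [leRHS]E//; apply: le_Rintegral => //.
- by apply: regular_integrable; exact: regularM.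
- by apply: regular_integrable; exact: regularM.
move=> x _; rewrite indicE mem_setE in_itv/=.
by case: (boolP (-1 <= x <= 1)) => [/fg|]; rewrite ?mul1r ?mul0r.
Qed.

Lemma Ex_norm f g : regular f -> regular g ->
  (forall x, -1 <= x <= 1 -> `|f x| <= g x) -> `|Ex f| <= Ex g.
Proof.
move=> rf rg fg; rewrite ler_norml; apply/andP; split.
  rewrite -mulN1r -ExZ//; apply: Ex_le => //.
    by apply: regularM => //; exact: regular_cst.
  by move=> x /fg; rewrite ler_norml mulN1r => /andP[].
by apply: Ex_le => // x /fg; rewrite ler_norml => /andP[].
Qed.

Lemma Ex_cst c : Ex (fun=> c) = c.
Proof.
by rewrite /Ex Rintegral_cst// [X in fine X]probability_setT mulr1.
Qed.

Lemma Ex_lebesgue f : regular f ->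
  (Ex f)%:E = (2^-1%:E * \int[leb]_x (\1_(`[-1, 1]%classic : set R) x * f x)%:E)%E.
Proof. by move=> rf; rewrite ExE// lam_integral//; exact: regular_integrable. Qed.

Lemma Ex_flip c f : regular f -> (forall x, ~~ (-1 <= x <= 1) -> f x = 0) ->
  (forall x, ~~ (-1 <= x <= 1) -> f (c - x) = 0) ->
  Ex (fun x => f (c - x)) = Ex f.
Proof.
move=> rf f0 fc0.
have rfc : regular (fun x => f (c - x)).
  by apply: regular_ext (regular_affine (-1) c rf) => x; congr f; ring.
have drop g : (forall x, ~~ (-1 <= x <= 1) -> g x = 0) ->
    (fun x => \1_(`[-1, 1]%classic : set R) x * g x) = g.
  move=> g0; apply/funext => x; rewrite indicE mem_setE in_itv/=.
  by case: (boolP (-1 <= x <= 1)) => [_|/g0 ->]; rewrite ?mul1r ?mulr0.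
apply: EFin_inj; rewrite !Ex_lebesgue//; congr (_ * _)%E.
have fi : leb.-integrable setT (fun x => (f x)%:E).
  have := regular_integrable rf; rewrite lam_integrable//; last exact: rf.1.
  by apply: eq_integrable => // x _; rewrite -[in RHS](drop f f0).
have N1 : -1 != 0 :> R by rewrite oppr_eq0 oner_neq0.
have [E _] := integral_affine (F := fun x => (f x)%:E) c N1 fi.
transitivity (\int[leb]_x (f (c - x))%:E)%E.
  apply: eq_integral => x _; congr EFin.
  exact: (congr1 (fun k => k x) (drop _ fc0)).
rewrite [RHS](_ : _ = \int[leb]_x (f x)%:E)%E; last first.
  apply: eq_integral => x _; congr EFin.
  exact: (congr1 (fun k => k x) (drop _ f0)).
rewrite E normrN1 mul1e; apply: eq_integral => x _.
by congr (f _)%:E; rewrite mulN1r addrC.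
Qed.

Lemma Ex_itv a b : -1 <= a -> a <= b -> b <= 1 ->
  Ex (\1_(`[a, b]%classic : set R)) = (b - a) / 2.
Proof.
move=> a1 ab b1.
have rab : regular (\1_(`[a, b]%classic : set R) : R -> R) by exact: regular_indic.
apply: EFin_inj; rewrite Ex_lebesgue// mulrC EFinM; congr (_ * _)%E.
transitivity (\int[leb]_x (\1_(`[a, b]%classic : set R) x)%:E)%E.
  apply: eq_integral => x _; congr EFin; rewrite !indicE !mem_setE !in_itv/=.
  case: (boolP (a <= x <= b)) => xab; last by rewrite mulr0.
  by have -> : -1 <= x <= 1 by [lra]; rewrite mul1r.
rewrite integral_indic// setIT.
transitivity (@lebesgue_measure R [set` `[a, b]]); first by [].
rewrite lebesgue_measure_itv/= lte_fin.
by move: ab; rewrite le_eqVlt => /predU1P[->|->]; rewrite ?ltxx ?subrr.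
Qed.

Definition rho kappa x : R := Num.sqrt (Num.min x (1 - x) + kappa).

Lemma rho_nonneg kappa : nonneg01 (rho kappa).
Proof. by move=> x _; exact: sqrtr_ge0. Qed.

Lemma rho_le1 kappa x : kappa <= 4^-1 -> rho kappa x <= 1.
Proof.
move=> k1; rewrite -[leRHS]sqrtr1 ler_sqrt ?ltr01//.
by case: (leP x (1 - x)); lra.
Qed.

Lemma rho_ge_half kappa x : 0 <= kappa -> 2 / 5 <= x <= 3 / 5 ->
  2^-1 <= rho kappa x.
Proof.
move=> k0 xb; have -> : 2^-1 = Num.sqrt (2^-1 ^+ 2) :> R.
  by rewrite sqrtr_sqr ger0_norm// invr_ge0.
rewrite ler_sqrt; first by rewrite expr2; case: (leP x (1 - x)); lra.
by case: (leP x (1 - x)); lra.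
Qed.

(** Since min (y, 1 - y) <= 1 - y = s ((1 - y) / s), the square of the weight grows by at most the
    factor [s]. *)
Lemma rho_expand kappa s y : 0 <= kappa -> 2 <= s -> 0 <= y <= 1 ->
  rho kappa y <= Num.sqrt s * rho kappa ((1 - y) / s).
Proof.
move=> k0 s2 yb; have s0 : 0 < s by lra.
have t0 : 0 <= (1 - y) / s by rewrite divr_ge0; lra.
have t1 : (1 - y) / s <= 2^-1 by rewrite ler_pdivrMr//; lra.
have st : s * ((1 - y) / s) = 1 - y by rewrite mulrCA mulfV ?mulr1// gt_eqF.
rewrite /rho -sqrtrM; last lra.
have -> : Num.min ((1 - y) / s) (1 - (1 - y) / s) = (1 - y) / s by apply: min_l; lra.
have sk : kappa <= s * kappa by rewrite ler_peMl//; lra.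
rewrite ler_sqrt mulrDr st; first by case: (leP y (1 - y)); lra.
lra.
Qed.

Lemma rho_symm kappa y : rho kappa (1 - y) = rho kappa y.
Proof. by rewrite /rho minC; congr (Num.sqrt (Num.min _ _ + _)); ring. Qed.

Lemma rho_edge kappa e y : 0 <= y <= e -> e <= kappa ->
  rho kappa y <= Num.sqrt (2 * kappa).
Proof.
move=> yb ek; rewrite ler_sqrt; last lra.
by case: (leP y (1 - y)); lra.
Qed.

(** Together with its reflection in 1/2 it dominates the inverse of [rho] on [0, 1], which avoids
    integrating a minimum. *)
Definition inv_sqrt kappa x : R := (Num.sqrt (x + kappa))^-1.

Lemma inv_sqrt_integral kappa : 0 < kappa ->
  (\int[leb]_(x in `[0%R, 1%R]) (inv_sqrt kappa x)%:E =
   (2 * Num.sqrt (1 + kappa) - 2 * Num.sqrt kappa)%:E)%E.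
Proof.
move=> k0; pose F x := 2 * Num.sqrt (x + kappa).
have cF : continuous F.
  move=> x; apply: cvgM; first exact: cvg_cst.
  apply: (continuous_comp (f := fun x => x + kappa) (g := Num.sqrt)).
    by apply: cvgD; [exact: cvg_id|exact: cvg_cst].
  exact: sqrt_continuous.
have dF (x : R) : 0 <= x -> is_derive x 1 F (inv_sqrt kappa x).
  move=> x0; have xk : 0 < x + kappa by lra.
  pose g (y : R) := y + kappa.
  have d1 : is_derive (g x) 1 (@Num.sqrt R) (2 * Num.sqrt (x + kappa))^-1.
    exact: is_derive1_sqrt.
  have d2 : is_derive x 1 g 1 by rewrite -[X in is_derive _ _ _ X]addr0; exact: is_deriveD.
  have d3 := @is_derive1_comp _ _ g _ _ _ d1 d2.
  have d4 := is_deriveZ 2 d3.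
  apply: (is_derive_eq d4); rewrite /inv_sqrt mulr1 -[LHS]/(2 * _) invfM mulrA divff ?mul1r//.
have := @continuous_FTC2 R (inv_sqrt kappa) F 0 1 ltr01.
rewrite /F add0r => ->//.
- apply: continuous_in_subspaceT => x; rewrite inE/= in_itv/= => xb.
  have xk : 0 < x + kappa by lra.
  have cs : {for x, continuous (fun y => Num.sqrt (y + kappa))}.
    apply: (continuous_comp (f := fun x => x + kappa) (g := Num.sqrt)).
      by apply: cvgD; [exact: cvg_id|exact: cvg_cst].
    exact: sqrt_continuous.
  have s0 : Num.sqrt (x + kappa) != 0 by rewrite gt_eqF// sqrtr_gt0.
  exact: (cvgV s0 cs).
- split.
  + by move=> x; rewrite in_itv/= => xb; have [] := dF x ltac:(lra).
  + exact: (cvg_at_right_filter (cF 0)).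
  + exact: (cvg_at_left_filter (cF 1)).
- move=> x; rewrite in_itv/= => xb; rewrite derive1E.
  by have [_ <-] := dF x ltac:(lra).
Qed.

(* lam is normalized on [-1, 1], hence this is half the integral of u over [0, 1]. *)
Definition half_mass u : R := Ex (fun x => \1_(`[0, 1]%classic : set R) x * u x).

End expectation.

(** * Masses of the halves and of the leaking windows *)

Section half_masses.
Context {R : realType}.
Local Notation leb := (@lebesgue_measure R).
Implicit Types (f g h u v : R -> R) (e c s kappa K : R).
Local Notation I01 := (`[0, 1]%classic : set R).

(** The weight peaks at 1/2, so the smaller of the two weights is the one at [x]. *)
Lemma osc_center kappa u K x : osc (rho kappa) u K -> 0 <= x <= 1 ->
  rho kappa x * `|u x - u 2^-1| <= K.
Proof.
move=> [w uw wK] x01.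
have w1 := dominated_le (@rho_nonneg R kappa) uw.
have rx : rho kappa x <= rho kappa 2^-1.
  rewrite /rho ler_wsqrtr// lerD2r; have -> : Num.min 2^-1 (1 - 2^-1) = 2^-1 :> R by apply: min_l; lra.
  by case: (leP x (1 - x)); lra.
have [xh|xh] := leP x 2^-1.
  have := uw x 2^-1 ltac:(lra) xh ltac:(lra); rewrite min_l// distrC.
  have := w1 0 x ltac:(lra) ltac:(lra) ltac:(lra).
  have := w1 2^-1 1 ltac:(lra) ltac:(lra) ltac:(lra); lra.
have := uw 2^-1 x ltac:(lra) ltac:(lra) ltac:(lra); rewrite min_r//.
have := w1 x 1 ltac:(lra) ltac:(lra) ltac:(lra).
have := w1 0 2^-1 ltac:(lra) ltac:(lra) ltac:(lra); lra.
Qed.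

(** By [osc_center] the distance of [u] from its central value is at most K / rho, and the integral
    of 1 / rho stays bounded as [kappa] tends to 0. The division by 2 reflects that [0, 1] has
    [lam]-measure 1/2. *)
Lemma half_mass_center kappa u K : 0 < kappa <= 4^-1 -> regular u ->
  osc (rho kappa) u K -> `|half_mass u - u 2^-1 / 2| <= 3 * K.
Proof.
move=> kb ru oK; have K0 := osc_ge0 (@rho_nonneg R kappa) oK.
pose wt x := \1_I01 x * inv_sqrt kappa x.
have rI : regular (\1_I01 : R -> R) by exact: regular_indic.
have wt_ge0 x : 0 <= wt x.
  by rewrite mulr_ge0//= invr_ge0 sqrtr_ge0.
have rwt : regular wt.
  split.
    (* Clamping at 0 makes the second factor monotone on the whole line, hence measurable. *)
    have -> : wt = (fun x => \1_I01 x * inv_sqrt kappa (Num.max 0 x)).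
      apply/funext => x; rewrite /wt indicE mem_setE in_itv/=.
      by case: leP => //= _; rewrite !mul0r.
    apply: measurable_funM; first exact: measurable_indic.
    apply: nonincreasing_measurable => //= x y xy; rewrite /inv_sqrt.
    have xy' : Num.max 0 x <= Num.max 0 y by rewrite ge_max !le_max xy lexx ?orbT.
    have x0 : 0 <= Num.max 0 x by rewrite le_max lexx.
    rewrite lef_pV2 ?posrE ?sqrtr_gt0; [|lra..].
    by rewrite ler_wsqrtr// lerD2r.
  exists ((Num.sqrt kappa)^-1) => x; rewrite ger0_norm// /wt indicE mem_setE in_itv/=.
  case: (boolP (0 <= x <= 1)) => xb; last by rewrite mul0r invr_ge0 sqrtr_ge0.
  rewrite mul1r /inv_sqrt lef_pV2 ?posrE ?sqrtr_gt0; [|lra..].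
  by rewrite ler_wsqrtr//; lra.
have rwt' : regular (fun x => wt (1 - x)).
  by apply: regular_ext (regular_affine (-1) 1 rwt) => x; congr wt; ring.
have Ewt : Ex wt <= 3 / 2.
  rewrite -lee_fin Ex_lebesgue//.
  have -> : (\int[leb]_x (\1_(`[-1, 1]%classic : set R) x * wt x)%:E =
     \int[leb]_(x in `[0%R, 1%R]) (inv_sqrt kappa x)%:E)%E.
    rewrite [RHS]integral_mkcond; apply: eq_integral => x _.
    rewrite patchE /wt !indicE !mem_setE !in_itv/=.
    case: (boolP (0 <= x <= 1)) => xb; last by rewrite mul0r mulr0.
    by have -> : -1 <= x <= 1 by [lra]; rewrite !mul1r.
  rewrite inv_sqrt_integral; last lra.
  rewrite -EFinM lee_fin.
  have := sqrtr_ge0 kappa; have : Num.sqrt (1 + kappa) <= Num.sqrt ((5 / 4) ^+ 2).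
    by rewrite ler_wsqrtr// expr2; lra.
  rewrite sqrtr_sqr ger0_norm; [lra|lra].
have E' : Ex (fun x => wt (1 - x)) = Ex wt.
  apply: Ex_flip => // x xb; rewrite /wt indicE mem_setE in_itv/=.
    have -> : (0 <= x <= 1) = false by apply/negP => ?; move/negP: xb; apply; lra.
    by rewrite mul0r.
  have -> : (0 <= 1 - x <= 1) = false by apply/negP => ?; move/negP: xb; apply; lra.
  by rewrite mul0r.
have rk c : regular (fun=> c : R) by exact: regular_cst.
have -> : half_mass u - u 2^-1 / 2 = Ex (fun x => \1_I01 x * u x + (- u 2^-1) * \1_I01 x).
  rewrite ExD; [|exact: regularM..].
  by rewrite ExZ// Ex_itv; [|lra..]; rewrite /half_mass; lra.
apply: (@le_trans _ _ (Ex (fun x => K * (wt x + wt (1 - x))))); last first.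
  rewrite ExZ; last exact: regularD.
  rewrite ExD// E'; have : K * (Ex wt + Ex wt) <= K * 3 by rewrite ler_wpM2l//; lra.
  lra.
apply: Ex_norm.
- by apply: regularD; apply: regularM.
- by apply: regularM => //; exact: regularD.
move=> x _; have -> : \1_I01 x * u x + - u 2^-1 * \1_I01 x = \1_I01 x * (u x - u 2^-1) by ring.
rewrite /wt !indicE !mem_setE !in_itv/=.
have -> : (0 <= 1 - x <= 1) = (0 <= x <= 1) by apply/idP/idP; lra.
case: (boolP (0 <= x <= 1)) => xb; last by rewrite !mul0r normr0 addr0 mulr0.
rewrite !mul1r; have rx : 0 < rho kappa x.
  by rewrite sqrtr_gt0; case: (leP x (1 - x)); lra.
have oc := osc_center oK xb.
apply: (@le_trans _ _ (K * (rho kappa x)^-1)).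
  by rewrite ler_pdivlMr// mulrC.
rewrite ler_wpM2l// /rho /inv_sqrt.
case: (leP x (1 - x)) => _; first by rewrite lerDl invr_ge0 sqrtr_ge0.
by rewrite lerDr invr_ge0 sqrtr_ge0.
Qed.

(** The points around 1/2 that a tent of slope 2 (1 + e) sends beyond 0, up to the ends; its length
    is e / (1 + e). *)
Definition window e : set R := `[(2 * (1 + e))^-1, 1 - (2 * (1 + e))^-1]%classic.

Definition window_mass e u : R := Ex (fun x => \1_(window e) x * u x).

Lemma inv_slope e : 0 <= e <= 4^-1 ->
  [/\ 2 / 5 <= (2 * (1 + e))^-1 <= 2^-1, 0 < 2 * (1 + e) &
      1 - (2 * (1 + e))^-1 - (2 * (1 + e))^-1 = e / (1 + e)].
Proof.
move=> eb; have s0 : 0 < 2 * (1 + e) by lra.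
split=> //; last by field; lra.
apply/andP; split; last by rewrite lef_pV2 ?posrE//; lra.
by rewrite -[X in X <= _]invrK lef_pV2 ?posrE// invfM invrK; lra.
Qed.

Lemma window_mass_center kappa e u K : 0 <= kappa -> 0 <= e <= 4^-1 -> regular u ->
  osc (rho kappa) u K ->
  `|window_mass e u - e / (1 + e) / 2 * u 2^-1| <= e / (1 + e) * K.
Proof.
move=> k0 eb ru oK; have K0 := osc_ge0 (@rho_nonneg R kappa) oK.
have [ib s0 len] := inv_slope eb.
have rI : regular (\1_(window e) : R -> R) by apply: regular_indic; exact: measurable_itv.
have Elen : Ex (\1_(window e)) = e / (1 + e) / 2.
  by rewrite Ex_itv ?len//; lra.
have rk c : regular (fun=> c : R) by exact: regular_cst.
have -> : window_mass e u - e / (1 + e) / 2 * u 2^-1 =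
    Ex (fun x => \1_(window e) x * u x + (- u 2^-1) * \1_(window e) x).
  rewrite ExD; [|exact: regularM..].
  by rewrite ExZ// Elen /window_mass; ring.
have -> : e / (1 + e) * K = Ex (fun x => (2 * K) * \1_(window e) x).
  by rewrite ExZ// Elen; field; lra.
apply: Ex_norm.
- by apply: regularD; apply: regularM.
- exact: regularM.
move=> x _; have -> : \1_(window e) x * u x + - u 2^-1 * \1_(window e) x = \1_(window e) x * (u x - u 2^-1) by ring.
rewrite /window !indicE !mem_setE !in_itv/=.
case: (boolP (_ <= x <= _)) => xb; last by rewrite mul0r normr0 mulr0.
rewrite mul1r mulr1; have xb' : 0 <= x <= 1 by lra.
have := osc_center oK xb'; have rx : 2^-1 <= rho kappa x by apply: rho_ge_half => //; lra.
have : 2^-1 * `|u x - u 2^-1| <= rho kappa x * `|u x - u 2^-1| by rewrite ler_wpM2r.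
lra.
Qed.

Let branch e x : 0 <= e <= 4^-1 -> let i := (2 * (1 + e))^-1 in 0 < x -> x <= 1 ->
  x != 2^-1 -> x != i -> x != 1 - i ->
  (0 <= (if x <= 2^-1 then - 2 * (1 + e) * x + 1 else 2 * (1 + e) * (x - 1) + 1) <= 1) =
  ~~ (i <= x <= 1 - i).
Proof.
move=> eb i x0 x1 xh xi xi'; have [ib s0 _] := inv_slope eb; rewrite -/i in ib.
have si : 2 * (1 + e) * i = 1 by rewrite /i mulfV// gt_eqF.
set s := 2 * (1 + e) in s0 si *.
have -> : - 2 * (1 + e) * x + 1 = 1 - s * x by rewrite /s; ring.
have -> : s * (x - 1) + 1 = 1 - s * (1 - x) by ring.
case: (leP x 2^-1) => xle.
  have -> : (x <= 1 - i) = true by apply/idP; lra.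
  rewrite andbT -ltNge.
  have -> : (1 - s * x <= 1) = true by have : 0 <= s * x by [apply: mulr_ge0; lra]; move=> ?; apply/idP; lra.
  rewrite andbT; have -> : (0 <= 1 - s * x) = (s * x <= s * i) by apply/idP/idP; lra.
  by rewrite ler_pM2l// le_eqVlt (negbTE xi).
have -> : (i <= x) = true by apply/idP; lra.
have -> : (1 - s * (1 - x) <= 1) = true.
  by have : 0 <= s * (1 - x) by [apply: mulr_ge0; lra]; move=> ?; apply/idP; lra.
rewrite andbT /= -ltNge.
have -> : (0 <= 1 - s * (1 - x)) = (s * (1 - x) <= s * i) by apply/idP/idP; lra.
rewrite ler_pM2l//; move: xi'; rewrite neq_lt => /orP[] ?; apply/idP/idP; lra.
Qed.

Let branch_left e x : 0 <= e <= 4^-1 -> let i := (2 * (1 + e))^-1 in -1 <= x -> x < 0 ->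
  (0 <= (if x <= - 2^-1 then 2 * (1 + e) * (x + 1) - 1 else - 2 * (1 + e) * x - 1) <= 1) =
  (i <= - x <= 1 - i).
Proof.
move=> eb i x0 x1; have [ib s0 _] := inv_slope eb; rewrite -/i in ib.
have si : 2 * (1 + e) * i = 1 by rewrite /i mulfV// gt_eqF.
set s := 2 * (1 + e) in s0 si *.
have sb : s <= 5 / 2 by rewrite /s; lra.
have -> : - 2 * (1 + e) * x - 1 = s * - x - 1 by rewrite /s; ring.
case: (leP x (- 2^-1)) => xle.
  have -> : (i <= - x) = true by apply/idP; lra.
  have h : s * (x + 1) <= s * 2^-1 by rewrite ler_pM2l//; lra.
  have -> : (s * (x + 1) - 1 <= 1) = true by apply/idP; lra.
  rewrite andbT /=; have -> : (0 <= s * (x + 1) - 1) = (s * i <= s * (x + 1)) by apply/idP/idP; lra.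
  by rewrite ler_pM2l//; apply/idP/idP; lra.
have -> : (- x <= 1 - i) = true by apply/idP; lra.
have h : s * - x <= s * 2^-1 by rewrite ler_pM2l//; lra.
have -> : (s * - x - 1 <= 1) = true by apply/idP; lra.
rewrite !andbT; have -> : (0 <= s * - x - 1) = (s * i <= s * - x) by apply/idP/idP; lra.
by rewrite ler_pM2l.
Qed.

(** Duality with the indicator of [0, 1] turns the new mass into the old mass of the preimage of
    [0, 1]: the right half without its window, and the mirrored window of the left half. *)
Lemma half_mass_step e1 e2 u v : 0 <= e1 <= 4^-1 -> 0 <= e2 <= 4^-1 ->
  regular u -> regular v ->
  half_mass (step_right e1 e2 u v) =
  half_mass v - window_mass e2 v + window_mass e1 u.
Proof.
move=> e1b e2b ru rv.
have e1b' : 0 <= e1 <= 1 by lra.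
have e2b' : 0 <= e2 <= 1 by lra.
have rI : regular (\1_I01 : R -> R) by exact: regular_indic.
have rw e : regular (\1_(window e) : R -> R) by apply: regular_indic; exact: measurable_itv.
have rR : regular (step_right e1 e2 u v) by apply: regularD; [exact: regular_Q|exact: regular_leak].
have rL : regular (step_left e1 e2 u v) by apply: regularD; [exact: regular_Q|exact: regular_leak].
have -> : half_mass (step_right e1 e2 u v) =
    Ex (fun x => glue (step_left e1 e2 u v) (step_right e1 e2 u v) x * \1_I01 x).
  congr Ex; apply/funext => x; rewrite /glue indicE mem_setE in_itv/= mulrC.
  by case: (ltP x 0) => // x0; rewrite !mulr0.
have rT : regular (fun x => glue u v x * \1_I01 (tent e1 e2 x)).
  apply: regularM; first exact: regular_glue.
  split; first exact: (measurableT_comp rI.1 (measurable_tent e1 e2)).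
  by have [_ [M hM]] := rI; exists M.
have -> : Ex (fun x => glue (step_left e1 e2 u v) (step_right e1 e2 u v) x * \1_I01 x) =
    Ex (fun x => glue u v x * \1_I01 (tent e1 e2 x)).
  apply: EFin_inj; rewrite !ExE//; last by apply: regularM => //; exact: regular_glue.
  by rewrite tent_duality//; exact: regular_integrable.
pose wu x := \1_(window e1) (0 - x) * u (0 - x).
have rwu : regular wu.
  apply: regular_ext (regular_affine (-1) 0 (regularM (rw e1) ru)) => x /=.
  by rewrite /wu mulN1r addr0 sub0r.
have w_out x : ~~ (-1 <= x <= 1) -> \1_(window e1) x * u x = 0.
  have [ib _ _] := inv_slope e1b => xb; rewrite indicE mem_setE in_itv/=.
  have -> : ((2 * (1 + e1))^-1 <= x <= 1 - (2 * (1 + e1))^-1) = false.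
    by apply/negP => ?; move/negP: xb; apply; lra.
  by rewrite mul0r.
have -> : window_mass e1 u = Ex wu.
  apply/esym/Ex_flip => //; first exact: regularM.
  by move=> x xb; apply: w_out; apply: contra xb => xb; lra.
rewrite -[_ - _]/(half_mass v + - window_mass e2 v) -mulN1r /half_mass /window_mass.
rewrite -ExZ; last exact: regularM.
have r1 := regularM rI rv.
have r2 := regularM (regular_cst (-1)) (regularM (rw e2) rv).
rewrite -ExD// -ExD//; last exact: regularD.
pose i1 := (2 * (1 + e1))^-1; pose i2 := (2 * (1 + e2))^-1.
(* The break points and the window ends: an end of the right window maps to 0, so it belongs both to
   the closed window and to the preimage of [0, 1]. *)
apply: (@Ex_eq _ _ _ ([set 0; 2^-1; - 2^-1] `|` [set i2; 1 - i2] `|` [set - i1; i1 - 1])) => //.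
- by rewrite !finite_setU; do !split; exact: finite_set1.
- by apply: regularD => //; exact: regularD.
move=> x xb xS.
have [x0 x1 x2] : [/\ x != 0, x != 2^-1 & x != - 2^-1].
  by split; apply/eqP => xE; apply: xS; left; left; rewrite xE /=; tauto.
have [x3 x4] : x != i2 /\ x != 1 - i2.
  by split; apply/eqP => xE; apply: xS; left; right; rewrite xE /=; tauto.
have [x5 x6] : x != - i1 /\ x != i1 - 1.
  by split; apply/eqP => xE; apply: xS; right; rewrite xE /=; tauto.
have [ib1 _ _] := inv_slope e1b; have [ib2 _ _] := inv_slope e2b.
rewrite /wu !indicE !mem_setE !in_itv/= -/i1 -/i2 sub0r /glue /tent (negbTE x0).
case: (ltP x 0) => xlt.
  have -> : (i2 <= x <= 1 - i2) = false by apply/negP; rewrite /i2; lra.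
  rewrite /= (@branch_left e1 x) //; last by lra.
  by rewrite -/i1 !mul0r mulr0 !add0r mulrC.
have xp : 0 < x by rewrite lt_neqAle eq_sym x0.
have -> : (x <= - 2^-1) = false by apply/negP; lra.
have -> : (i1 <= - x <= 1 - i1) = false by apply/negP; rewrite /i1; lra.
have x1' : x <= 1 by lra.
rewrite x1' (@branch e2 x)// -/i2 /= mul0r addr0 mul1r.
by case: (i2 <= x <= 1 - i2); rewrite /=; ring.
Qed.

End half_masses.

(** * One-step inequalities and the Lyapunov function *)

Section one_step.
Context {R : realType}.
Implicit Types (r f g h u v : R -> R) (e c s kappa K a N V z : R).

Definition osc2 r u v K : Prop :=
  exists K1 K2, [/\ osc r u K1, osc r v K2 & K1 + K2 <= K].

(** [a] is exact and signed, and the opposite masses encode mean zero; [N] and [V] are only upper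
    bounds, so that inequalities suffice to propagate them. *)
Record state kappa u v a N V : Prop := State {
  state_left : regular u;
  state_right : regular v;
  state_mass_left : half_mass u = - a;
  state_mass_right : half_mass v = a;
  state_osc : osc2 (rho kappa) u v N;
  state_var : osc2 (fun=> 1) u v V
}.

Let nn1 : nonneg01 (fun=> 1 : R). Proof. by move=> x _; rewrite ler01. Qed.

(** Constants: 3/4 bounds sqrt s / s for s >= 2, and 3/2 bounds the sqrt 2 in [rho_edge]. Doubling
    [half_mass_center] gives |u(1/2)| <= 2 |mass| + 6 [N1], and the leak adds its own [N1], whence
    7. The 4 is 1 from [window_mass_center] plus 3 from [half_mass_center]. *)
Let side kappa e1 e2 u v N1 N2 V2 : 0 < kappa <= 4^-1 ->
  0 <= e1 <= kappa -> 0 <= e2 <= kappa ->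
  regular u -> regular v -> osc (rho kappa) u N1 -> osc (rho kappa) v N2 ->
  osc (fun=> 1) v V2 ->
  [/\ osc (rho kappa) (step_right e1 e2 u v)
        (3 / 4 * N2 + 3 / 2 * Num.sqrt kappa * (7 * N1 + 2 * `|half_mass u|)),
      osc (fun=> 1) (step_right e1 e2 u v)
        (V2 / 2 + (7 * N1 + 2 * `|half_mass u|)) &
      `|window_mass e2 v - e2 / (1 + e2) * half_mass v| <= 4 * kappa * N2].
Proof.
move=> kb e1b e2b ru rv ou ov vv.
have N10 := osc_ge0 (@rho_nonneg R kappa) ou.
have N20 := osc_ge0 (@rho_nonneg R kappa) ov.
have V20 := osc_ge0 nn1 vv.
have z0 := sqrtr_ge0 kappa.
have u12 : `|u 2^-1| <= 2 * `|half_mass u| + 6 * N1.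
  have := half_mass_center kb ru ou.
  have := ler_normB (half_mass u) (half_mass u - u 2^-1 / 2).
  have -> : half_mass u - (half_mass u - u 2^-1 / 2) = u 2^-1 / 2 by ring.
  rewrite normrM [`|2^-1|]ger0_norm//; lra.
have z1 : Num.sqrt (2 * kappa) <= 3 / 2 * Num.sqrt kappa.
  have -> : 3 / 2 = Num.sqrt ((3 / 2) ^+ 2) :> R by rewrite sqrtr_sqr ger0_norm//; lra.
  by rewrite -sqrtrM ?ler_wsqrtr ?exprn_ge0// ?expr2; lra.
set s := 2 * (1 + e2); have sb : 2 <= s by rewrite /s; lra.
have ss : Num.sqrt s / s <= 3 / 4.
  rewrite ler_pdivrMr; last lra.
  have -> : 3 / 4 * s = Num.sqrt ((3 / 4 * s) ^+ 2) by rewrite sqrtr_sqr ger0_norm//; lra.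
  rewrite ler_wsqrtr// expr2; have : 2 * s <= s * s by rewrite ler_wpM2r//; lra.
  lra.
have rhoh x : 2 / 5 <= x <= 3 / 5 -> 2^-1 <= rho kappa x.
  by apply: rho_ge_half; lra.
have e1b' : 0 <= e1 <= 4^-1 by lra.
split.
- have ring7 : 0 <= 7 * N1 + 2 * `|half_mass u| by have := normr_ge0 (half_mass u); lra.
  apply: (@osc_le _ _ _ (Num.sqrt s / s * N2 + Num.sqrt (2 * kappa) * (N1 + `|u 2^-1|))).
    apply: lerD; first by rewrite ler_wpM2r.
    apply: ler_pM => //.
      by rewrite addr_ge0.
    lra.
  apply: osc_add => //; first exact: rho_nonneg.
    apply: osc_Q => //; [exact: rho_nonneg| |].
      by move=> y yb; apply: rho_expand => //; lra.
    by move=> y yb; rewrite rho_symm; apply: rho_expand => //; lra.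
  apply: (@osc_leak _ _ (rho kappa)) => //; [exact: rho_nonneg..| ].
  by move=> y yb; apply: rho_edge yb _; lra.
- apply: (@osc_le _ _ _ (1 / s * V2 + 1 * (N1 + `|u 2^-1|))).
    have : s^-1 * V2 <= 2^-1 * V2 by rewrite ler_wpM2r// lef_pV2 ?posrE//; lra.
    lra.
  apply: osc_add => //; last exact: (@osc_leak _ _ (rho kappa)) (@rho_nonneg R kappa) _ _ _ _.
  by apply: osc_Q => // y _; rewrite mul1r.
- have e2b' : 0 <= e2 <= 4^-1 by lra.
  have wm := window_mass_center (ltW (proj1 (andP kb))) e2b' rv ov.
  have hm := half_mass_center kb rv ov.
  have c0 : 0 <= e2 / (1 + e2) by rewrite divr_ge0; lra.
  have c1 : e2 / (1 + e2) <= kappa.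
    rewrite ler_pdivrMr; last lra.
    have : 0 <= kappa * e2 by apply: mulr_ge0; lra.
    lra.
  set c := e2 / (1 + e2) in wm c0 c1 *.
  have := ler_normD (window_mass e2 v - c / 2 * v 2^-1) (c * - (half_mass v - v 2^-1 / 2)).
  have -> : window_mass e2 v - c / 2 * v 2^-1 + c * - (half_mass v - v 2^-1 / 2) =
    window_mass e2 v - c * half_mass v by ring.
  rewrite normrM normrN (ger0_norm c0) => /le_trans; apply.
  have : c * `|half_mass v - v 2^-1 / 2| <= c * (3 * N2) by rewrite ler_wpM2l.
  have : c * N2 <= kappa * N2 by rewrite ler_wpM2r.
  lra.
Qed.

(** Adding the two sides gives 7 * 3/2, rounded up to 11, and 4 * 3/2 = 6. The new [a] and [N] do
    not involve [V]. *)
Lemma state_step kappa e1 e2 u v a N V : 0 < kappa <= 4^-1 ->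
  0 <= e1 <= kappa -> 0 <= e2 <= kappa -> state kappa u v a N V ->
  exists2 a', state kappa (step_left e1 e2 u v) (step_right e1 e2 u v) a'
      ((3 / 4 + 11 * Num.sqrt kappa) * N + 6 * Num.sqrt kappa * `|a|)
      (V / 2 + 7 * N + 4 * `|a|) &
    `|a' - (1 - e1 / (1 + e1) - e2 / (1 + e2)) * a| <= 4 * kappa * N.
Proof.
move=> kb e1b e2b [ru rv mu mv [N1 [N2 [ou ov NN]]] [V1 [V2 [vu vv VV]]]].
have [oR vR wR] := side kb e1b e2b ru rv ou ov vv.
have [oL vL wL] := side kb e2b e1b rv ru ov ou vu.
have N10 := osc_ge0 (@rho_nonneg R kappa) ou.
have N20 := osc_ge0 (@rho_nonneg R kappa) ov.
have z0 := sqrtr_ge0 kappa.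
have e1b' : 0 <= e1 <= 4^-1 by lra.
have e2b' : 0 <= e2 <= 4^-1 by lra.
rewrite mu normrN in oR vR wL; rewrite mv in oL vL wR.
exists (a - window_mass e2 v + window_mass e1 u); first split.
- by apply: regularD; [exact: regular_Q|exact: regular_leak].
- by apply: regularD; [exact: regular_Q|exact: regular_leak].
- by rewrite half_mass_step// mu; ring.
- by rewrite half_mass_step// mv.
- exists (3 / 4 * N1 + 3 / 2 * Num.sqrt kappa * (7 * N2 + 2 * `|a|)).
  exists (3 / 4 * N2 + 3 / 2 * Num.sqrt kappa * (7 * N1 + 2 * `|a|)).
  split => //.
  have : Num.sqrt kappa * (N1 + N2) <= Num.sqrt kappa * N by rewrite ler_wpM2l.
  have : 0 <= Num.sqrt kappa * N by rewrite mulr_ge0//; lra.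
  lra.
- exists (V1 / 2 + (7 * N2 + 2 * `|a|)), (V2 / 2 + (7 * N1 + 2 * `|a|)).
  by split => //; lra.
have -> : a - window_mass e2 v + window_mass e1 u -
   (1 - e1 / (1 + e1) - e2 / (1 + e2)) * a =
   (window_mass e1 u - e1 / (1 + e1) * - a) - (window_mass e2 v - e2 / (1 + e2) * a) by ring.
have := ler_normB (window_mass e1 u - e1 / (1 + e1) * - a) (window_mass e2 v - e2 / (1 + e2) * a).
have : kappa * (N1 + N2) <= kappa * N by rewrite ler_wpM2l//; lra.
lra.
Qed.

(** The 32 absorbs the error 4 kappa N of the mass: 32 * 3/4 + 4 = 28 < 32. The factor kappa^2 makes
    what [V] receives from [a] and [N] of higher order. *)
Definition Psi kappa a N V : R := `|a| + 32 * kappa * N + kappa ^+ 2 * V.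

(** Coefficients are compared one by one, with p = z^2. For |a|: 32 * 6 = 192, and the remaining 8
    of the 200 covers 4 p^2. For [N]: 28 + 352 z + 7 p has to stay below 32 q, which is where z <=
    1/100 enters. For [V]: 1/2 against [q]. *)
Lemma Psi_step z q a a' N V : 0 <= z <= 100^-1 -> 1 - 2 * z ^+ 2 <= q <= 1 ->
  0 <= N -> 0 <= V -> `|a' - q * a| <= 4 * z ^+ 2 * N ->
  Psi (z ^+ 2) a' ((3 / 4 + 11 * z) * N + 6 * z * `|a|) (V / 2 + 7 * N + 4 * `|a|) <=
  (q + 200 * z ^+ 3) * Psi (z ^+ 2) a N V.
Proof.
move=> zb qb N0 V0 h; rewrite /Psi.
have A0 := normr_ge0 a; set A := `|a| in A0 *.
have -> : z ^+ 3 = z * z ^+ 2 by rewrite exprS.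
have pb : 0 <= z ^+ 2 <= z * 100^-1 by rewrite expr2 mulr_ge0 ?ler_wpM2l//; lra.
have ha' : `|a'| <= q * A + 4 * z ^+ 2 * N.
  have := ler_normD (a' - q * a) (q * a); rewrite subrK normrM (@ger0_norm _ q); last lra.
  rewrite -/A; lra.
move: (z ^+ 2) pb qb ha' {h} => p pb qb ha'.
have zp0 : 0 <= z * p by rewrite mulr_ge0//; lra.
have p0 : 0 <= p by lra.
have b1 : 0 <= 8 * z - 4 * p by lra.
have b2 : 0 <= 32 * (q + 200 * (z * p)) - (28 + 352 * z + 7 * p) by lra.
have b3 : 0 <= q + 200 * (z * p) - 1 / 2 by lra.
have cA := mulr_ge0 A0 (mulr_ge0 p0 b1).
have cN := mulr_ge0 N0 (mulr_ge0 p0 b2).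
have cV := mulr_ge0 V0 (mulr_ge0 (mulr_ge0 p0 p0) b3).
rewrite -subr_ge0 addrC; apply: le_trans (addr_ge0 (addr_ge0 cA cN) cV) _.
rewrite -subr_ge0 in ha'; rewrite -subr_ge0; apply: le_trans ha' _.
by rewrite le_eqVlt; apply/orP; left; apply/eqP; rewrite expr2; field.
Qed.

End one_step.

(** * Bounded variation through dominating functions *)

Section bounded_variation_classes.
Context {R : realType}.
Implicit Types (f g h u v w : R -> R) (a b c s K V M : R).
Local Notation TV := (@total_variation R).
Local Notation "1_" := (fun=> 1 : R) (only parsing).

Lemma total_variation_dominated a b f w :
  (forall x y, a <= x -> x <= y -> y <= b -> `|f y - f x| <= w y - w x) ->
  (TV a b f <= (w b - w a)%:E)%E.
Proof.
move=> fw; apply: ge_ereal_sup => _ [_ [s [ps /eqP ls] <-] <-].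
rewrite lee_fin /variation.
have ips : itv_partition a b s by split => //; apply/eqP.
apply: (@le_trans _ _ (\sum_(0 <= n < size s)
    ((w \o nth b (a :: s)) n.+1 - (w \o nth b (a :: s)) n))).
  rewrite big_nat [leRHS]big_nat; apply: ler_sum => i /andP[_ ilt] /=.
  apply: fw.
  - exact: (itv_partition_nth_ge (ltnW ilt) ips).
  - by apply: ltW; move/(pathP b) : ps => /(_ _ ilt).
  - exact: (itv_partition_nth_le (m := i.+1) ilt ips).
rewrite telescope_sumr//= lerB//.
by rewrite -[in leRHS]ls (last_nth b); case: (s).
Qed.

Lemma bounded_variation_dominated g : bounded_variation (-1) 1 g ->
  exists2 w : R -> R, (forall x y, -1 <= x -> x <= y -> y <= 1 -> `|g y - g x| <= w y - w x) &
    (w 1 - w (-1))%:E = TV (-1) 1 g.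
Proof.
move=> bg; have N1 : -1 <= 1 :> R by lra.
have fin x : -1 <= x <= 1 -> TV (-1) x g \is a fin_num.
  move=> xb; apply/bounded_variationP; first lra.
  by apply: bounded_variationl bg; lra.
exists (fun x => fine (TV (-1) x g)) => [x y x1 xy y1|]; last first.
  by rewrite total_variationxx/= subr0 fineK// fin//; lra.
have D := total_variationD g x1 xy.
have fy := fin y ltac:(lra); have fx := fin x ltac:(lra).
have fxy : TV x y g \is a fin_num by move: fy; rewrite D fin_numD => /andP[].
rewrite D fineD// addrAC subrr add0r -lee_fin fineK//.
exact: total_variation_ge.
Qed.

(** Extends a function from [0, 1] to the line by constants, so that it becomes [regular]. *)
Definition clip01 x : R := Num.max 0 (Num.min 1 x).

Lemma clip01_itv x : 0 <= clip01 x <= 1.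
Proof. by rewrite /clip01 le_max lexx/= ge_max ler01 ge_min lexx. Qed.

Lemma clip01_id x : 0 <= x <= 1 -> clip01 x = x.
Proof. by move=> xb; rewrite /clip01 min_r ?max_r//; lra. Qed.

Lemma clip01_le x y : x <= y -> clip01 x <= clip01 y.
Proof.
move=> xy; rewrite /clip01 ge_max !le_max lexx/=; apply/orP; right.
by rewrite le_min !ge_min lexx/= xy orbT.
Qed.

(** Jordan decomposition: [f + w] and [w] are both monotone, so their difference is measurable. *)
Lemma osc_regular_clip f w : (forall x y, 0 <= x -> x <= y -> y <= 1 -> `|f y - f x| <= w y - w x) ->
  regular (fun x => f (clip01 x)).
Proof.
move=> fw; split.
  have -> : (fun x => f (clip01 x)) =
     (fun x => f (clip01 x) + w (clip01 x)) \- (fun x => w (clip01 x)).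
    by apply/funext => x /=; rewrite addrK.
  have dom x y : x <= y -> `|f (clip01 y) - f (clip01 x)| <= w (clip01 y) - w (clip01 x).
    by move=> xy; have := clip01_itv x; have := clip01_itv y; move=> ? ?;
      apply: fw; [lra|exact: clip01_le|lra].
  apply: measurable_funB; apply: nondecreasing_measurable => // x y /dom.
    by rewrite ler_norml; lra.
  by move=> h; rewrite -subr_ge0; apply: le_trans h.
exists (`|f 0| + (w 1 - w 0)) => x.
have xb := clip01_itv x.
have := ler_normD (f 0) (f (clip01 x) - f 0).
rewrite addrC subrK => /le_trans; apply; rewrite lerD2l.
have h1 := fw 0 (clip01 x) ltac:(lra) ltac:(lra) ltac:(lra).
have h2 := fw (clip01 x) 1 ltac:(lra) ltac:(lra) ltac:(lra).
have := normr_ge0 (f 1 - f (clip01 x)); lra.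
Qed.

Lemma dominated1P f w : dominated_by 1_ f w <->
  (forall x y, 0 <= x -> x <= y -> y <= 1 -> `|f y - f x| <= w y - w x).
Proof.
by split=> h x y x0 xy y1; have := h x y x0 xy y1; rewrite minxx mul1r.
Qed.

Lemma bounded_variation_halves g V : bounded_variation (-1) 1 g ->
  (TV (-1) 1 g <= V%:E)%E ->
  exists u v, [/\ regular u, regular v, osc2 1_ u v V &
    forall x, -1 <= x <= 1 -> g x = glue u v x].
Proof.
move=> bg; have [w gw <-] := bounded_variation_dominated bg; rewrite lee_fin => wV.
pose u x := g (- clip01 x); pose v x := g (clip01 x).
have du x y : 0 <= x -> x <= y -> y <= 1 -> `|g (- y) - g (- x)| <= - w (- y) - - w (- x).
  by move=> x0 xy y1; have := gw (- y) (- x) ltac:(lra) ltac:(lra) ltac:(lra); rewrite distrC; lra.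
have dv x y : 0 <= x -> x <= y -> y <= 1 -> `|g y - g x| <= w y - w x.
  by move=> x0 xy y1; apply: gw; lra.
exists u, v; split.
- exact: (osc_regular_clip (f := fun x => g (- x)) du).
- exact: (osc_regular_clip dv).
- exists (w 0 - w (-1)), (w 1 - w 0); split; last lra.
    exists (fun x => - w (- x)); last by rewrite oppr0; lra.
    by apply/dominated1P => x y x0 xy y1; rewrite /u !clip01_id; [exact: du|lra..].
  exists w => //.
  by apply/dominated1P => x y x0 xy y1; rewrite /v !clip01_id; [exact: dv|lra..].
move=> x xb; rewrite /glue /u /v; case: ltP => x0.
  by rewrite clip01_id ?opprK//; lra.
by rewrite clip01_id//; lra.
Qed.

Lemma osc1_le u K x y : osc 1_ u K -> 0 <= x <= 1 -> 0 <= y <= 1 ->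
  `|u x| <= `|u y| + K.
Proof.
move=> [w /dominated1P uw wK] xb yb.
have w1 s t : 0 <= s -> s <= t -> t <= 1 -> w s <= w t.
  by move=> s0 st t1; rewrite -subr_ge0; apply: le_trans (uw _ _ s0 st t1).
have h : `|u x - u y| <= K.
  have [xy|yx] := leP x y.
    rewrite distrC; have := uw x y ltac:(lra) xy ltac:(lra).
    have := w1 0 x ltac:(lra) ltac:(lra) ltac:(lra).
    by have := w1 y 1 ltac:(lra) ltac:(lra) ltac:(lra); lra.
  have := uw y x ltac:(lra) ltac:(lra) ltac:(lra).
  have := w1 0 y ltac:(lra) ltac:(lra) ltac:(lra).
  by have := w1 x 1 ltac:(lra) ltac:(lra) ltac:(lra); lra.
by have := ler_normD (u y) (u x - u y); rewrite addrC subrK; lra.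
Qed.

(** Gluing adds a jump of at most |u 0| + |v 0| at 0. These are traded for the values at 1/2, the
    ones that mass and weighted variation control. *)
Lemma glue_bounded_variation u v V : osc2 1_ u v V ->
  bounded_variation (-1) 1 (glue u v) /\
  (TV (-1) 1 (glue u v) <= (`|u 2^-1| + `|v 2^-1| + 2 * V)%:E)%E.
Proof.
move=> [V1 [V2 [ou ov VV]]].
have hu := osc1_le (x := 0) (y := 2^-1) ou ltac:(lra) ltac:(lra).
have hv := osc1_le (x := 0) (y := 2^-1) ov ltac:(lra) ltac:(lra).
case: ou ov => [w1 /dominated1P uw wV1] [w2 /dominated1P vw wV2].
pose w x := if x < 0 then - w1 (- x) + w1 0 else w2 x - w2 0 + (`|u 0| + `|v 0|).
have tv : (TV (-1) 1 (glue u v) <= (w 1 - w (-1))%:E)%E.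
  apply: total_variation_dominated => x y x1 xy y1; rewrite /w /glue.
  case: (ltP y 0) => y0.
    have -> : x < 0 by lra.
    have := uw (- y) (- x) ltac:(lra) ltac:(lra) ltac:(lra); rewrite distrC; lra.
  case: (ltP x 0) => x0; last by have := vw x y x0 xy y1; lra.
  have h1 := uw 0 (- x) ltac:(lra) ltac:(lra) ltac:(lra).
  have h2 := vw 0 y ltac:(lra) ltac:(lra) ltac:(lra).
  have -> : v y - u (- x) = (v y - v 0) + (v 0 - u 0) + (u 0 - u (- x)) by ring.
  have := ler_normD ((v y - v 0) + (v 0 - u 0)) (u 0 - u (- x)).
  have := ler_normD (v y - v 0) (v 0 - u 0).
  have := ler_normB (v 0) (u 0); rewrite (distrC (u 0)); lra.
have bd : (TV (-1) 1 (glue u v) <= (`|u 2^-1| + `|v 2^-1| + 2 * V)%:E)%E.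
  apply: le_trans tv _; rewrite lee_fin /w.
  have -> : (1 < 0 :> R) = false by apply/negP; lra.
  have -> : (-1 < 0 :> R) = true by apply/idP; lra.
  rewrite opprK; lra.
split => //; apply/bounded_variationP; first lra.
rewrite ge0_fin_numE; last by apply: total_variation_ge0; lra.
exact: le_lt_trans bd (ltry _).
Qed.

End bounded_variation_classes.

(** * The BV norm on almost-everywhere classes *)

Section BV_norm.
Context {R : realType}.
Local Notation lam := (lam R).
Implicit Types (f g h u v w : R -> R) (a b c s K V M : R).
Local Notation TV := (@total_variation R).
Local Notation "1_" := (fun=> 1 : R) (only parsing).

Lemma N1_le1 : -1 <= 1 :> R. Proof. lra. Qed.

Lemma ae_refl f : f = f %[ae lam].
Proof. by apply/ae_eqP; exact: lam_ae. Qed.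

Lemma Var_ae f g : f = g %[ae lam] -> Var f = Var g.
Proof.
suff le f' g' : f' = g' %[ae lam] -> (Var f' <= Var g')%E.
  move=> fg; apply/eqP; rewrite eq_le !le//.
  by apply: ae_imp fg => x /= h _; rewrite h.
move=> fg; apply: le_ereal_inf_tmp => _ [k kg <-].
apply: ereal_inf_lbound; exists k => //=.
by apply: ae_imp2 kg fg => x /= h1 h2 _; rewrite h1// h2.
Qed.

Lemma Var_ge0 f : (0 <= Var f)%E.
Proof.
apply: le_ereal_inf_tmp => _ [k _ <-]; apply: total_variation_ge0; exact: N1_le1.
Qed.

Lemma Var_le f g : f = g %[ae lam] -> (Var f <= TV (-1) 1 g)%E.
Proof.
by move=> fg; apply: ereal_inf_lbound; exists g => //=; apply: ae_imp fg => x h _; rewrite h.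
Qed.

Lemma BVnorm_ae f g : measurable_fun setT f -> measurable_fun setT g ->
  f = g %[ae lam] -> BVnorm f = BVnorm g.
Proof.
move=> mf mg fg; rewrite /BVnorm (Var_ae fg) !Lnorm1; congr (_ + _)%E.
apply: ae_eq_integral => //.
- by apply: measurableT_comp => //; exact/measurable_EFinP.
- by apply: measurableT_comp => //; exact/measurable_EFinP.
- by apply: ae_imp fg => x /= h _; rewrite h.
Qed.

Lemma BVnorm_ge0 f : (0 <= BVnorm f)%E.
Proof. by rewrite adde_ge0 ?Lnorm_ge0 ?Var_ge0. Qed.

Lemma regular_norm f : regular f -> regular (fun x => `|f x|).
Proof.
move=> [mf [M hM]]; split; first by apply: measurableT_comp => //; exact: mf.
by exists M => x; rewrite normr_id.
Qed.

Lemma Lnorm1_regular f : regular f -> 'N[lam]_1[EFin \o f]%E = (Ex (fun x => `|f x|))%:E.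
Proof.
move=> rf; rewrite Lnorm1 ExE//; exact: regular_norm.
Qed.

Lemma glue_BV u v V : regular u -> regular v -> osc2 1_ u v V ->
  BV (glue u v) /\
  (BVnorm (glue u v) <= (2 * (`|u 2^-1| + `|v 2^-1|) + 3 * V)%:E)%E.
Proof.
move=> ru rv ouv; have [bv tv] := glue_bounded_variation ouv.
have [mg [M gM]] := regular_glue ru rv.
split.
  split; first exact: (bounded_Lfun mg gM).
  by exists (glue u v) => //; exact: ae_refl.
have -> : 2 * (`|u 2^-1| + `|v 2^-1|) + 3 * V =
  (`|u 2^-1| + `|v 2^-1| + V) + (`|u 2^-1| + `|v 2^-1| + 2 * V) by ring.
rewrite EFinD; apply: leeD; last exact: le_trans (Var_le (@ae_refl _)) tv.
rewrite Lnorm1_regular; last exact: regular_glue.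
rewrite lee_fin -[leRHS]Ex_cst; apply: Ex_le; last first.
- move=> x xb; case: ouv => [V1 [V2 [ou ov VV]]]; rewrite /glue.
  have V10 : 0 <= V1 by apply: osc_ge0 ou => y _; rewrite ler01.
  have V20 : 0 <= V2 by apply: osc_ge0 ov => y _; rewrite ler01.
  case: ltP => x0.
    have := osc1_le (x := - x) (y := 2^-1) ou ltac:(lra) ltac:(lra).
    have := normr_ge0 (v 2^-1); lra.
  have := osc1_le (x := x) (y := 2^-1) ov ltac:(lra) ltac:(lra).
  have := normr_ge0 (u 2^-1); lra.
- exact: regular_cst.
- exact: (regular_norm (regular_glue ru rv)).
Qed.

Lemma Ex_le_BVnorm f : f \in Lfun lam 1%E -> (`|Ex f|%:E <= BVnorm f)%E.
Proof.
move=> /Lfun1_integrable fi; apply: (@le_trans _ _ 'N[lam]_1[EFin \o f]%E); last first.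
  by rewrite leeDl// Var_ge0.
rewrite Lnorm1 /Ex EFin_normr_Rintegral//.
apply: le_abse_integral => //; exact: (measurable_int _ fi).
Qed.

Lemma BVnorm_scale c f : 0 < c -> f \in Lfun lam 1%E ->
  (BVnorm (fun x => (c * f x)%R) <= c%:E * BVnorm f)%E.
Proof.
move=> c0 Lf; rewrite /BVnorm ge0_muleDr ?Lnorm_ge0 ?Var_ge0//.
apply: leeD.
  rewrite !Lnorm1 -ge0_integralZl//; last 2 first.
  - by apply: measurableT_comp => //; apply/measurable_EFinP; exact: Lfun1_measurable.
  - by rewrite lee_fin ltW.
  rewrite le_eqVlt; apply/orP; left; apply/eqP; apply: eq_integral => x _.
  by rewrite /= normrM gtr0_norm// EFinM.
rewrite -lee_pdivrMl//; apply: le_ereal_inf_tmp => _ [k kf <-].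
rewrite lee_pdivrMl//; apply: (@le_trans _ _ (TV (-1) 1 (fun x => c * k x))).
  by apply: Var_le; apply: ae_imp kf => x /= h _; rewrite h.
have [kfin|] := boolP (TV (-1) 1 k \is a fin_num); last first.
  rewrite ge0_fin_numE; last by apply: total_variation_ge0; exact: N1_le1.
  by rewrite ltey negbK => /eqP ->; rewrite gt0_muley ?leey.
have /bounded_variationP kb := kfin.
have [w kw <-] := bounded_variation_dominated (kb N1_le1).
rewrite -EFinM mulrBr.
apply: (@total_variation_dominated _ _ _ _ (fun x => c * w x)) => x y x1 xy y1.
by rewrite -!mulrBr normrM gtr0_norm// ler_pM2l// kw.
Qed.

(** [Var] is an infimum, so a representative of variation below [M] is available only under a strict
    inequality. *)
Lemma BV_halves f M : f \in Lfun lam 1%E -> (BVnorm f < M%:E)%E ->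
  exists u v, [/\ regular u, regular v, osc2 1_ u v M & f = glue u v %[ae lam]].
Proof.
move=> Lf fM.
have /ereal_inf_lt[_ [g gf <-] gM] : (Var f < M%:E)%E.
  by apply: le_lt_trans fM; rewrite leeDr// Lnorm_ge0.
have bg : bounded_variation (-1) 1 g.
  apply/bounded_variationP; first exact: N1_le1.
  rewrite ge0_fin_numE; first exact: lt_trans gM (ltry _).
  by apply: total_variation_ge0; exact: N1_le1.
have [u [v [ru rv ouv guv]]] := bounded_variation_halves bg (ltW gM).
exists u, v; split => //.
apply: ae_imp2 gf (lam_ae guv) => x /= h1 h2 _.
by rewrite -h1// h2.
Qed.

Lemma half_mass_bound u v : regular u -> regular v ->
  [/\ Ex (glue u v) = half_mass u + half_mass v,
      (`|half_mass u|%:E <= BVnorm (glue u v))%E &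
      (`|half_mass v|%:E <= BVnorm (glue u v))%E].
Proof.
move=> ru rv; have rg := regular_glue ru rv.
have rI : regular (\1_(`[0, 1]%classic : set R) : R -> R) by exact: regular_indic.
pose wu x := \1_(`[0, 1]%classic : set R) (0 - x) * u (0 - x).
pose wv x := \1_(`[0, 1]%classic : set R) x * v x.
have rwu : regular wu.
  apply: regular_ext (regular_affine (-1) 0 (regularM rI ru)) => x /=.
  by rewrite /wu mulN1r addr0 sub0r.
have rwv : regular wv by exact: regularM.
have Eu : half_mass u = Ex wu.
  have out x : ~~ (-1 <= x <= 1) -> \1_(`[0, 1]%classic : set R) x * u x = 0.
    move=> xb; rewrite indicE mem_setE in_itv/=.
    have -> : (0 <= x <= 1) = false by apply/negP => ?; move/negP: xb; apply; lra.
    by rewrite mul0r.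
  apply/esym/Ex_flip => //; first exact: regularM.
  by move=> x xb; apply: out; apply: contra xb => xb; lra.
have pw x : -1 <= x <= 1 -> ~ [set 0] x ->
    [/\ glue u v x = wu x + wv x, `|wu x| <= `|glue u v x| & `|wv x| <= `|glue u v x|].
  move=> xb /eqP x0; rewrite /wu /wv /glue !indicE !mem_setE !in_itv/= sub0r.
  have [xlt|xgt|xE] := ltgtP x 0; last by rewrite xE eqxx in x0.
    have -> : (0 <= - x <= 1) = true by apply/idP; lra.
    by rewrite /= mul1r mul0r addr0 normr0.
  have -> : (0 <= - x <= 1) = false by apply/negP; lra.
  have -> : (x <= 1) = true by apply/idP; lra.
  by rewrite /= mul1r mul0r add0r normr0.
have bnd k : regular k -> (forall x, -1 <= x <= 1 -> ~ [set 0] x -> `|k x| <= `|glue u v x|) ->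
    (`|Ex k|%:E <= BVnorm (glue u v))%E.
  move=> rk kg; apply: (@le_trans _ _ (Ex (fun x => `|glue u v x|))%:E); last first.
    by rewrite -Lnorm1_regular// leeDl// Var_ge0.
  rewrite lee_fin.
  (* At 0 [glue] shows the value of [v] only, so it need not dominate the left half there; that
     point is masked. *)
  have -> : Ex k = Ex (fun x => \1_(~` [set 0]) x * k x).
    apply: (@Ex_eq _ _ _ [set 0]) => //.
      by apply: regularM => //; apply: regular_indic; exact: measurableC.
    by move=> x _ x0; rewrite indicE mem_set// mul1r.
  apply: Ex_norm; [|exact: (regular_norm (regular_glue ru rv))|].
    by apply: regularM => //; apply: regular_indic; exact: measurableC.
  move=> x xb; rewrite indicE; case: (boolP (x \in ~` [set 0])) => xS; last by rewrite mul0r normr0.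
  by rewrite mul1r; apply: kg => //; rewrite inE in xS.
split.
- rewrite Eu /half_mass -ExD//; apply: (@Ex_eq _ _ _ [set 0]) => //; first exact: regularD.
  by move=> x xb xS; have [] := pw x xb xS.
- by rewrite Eu; apply: bnd => // x xb xS; have [] := pw x xb xS.
- by apply: bnd => // x xb xS; have [] := pw x xb xS.
Qed.

Lemma dominated_bounded_variation g w :
  (forall x y, -1 <= x -> x <= y -> y <= 1 -> `|g y - g x| <= w y - w x) ->
  bounded_variation (-1) 1 g.
Proof.
move=> gw; apply/bounded_variationP; first exact: N1_le1.
rewrite ge0_fin_numE; last by apply: total_variation_ge0; exact: N1_le1.
exact: le_lt_trans (total_variation_dominated gw) (ltry _).
Qed.

Lemma BV_lin a f g : BV f -> BV g -> BV (a *: f + g).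
Proof.
move=> [Lf [f' ff' bf']] [Lg [g' gg' bg']]; split.
  by apply: rpredD => //; exact: rpredZ.
exists (fun x => a * f' x + g' x).
  by apply: ae_imp2 ff' gg' => x h1 h2 xT; rewrite h1// h2.
have [w1 h1 _] := bounded_variation_dominated bf'.
have [w2 h2 _] := bounded_variation_dominated bg'.
apply: (@dominated_bounded_variation _ (fun x => `|a| * w1 x + w2 x)) => x y x1 xy y1.
have -> : a * f' y + g' y - (a * f' x + g' x) = a * (f' y - f' x) + (g' y - g' x) by ring.
apply: le_trans (ler_normD _ _) _; rewrite normrM.
have := ler_wpM2l (normr_ge0 a) (h1 x y x1 xy y1); have := h2 x y x1 xy y1.
rewrite mulrBr; lra.
Qed.

Lemma Ex_lin a f g : f \in Lfun lam 1%E -> g \in Lfun lam 1%E ->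
  Ex (a *: f + g) = a * Ex f + Ex g.
Proof.
move=> Lf Lg; have Laf : a *: f \in Lfun lam 1%E by exact: rpredZ.
move: Lf Lg Laf => /Lfun1_integrable fi /Lfun1_integrable gi /Lfun1_integrable afi.
by rewrite /Ex RintegralD//; congr (_ + _); rewrite -RintegralZl.
Qed.

Lemma BVnorm_fin f : BV f -> (BVnorm f < +oo)%E.
Proof.
move=> [Lf [g gf bg]]; rewrite /BVnorm lte_add_pinfty//.
  by move: Lf; rewrite Lfun1_integrable => /integrableP[_]; rewrite Lnorm1.
apply: (@le_lt_trans _ _ (TV (-1) 1 g)).
  by apply: Var_le; apply: ae_imp gf => x h xT; rewrite h.
by move/bounded_variationP : bg => /(_ N1_le1); rewrite fin_num_abs; apply: le_lt_trans; exact: lee_abs.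
Qed.

End BV_norm.

(** * Norm bounds for the cocycle on mean-zero functions *)

Section cocycle_estimates.
Context {d : measure_display} {Omega : measurableType d} {R : realType}.
Local Notation lam := (lam R).
Variables (sigma : Omega -> Omega) (eps1 eps2 : Omega -> R) (kappa : R).
Hypothesis eps1_itv : forall omega, 0 <= eps1 omega <= 1.
Hypothesis eps2_itv : forall omega, 0 <= eps2 omega <= 1.
Hypothesis kappa_itv : 0 < kappa <= (100 ^+ 2)^-1.
Implicit Types (omega : Omega) (f u v : R -> R) (p : (R -> R) * (R -> R)) (a N V : R).

Local Notation z := (Num.sqrt kappa).
Local Notation e1 omega := (kappa * eps1 omega).
Local Notation e2 omega := (kappa * eps2 omega).

Let k0 : 0 < kappa. Proof. by case/andP: kappa_itv. Qed.

Let kb : 0 < kappa <= 4^-1.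
Proof. by move: kappa_itv; rewrite expr2; lra. Qed.

Let zz : z ^+ 2 = kappa. Proof. by rewrite sqr_sqrtr// ltW. Qed.

Let zb : 0 <= z <= 100^-1.
Proof.
rewrite sqrtr_ge0 /=; have -> : 100^-1 = Num.sqrt ((100 ^+ 2)^-1) :> R.
  by rewrite -exprVn sqrtr_sqr ger0_norm// invr_ge0.
by rewrite ler_wsqrtr//; case/andP: kappa_itv.
Qed.

Let e1b omega : 0 <= e1 omega <= kappa.
Proof.
by have /andP[h1 h2] := eps1_itv omega; rewrite mulr_ge0 ?ler_piMr ?(ltW k0).
Qed.

Let e2b omega : 0 <= e2 omega <= kappa.
Proof.
by have /andP[h1 h2] := eps2_itv omega; rewrite mulr_ge0 ?ler_piMr ?(ltW k0).
Qed.

Let e1b' omega : 0 <= e1 omega <= 1. Proof. by have := e1b omega; have := kb; lra. Qed.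
Let e2b' omega : 0 <= e2 omega <= 1. Proof. by have := e2b omega; have := kb; lra. Qed.

(** The cocycle lifted to genuine functions, where identities hold everywhere and no choice is
    involved. *)
Definition pair_step omega p :=
  (step_left (e1 omega) (e2 omega) p.1 p.2, step_right (e1 omega) (e2 omega) p.1 p.2).

Local Notation PFc := (PF_cocycle sigma eps1 eps2 kappa).
Local Notation pairc := (cocycle sigma pair_step).

Definition regular_pair p := regular p.1 /\ regular p.2.

Lemma regular_pair_step omega p : regular_pair p -> regular_pair (pair_step omega p).
Proof.
by move=> [r1 r2]; split; apply: regularD;
  [exact: regular_Q|exact: regular_leak|exact: regular_Q|exact: regular_leak].
Qed.

Lemma PF_cocycle_glue n omega p f : regular_pair p -> f \in Lfun lam 1%E ->
  f = glue p.1 p.2 %[ae lam] ->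
  [/\ regular_pair (pairc n omega p), PFc n omega f \in Lfun lam 1%E &
      PFc n omega f = glue (pairc n omega p).1 (pairc n omega p).2 %[ae lam]].
Proof.
move=> rp Lf fp; elim: n => [//|n [rn Ln En]] /=.
have [L' E'] := PF_glue (e1b' (iter n sigma omega)) (e2b' (iter n sigma omega)) rn.1 rn.2 Ln En.
by split => //; exact: regular_pair_step.
Qed.

(** The recursion peels off the last map; peeling off the first one is what compares [omega] with
    [sigma omega]. *)
Lemma cocycle_shift (X : Type) (A : Omega -> X -> X) n omega x :
  cocycle sigma A n.+1 omega x = cocycle sigma A n (sigma omega) (A omega x).
Proof.
elim: n => [//|n ih]; rewrite [LHS]/= -/(cocycle sigma A n.+1 omega x) ih /=.
by rewrite -iterSr.
Qed.

Definition scale_pair c p : (R -> R) * (R -> R) := (fun x => c * p.1 x, fun x => c * p.2 x).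

Lemma pair_cocycle_scale n omega c p :
  pairc n omega (scale_pair c p) = scale_pair c (pairc n omega p).
Proof.
elim: n => [//|n ih] /=; rewrite ih /pair_step /scale_pair /=.
congr pair; apply/funext => x; rewrite /step_left /step_right /leak /Q;
  case: ifP => _; ring.
Qed.

Lemma glue_scale c p x : glue (scale_pair c p).1 (scale_pair c p).2 x = c * glue p.1 p.2 x.
Proof. by rewrite /glue; case: ifP. Qed.

Definition decay omega : R := 1 - e1 omega / (1 + e1 omega) - e2 omega / (1 + e2 omega).

Lemma decay_itv omega : 1 - 2 * kappa <= decay omega <= 1.
Proof.
have kb' := kb; have h e : 0 <= e <= kappa -> 0 <= e / (1 + e) <= kappa.
  move=> eb; rewrite divr_ge0/=; [|lra..].
  rewrite ler_pdivrMr; last lra.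
  have : 0 <= kappa * e by rewrite mulr_ge0; lra.
  lra.
have := h _ (e1b omega); have := h _ (e2b omega); rewrite /decay; lra.
Qed.

Lemma state_ge0 u v a N V : state kappa u v a N V -> 0 <= N /\ 0 <= V.
Proof.
move=> [_ _ _ _ [N1 [N2 [ou ov h]]] [V1 [V2 [vu vv h']]]].
have r1 : nonneg01 (fun=> 1 : R) by move=> x _; rewrite ler01.
have := osc_ge0 (@rho_nonneg R kappa) ou; have := osc_ge0 (@rho_nonneg R kappa) ov.
have := osc_ge0 r1 vu; have := osc_ge0 r1 vv; lra.
Qed.

Lemma state_cocycle n omega p a N V : state kappa p.1 p.2 a N V ->
  exists a' N' V', state kappa (pairc n omega p).1 (pairc n omega p).2 a' N' V' /\
   Psi kappa a' N' V' <=
   \prod_(k < n) (decay (iter k sigma omega) + 200 * z ^+ 3) * Psi kappa a N V.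
Proof.
move=> st; elim: n => [|n [a' [N' [V' [st' h]]]]].
  by exists a, N, V; rewrite big_ord0 mul1r.
have [N0 V0] := state_ge0 st'.
have [a'' st'' ha] := state_step kb (e1b (iter n sigma omega)) (e2b (iter n sigma omega)) st'.
exists a'', ((3 / 4 + 11 * z) * N' + 6 * z * `|a'|), (V' / 2 + 7 * N' + 4 * `|a'|).
split; first exact: st''.
have qb := decay_itv (iter n sigma omega); have kb' := kb.
have := @Psi_step R z (decay (iter n sigma omega)) a' a'' N' V' zb.
rewrite zz => /(_ qb N0 V0 ha) /le_trans; apply.
rewrite big_ord_recr /= [X in _ <= X * _]mulrC -mulrA ler_wpM2l//.
have z3 : 0 <= z ^+ 3 by rewrite exprn_ge0 ?sqrtr_ge0.
by lra.
Qed.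

(** Dividing by kappa^2 undoes the weights in [Psi]. The factor does not depend on the number of
    steps, so it is invisible in the growth rate. *)
Lemma state_BVnorm u v a N V : state kappa u v a N V ->
  (BVnorm (glue u v) <= (8 / kappa ^+ 2 * Psi kappa a N V)%:E)%E.
Proof.
move=> st; have [N0 V0] := state_ge0 st; have k0' := k0; have kb' := kb.
case: st => ru rv mu mv [N1 [N2 [ou ov NN]]] oV.
have [_ bv] := glue_BV ru rv oV; apply: le_trans bv _; rewrite lee_fin.
have hu := half_mass_center kb ru ou; have hv := half_mass_center kb rv ov.
rewrite mu in hu; rewrite mv in hv.
have u12 : `|u 2^-1| <= 2 * `|a| + 6 * N1.
  have := ler_normB (- a) (- a - u 2^-1 / 2).
  have -> : - a - (- a - u 2^-1 / 2) = u 2^-1 / 2 by ring.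
  rewrite normrM [`|2^-1|]ger0_norm// normrN; lra.
have v12 : `|v 2^-1| <= 2 * `|a| + 6 * N2.
  have := ler_normB a (a - v 2^-1 / 2).
  have -> : a - (a - v 2^-1 / 2) = v 2^-1 / 2 by ring.
  rewrite normrM [`|2^-1|]ger0_norm//; lra.
apply: (@le_trans _ _ (8 * `|a| + 12 * N + 3 * V)); first lra.
have k1 : 1 <= kappa^-1 by rewrite -invr1 lef_pV2 ?posrE//; lra.
have k2 : 1 <= kappa^-1 * kappa^-1 by rewrite -[leLHS]mulr1 ler_pM//; lra.
have -> : 8 / kappa ^+ 2 * Psi kappa a N V =
  8 * (kappa^-1 * kappa^-1 * `|a|) + 256 * (kappa^-1 * N) + 8 * V.
  by rewrite /Psi; field; rewrite gt_eqF.
have : 1 * `|a| <= kappa^-1 * kappa^-1 * `|a| by rewrite ler_wpM2r.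
have : 1 * N <= kappa^-1 * N by rewrite ler_wpM2r.
lra.
Qed.

Definition V0 : set (R -> R) := [set f | BV f /\ Ex f = 0].

Lemma Ex_glue f u v : regular u -> regular v -> f \in Lfun lam 1%E ->
  f = glue u v %[ae lam] -> Ex f = half_mass u + half_mass v.
Proof.
move=> ru rv Lf fE; have [<- _ _] := half_mass_bound ru rv.
apply: Ex_ae; [exact: Lfun1_measurable|exact: (regular_glue ru rv).1|exact/ae_eqP].
Qed.

(** Since [rho] is at most 1, the bound on the flat variation also serves as [N]. *)
Lemma V0_state f M : V0 f -> (BVnorm f < M%:E)%E ->
  exists p a, f = glue p.1 p.2 %[ae lam] /\ state kappa p.1 p.2 a M M /\ `|a| <= M.
Proof.
move=> [[Lf _] f0] fM; have [u [v [ru rv ouv fE]]] := BV_halves Lf fM.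
exists (u, v), (half_mass v); split => //=.
have := Ex_glue ru rv Lf fE; rewrite f0 => /esym/eqP; rewrite addr_eq0 => /eqP mu.
split; first split => //.
  case: ouv => [V1 [V2 [ou ov h]]]; exists V1, V2; split => //;
    by apply: osc_weight _ => [x _|]; [apply: rho_le1; have := kb; lra|].
have [_ _] := half_mass_bound ru rv.
rewrite -(BVnorm_ae _ _ fE) => [h||]; last 2 first.
- exact: Lfun1_measurable.
- exact: (regular_glue ru rv).1.
by rewrite -lee_fin; apply: (le_trans h); exact: ltW.
Qed.

Local Notation opn n omega := (opnorm_on V0 (PFc n omega)).

Lemma BVnorm_glue_eq f u v : regular u -> regular v -> f \in Lfun lam 1%E ->
  f = glue u v %[ae lam] -> BVnorm f = BVnorm (glue u v).
Proof.
move=> ru rv Lf fE; apply: BVnorm_ae => //; first exact: Lfun1_measurable.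
exact: (regular_glue ru rv).1.
Qed.

Lemma V0_PF_cocycle n omega f M : V0 f -> (BVnorm f < M%:E)%E ->
  V0 (PFc n omega f) /\
  (BVnorm (PFc n omega f) <=
    (268 * M / kappa ^+ 2 * \prod_(k < n) (decay (iter k sigma omega) + 200 * z ^+ 3))%:E)%E.
Proof.
move=> Vf fM; have [p [a [fE [st aM]]]] := V0_state Vf fM.
have [[Lf _] _] := Vf.
have rp : regular_pair p by case: st.
have [rn Ln En] := PF_cocycle_glue n omega rp Lf fE.
have [a' [N' [V' [st' h]]]] := state_cocycle n omega st.
have k0' := k0; have kb' := kb.
split.
  split; last by rewrite (Ex_glue rn.1 rn.2 Ln En); case: st' => _ _ -> -> _ _; rewrite addNr.
  split => //; exists (glue (pairc n omega p).1 (pairc n omega p).2).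
    by apply: ae_imp En => x hx xT; rewrite hx.
  by case: st' => r1 r2 _ _ _ oV; have [] := glue_bounded_variation oV.
rewrite (BVnorm_glue_eq rn.1 rn.2 Ln En); apply: le_trans (state_BVnorm st') _.
rewrite lee_fin; set P := \prod_(k < n) _ in h *.
have P0 : 0 <= P.
  apply: prodr_ge0 => k _; have := decay_itv (iter k sigma omega).
  have : 0 <= z ^+ 3 by rewrite exprn_ge0// sqrtr_ge0.
  lra.
have M0 : 0 <= M by apply: le_trans aM.
have hP : Psi kappa a M M <= 67 / 2 * M.
  rewrite /Psi; have : kappa * M <= 4^-1 * M by rewrite ler_wpM2r//; lra.
  have : kappa ^+ 2 * M <= 1 * M.
    by rewrite ler_wpM2r// expr2 mulr_ile1//; lra.
  have : `|a| <= M by [].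
  lra.
have c0 : 0 <= 8 / kappa ^+ 2 by rewrite divr_ge0// exprn_ge0// ltW.
have -> : 268 * M / kappa ^+ 2 * P = 8 / kappa ^+ 2 * (P * (67 / 2 * M)) by field; rewrite gt_eqF.
rewrite ler_wpM2l//; apply: le_trans h _.
by rewrite ler_wpM2l.
Qed.

Lemma opnorm_upper n omega :
  (opn n omega <= (536 / kappa ^+ 2 *
     \prod_(k < n) (decay (iter k sigma omega) + 200 * z ^+ 3))%:E)%E.
Proof.
apply: ge_ereal_sup => _ [f [Vf /= f1] <-].
(* Radius 2 supplies the strict inequality needed to pick a representative; hence 536 = 2 * 268. *)
have f2 : (BVnorm f < 2%:E)%E by apply: le_lt_trans f1 _; rewrite lte_fin; lra.
have [_ h] := V0_PF_cocycle n omega Vf f2; apply: le_trans h _.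
by rewrite lee_fin le_eqVlt; apply/orP; left; apply/eqP; ring.
Qed.

Lemma V0_lin c f g : V0 f -> V0 g -> V0 (c *: f + g).
Proof.
move=> [Bf f0] [Bg g0]; split; first exact: BV_lin.
by rewrite Ex_lin ?f0 ?g0 ?mulr0 ?addr0//; [case: Bf|case: Bg].
Qed.

Lemma V0_0 : V0 (cst 0).
Proof.
split; last exact: (@Ex_cst R 0).
split; first by apply: (bounded_Lfun (measurable_cst _) (M := 0)) => // x; rewrite normr0.
exists (cst 0); first exact: ae_refl.
by apply: (@dominated_bounded_variation _ _ (cst 0)) => x y _ _ _; rewrite /= !subrr normr0.
Qed.

Lemma V0_scale c f : V0 f -> V0 (fun x => c * f x).
Proof.
move=> Vf; have := V0_lin c Vf V0_0.
by congr V0; apply/funext => x; rewrite /= /GRing.add /= addr0.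
Qed.

(** This feeds the zero-one law for exponents. After one step the function has to be rescaled into
    the unit ball, but the chosen [PF] is homogeneous only almost everywhere, so the scaling is
    carried out on pairs. *)
Lemma opnorm_shift : exists2 C : R, 0 < C &
  forall n omega, (opn n.+1 omega <= C%:E * opn n (sigma omega))%E.
Proof.
have k0' := k0; have kb' := kb; have zb' := zb.
exists (1072 / kappa ^+ 2); first by apply: divr_gt0; [lra|exact: exprn_gt0].
set C := 1072 / kappa ^+ 2; have C0 : 0 < C by apply: divr_gt0; [lra|exact: exprn_gt0].
move=> n omega; apply: ge_ereal_sup => _ [f [Vf /= f1] <-].
have f2 : (BVnorm f < 2%:E)%E by apply: le_lt_trans f1 _; rewrite lte_fin; lra.
have [Vg gC] := V0_PF_cocycle 1 omega Vf f2.
have gC' : (BVnorm (PFc 1 omega f) <= C%:E)%E.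
  apply: le_trans gC _; rewrite lee_fin big_ord1 /=.
  have := decay_itv omega; have : z ^+ 3 <= 1 * 200^-1.
    rewrite exprS zz; apply: ler_pM; [exact: sqrtr_ge0|exact: ltW|lra|].
    by move: kappa_itv; rewrite expr2; lra.
  set D := decay omega + 200 * z ^+ 3 => h1 h2.
  have D2 : D <= 2 by rewrite /D; lra.
  have ik0 : 0 <= (kappa ^+ 2)^-1 by rewrite invr_ge0 exprn_ge0// ltW.
  have -> : 268 * 2 / kappa ^+ 2 * D = (kappa ^+ 2)^-1 * (536 * D) by ring.
  rewrite /C [X in _ <= X]mulrC; apply: ler_wpM2l; lra.
have -> : PFc n.+1 omega f = PFc n (sigma omega) (PFc 1 omega f) by exact: cocycle_shift.
set g := PFc 1 omega f in Vg gC' *.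
move: (C) C0 gC' => {}C {}C0 {}gC'; have [[Lg _] _] := Vg.
have Vg' := V0_scale (C^-1) Vg.
have g'1 : (BVnorm (fun x => (C^-1 * g x)%R) <= 1)%E.
  apply: le_trans (BVnorm_scale _ Lg) _; first by rewrite invr_gt0.
  by rewrite lee_pdivrMl// mule1.
have gM : (BVnorm g < (C + 1)%:E)%E by apply: le_lt_trans gC' _; rewrite lte_fin; lra.
have [p [a [gE [st _]]]] := V0_state Vg gM.
have rp : regular_pair p by case: st.
have rp' : regular_pair (scale_pair C^-1 p).
  by case: rp => r1 r2; split; apply: regularM => //; exact: regular_cst.
have [[Lg' _] _] := Vg'.
have gE' : (fun x => C^-1 * g x) = glue (scale_pair C^-1 p).1 (scale_pair C^-1 p).2 %[ae lam].
  by apply: ae_imp gE => x h xT; rewrite glue_scale h.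
have [rn Ln En] := PF_cocycle_glue n (sigma omega) rp Lg gE.
have [rn' Ln' En'] := PF_cocycle_glue n (sigma omega) rp' Lg' gE'.
have le1 : (BVnorm (PFc n (sigma omega) g) <=
    C%:E * BVnorm (PFc n (sigma omega) (fun x => (C^-1 * g x)%R)))%E.
  apply: le_trans (BVnorm_scale C0 Ln'); rewrite le_eqVlt; apply/orP; left; apply/eqP.
  apply: BVnorm_ae; first exact: Lfun1_measurable.
    by apply: measurable_funM => //; exact: Lfun1_measurable.
  apply: ae_imp2 En En' => x /= h1 h2 _; rewrite h1// h2//.
  by rewrite pair_cocycle_scale glue_scale mulrA divff ?mul1r// gt_eqF.
apply: le_trans le1 _; rewrite lee_pmul2l//.
by apply: ereal_sup_ubound; exists (fun x => C^-1 * g x).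
Qed.

(** To first order the recursion for [N] settles at 6 / (1 - 3/4) = 24 times z a. The aperture 60
    leaves room for the other terms, as 60 * 3/4 + 6 = 51, and turns the mass error 4 kappa N into 4
    * 60 = 240 times z^3 a. The starting pair is constant on each half, so [N = 0]. *)
Lemma state_cone n omega :
  exists a N V, [/\ state kappa (pairc n omega (cst (- 4^-1), cst 4^-1)).1
                       (pairc n omega (cst (- 4^-1), cst 4^-1)).2 a N V,
     N <= 60 * z * a &
     8^-1 * \prod_(k < n) (decay (iter k sigma omega) - 240 * z ^+ 3) <= a].
Proof.
have k0' := k0; have kb' := kb; have zb' := zb.
have zk : kappa <= z * 100^-1 by rewrite -[leLHS]zz expr2 ler_wpM2l//; lra.
have z3 : 0 <= z ^+ 3 <= kappa * 100^-1.
  rewrite exprS zz; apply/andP; split; first by apply: mulr_ge0; lra.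
  by rewrite [leRHS]mulrC ler_wpM2r//; lra.
have pos omega' : 0 < decay omega' - 240 * z ^+ 3.
  by have := decay_itv omega'; lra.
elim: n => [|n [a [N [V [st NA aP]]]]].
  exists 8^-1, 0, 0; rewrite big_ord0 mulr1; split; [|lra|exact: lexx].
  have h c : half_mass (cst c : R -> R) = c / 2.
    rewrite /half_mass.
    have -> : Ex (fun x => \1_(`[0, 1]%classic : set R) x * cst c x) =
       Ex (fun x => c * \1_(`[0, 1]%classic : set R) x).
      by congr Ex; apply/funext => x; rewrite mulrC.
    by rewrite ExZ; [rewrite Ex_itv; lra|exact: regular_indic].
  split => /=; [exact: regular_cst|exact: regular_cst|by rewrite h; lra|by rewrite h; lra| |].
    by exists 0, 0; split; [exact: osc_cst|exact: osc_cst|rewrite addr0].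
  by exists 0, 0; split; [exact: osc_cst|exact: osc_cst|rewrite addr0].
have [N0 V0'] := state_ge0 st.
have [a' st' ha] := state_step kb (e1b (iter n sigma omega)) (e2b (iter n sigma omega)) st.
have P0 : 0 <= \prod_(k < n) (decay (iter k sigma omega) - 240 * z ^+ 3).
  by apply: prodr_ge0 => k _; exact: ltW.
have a0 : 0 <= a by apply: le_trans aP; rewrite mulr_ge0.
have dq := decay_itv (iter n sigma omega); have dp := pos (iter n sigma omega).
rewrite -/(decay (iter n sigma omega)) in ha; set q := decay _ in dq dp ha.
have low : (q - 240 * z ^+ 3) * a <= a'.
  have h1 : `|a' - q * a| <= 240 * z ^+ 3 * a.
    apply: le_trans ha _.
    have -> : 240 * z ^+ 3 * a = 4 * kappa * (60 * z * a) by rewrite exprS zz; ring.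
    by rewrite ler_wpM2l//; lra.
  by move: h1; rewrite ler_norml; lra.
exists a', ((3 / 4 + 11 * z) * N + 6 * z * `|a|), (V / 2 + 7 * N + 4 * `|a|); split.
- exact: st'.
- rewrite (ger0_norm a0).
  apply: (@le_trans _ _ (60 * z * ((q - 240 * z ^+ 3) * a))); last first.
    by rewrite ler_wpM2l//; lra.
  apply: (@le_trans _ _ ((3 / 4 + 11 * z) * (60 * z * a) + 6 * z * a)).
    by rewrite lerD2r ler_wpM2l//; lra.
  have -> : (3 / 4 + 11 * z) * (60 * z * a) + 6 * z * a =
    (z * a) * (60 * (3 / 4 + 11 * z) + 6) by ring.
  have -> : 60 * z * ((q - 240 * z ^+ 3) * a) = (z * a) * (60 * (q - 240 * z ^+ 3)) by ring.
  rewrite ler_wpM2l//; first by rewrite mulr_ge0//; lra.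
  lra.
rewrite big_ord_recr /= mulrA; apply: le_trans low.
by rewrite mulrC; apply: ler_wpM2l; [exact: ltW|].
Qed.

Lemma opnorm_lower n omega :
  ((8^-1 * \prod_(k < n) (decay (iter k sigma omega) - 240 * z ^+ 3))%:E <= opn n omega)%E.
Proof.
have kb' := kb.
(* With these values the norm bound of [glue_BV] is 2 (1/4 + 1/4) = 1, and the initial mass is
   1/8. *)
pose p0 : (R -> R) * (R -> R) := (cst (- 4^-1), cst 4^-1).
have [a [N [V [st _ aP]]]] := state_cone n omega.
have [a0 [N0 [V0' [st0 _ _]]]] := state_cone 0 omega.
have rp : regular_pair p0 by split; exact: regular_cst.
have ov0 : osc2 (fun=> 1) (cst (- 4^-1) : R -> R) (cst 4^-1) 0.
  by exists 0, 0; split; [exact: osc_cst|exact: osc_cst|rewrite addr0].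
have [Bf nf] := glue_BV rp.1 rp.2 ov0.
set f := glue _ _ in Bf nf.
have [Lf _] := Bf.
have fE : f = glue p0.1 p0.2 %[ae lam] by exact: ae_refl.
have Vf : V0 f.
  split => //; rewrite (Ex_glue rp.1 rp.2 Lf fE).
  by case: st0 => /= _ _ -> -> _ _; rewrite addNr.
have [rn Ln En] := PF_cocycle_glue n omega rp Lf fE.
apply: (@le_trans _ _ (BVnorm (PFc n omega f))); last first.
  apply: ereal_sup_ubound; exists f => //; split => //=; apply: le_trans nf _.
  by rewrite lee_fin /= normrN ger0_norm//; lra.
rewrite (BVnorm_glue_eq rn.1 rn.2 Ln En).
have [_ _ hm] := half_mass_bound rn.1 rn.2; apply: le_trans hm.
case: st => _ _ _ -> _ _; rewrite lee_fin; exact: le_trans aP (ler_norm _).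
Qed.

(** The window masses that one half loses are gained by the other, so they cancel in the sum. *)
Lemma Ex_PF_cocycle n omega f : BV f ->
  PFc n omega f \in Lfun lam 1%E /\ Ex (PFc n omega f) = Ex f.
Proof.
move=> Bf; have [Lf _] := Bf.
have kb' := kb.
have [M fM] : exists M : R, (BVnorm f < M%:E)%E.
  have := BVnorm_fin Bf; have := BVnorm_ge0 f.
  by case: (BVnorm f) => // r _ _; exists (r + 1); rewrite lte_fin; lra.
have [u [v [ru rv _ fE]]] := BV_halves Lf fM.
have rp : regular_pair (u, v) by [].
have [rn Ln En] := PF_cocycle_glue n omega rp Lf fE.
split => //; rewrite (Ex_glue rn.1 rn.2 Ln En) (Ex_glue ru rv Lf fE).
elim: n {rn Ln En} => [//|n ih] /=.
have [rn _ _] := PF_cocycle_glue n omega rp Lf fE.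
have e1' := e1b (iter n sigma omega); have e2' := e2b (iter n sigma omega).
have [r1 r2] := rn.
rewrite /step_left !half_mass_step//; [|lra..].
by rewrite -ih; ring.
Qed.

End cocycle_estimates.

(** * Exponential growth rates *)

Section exponential_growth.
Context {R : realType}.
Implicit Types (a u : nat -> \bar R) (t C x : R).
Local Open Scope ereal_scope.

Definition exp_growth a : \bar R := limn_esup (fun n => (n%:R^-1)%:E * lne (a n)).

Lemma lne_le_expR (y : \bar R) x : 0 <= y -> (lne y <= x%:E) = (y <= (expR x)%:E).
Proof.
move=> y0; rewrite -[in LHS](expRK x) -lne_EFin ?expR_gt0//.
by rewrite lee_lne// in_itv/= ?y0 ?leey// lee_fin expR_ge0.
Qed.

Lemma limn_esup_le u x N : (forall n, (N <= n)%N -> u n <= x%:E) -> limn_esup u <= x%:E.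
Proof.
move=> ux; apply: (@le_trans _ _ (ereal_sup [set u n | n in [set n | (N <= n)%N]])).
  by apply: ereal_inf_lbound; exists [set n | (N <= n)%N] => //; exists N.
by apply: ge_ereal_sup => _ [n /= Nn <-]; exact: ux.
Qed.

Lemma limn_esup_ge u x : (forall N, exists2 n, (N <= n)%N & x%:E <= u n) -> x%:E <= limn_esup u.
Proof.
move=> ux; apply: le_ereal_inf_tmp => _ [V [N _ NV] <-].
have [n Nn xn] := ux N; apply: le_trans xn _.
by apply: ereal_sup_ubound; exists n => //; exact: NV.
Qed.

Lemma limn_esup_lt u x : limn_esup u < x%:E -> exists N, forall n, (N <= n)%N -> u n < x%:E.
Proof.
move=> /ereal_inf_lt[_ [V [N _ NV] <-] Vx]; exists N => n Nn.
by apply: le_lt_trans Vx; apply: ereal_sup_ubound; exists n => //; exact: NV.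
Qed.

Let large C (e : R) : (0 < e)%R -> exists N, forall n, (N <= n)%N -> (0 < n)%N /\ (`|C| <= e * n%:R)%R.
Proof.
move=> e0; have Ce0 : (0 <= `|C| / e)%R by rewrite divr_ge0// ltW.
exists (Num.bound (`|C| / e)).+1 => n Nn; split; first exact: leq_trans Nn.
rewrite mulrC -ler_pdivrMr//; apply: le_trans (ltW (archi_boundP Ce0)) _.
by rewrite ler_nat ltnW.
Qed.

Lemma exp_growth_le a t C : (forall n, 0 <= a n) ->
  (forall n, a n <= (expR (t * n%:R + C))%:E) -> exp_growth a <= t%:E.
Proof.
move=> a0 aC; apply/lee_addgt0Pr => e e0; rewrite -EFinD.
have [N hN] := large C e0; apply: (@limn_esup_le _ _ N) => n /hN[n0 Cn].
have n0' : (0 < n%:R :> R)%R by rewrite ltr0n.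
rewrite lee_pdivrMl// -EFinM; apply: (@le_trans _ _ (t * n%:R + C)%:E).
  by rewrite lne_le_expR.
by rewrite lee_fin [leRHS]mulrC mulrDl lerD2l; apply: le_trans (ler_norm _) Cn.
Qed.

Lemma exp_growth_ge a t C : (forall n, (expR (t * n%:R + C))%:E <= a n) -> t%:E <= exp_growth a.
Proof.
move=> aC; apply/lee_subgt0Pr => e e0; rewrite -EFinB.
have [N hN] := large C e0; apply: limn_esup_ge => N'; exists (maxn N N').
  exact: leq_maxr.
have [n0 Cn] := hN _ (leq_maxl N N'); move: (maxn N N') n0 Cn => n n0 Cn.
have n0' : (0 < n%:R :> R)%R by rewrite ltr0n.
rewrite lee_pdivlMl// -EFinM; apply: (@le_trans _ _ (t * n%:R + C)%:E).
  by rewrite lee_fin [leLHS]mulrC mulrBl lerD2l lerNl; apply: le_trans Cn; rewrite -normrN ler_norm.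
have a0 : 0 <= a n by apply: le_trans (aC n); rewrite lee_fin expR_ge0.
rewrite -[leLHS](_ : lne (expR (t * n%:R + C))%:E = _); last by rewrite lne_EFin ?expR_gt0// expRK.
by rewrite lee_lne// in_itv/= ?a0 ?leey// lee_fin expR_ge0.
Qed.

(** Replaces a statement about a limsup by a bound valid for all [n]: the finitely many early terms,
    being finite, are absorbed by [C]. *)
Lemma exp_growth_lt a t : (forall n, 0 <= a n) -> (forall n, a n < +oo) ->
  exp_growth a < t%:E -> exists C, forall n, a n <= (expR (t * n%:R + C))%:E.
Proof.
move=> a0 aoo /limn_esup_lt[N hN].
(* The first summand pays for [a n] through x <= exp x, the second for a possibly negative
   [t * n]. *)
pose c n : R := (fine (a n) + `|t * n%:R|)%R.
have c0 n : (0 <= c n)%R by rewrite addr_ge0// fine_ge0.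
exists (\sum_(n < N.+1) c n)%R => n.
have C0 : (0 <= \sum_(n < N.+1) c n)%R by apply: sumr_ge0 => i _.
have [nN|Nn] := ltnP n N.+1.
  apply: (@le_trans _ _ (expR (fine (a n)))%:E).
    rewrite -[leLHS](@fineK _ (a n)) ?ge0_fin_numE// lee_fin.
    by apply: le_trans (expR_ge1Dx _); rewrite lerDr.
  rewrite lee_fin ler_expR (bigD1 (Ordinal nN))//= /c.
  have : (0 <= \sum_(i < N.+1 | i != Ordinal nN) (fine (a i) + `|t * i%:R|))%R by apply: sumr_ge0 => i _; exact: c0.
  have := ler_norm (- (t * n%:R))%R; rewrite normrN; lra.
have n0' : (0 < n%:R :> R)%R by rewrite ltr0n; exact: leq_trans Nn.
have := hN n (ltnW Nn); move/ltW; rewrite lee_pdivrMl// -EFinM lne_le_expR// => /le_trans; apply.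
by rewrite lee_fin ler_expR [leLHS]mulrC lerDl.
Qed.

End exponential_growth.

(** * The second exponent as growth on mean-zero functions *)

Section second_exponent.
Context {d : measure_display} {Omega : measurableType d} {R : realType}.
Local Notation lam := (lam R).
Implicit Types (f g h : R -> R) (V : set (R -> R)) (c r : R).
Local Notation V0 := (@V0 R).

Lemma BV_cst c : BV (cst c : R -> R).
Proof.
split; first by apply: (bounded_Lfun (measurable_cst _) (M := `|c|)).
exists (cst c); first exact: ae_refl.
by apply: (@dominated_bounded_variation _ _ (cst 0)) => x y _ _ _; rewrite /= !subrr normr0.
Qed.

Lemma BV_Lfun f : BV f -> f \in Lfun lam 1%E. Proof. by case. Qed.

Lemma V0_hyperplane : closed_hyperplane V0.
Proof.
split.
- by move=> f [].
- exact: V0_0.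
- by move=> a f g; exact: V0_lin.
- move=> f Bf fr; split => //; apply/eqP; rewrite -normr_le0.
  apply/ler_addgt0Pr => r r0; rewrite add0r.
  have [g [Bg g0] fg] := fr r r0.
  have fgE : f - g = (-1) *: g + f by rewrite scaleN1r addrC.
  have := Ex_le_BVnorm (BV_Lfun (BV_lin (-1) Bg Bf)).
  rewrite Ex_lin; [|exact: BV_Lfun..].
  rewrite g0 mulr0 add0r -fgE => /le_lt_trans /(_ fg).
  by rewrite lte_fin => /ltW.
- exists (cst 1); split; first exact: BV_cst.
    by move=> [_]; rewrite (@Ex_cst R 1) => /eqP; rewrite oner_eq0.
  move=> f Bf; exists (Ex f).
  have -> : f - Ex f *: cst 1 = (- Ex f) *: cst 1 + f by rewrite scaleNr addrC.
  split; first by apply: BV_lin => //; exact: BV_cst.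
  rewrite Ex_lin; [|exact: BV_Lfun (BV_cst 1)|exact: BV_Lfun].
  by rewrite (@Ex_cst R 1) mulr1 addNr.
Qed.

(** A hyperplane contained in [V0] is all of it: otherwise its complementary vector would have mean
    zero, and with it every BV function, even the constant 1. *)
Lemma hyperplane_cases V : closed_hyperplane V ->
  V = V0 \/ exists2 f, V f & Ex f != 0.
Proof.
move=> [VBV V_0 Vlin _ [e [Be nVe Ve]]].
have [|nV] := pselect (exists2 f, V f & Ex f != 0); [by right|left].
have VV0 f : V f -> V0 f.
  move=> Vf; split; first exact: VBV.
  by apply/eqP; apply: contrapT => /negP f0; apply: nV; exists f.
apply/seteqP; split => // f [Bf f0].
have [c Vc] := Ve f Bf.
have [c0|c0] := eqVneq c 0; first by move: Vc; rewrite c0 scale0r subr0.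
have V0e : V0 e.
  have -> : e = (- c^-1) *: (f - c *: e) + (c^-1 *: f + 0).
    by rewrite addr0 scaleNr scalerBr scalerA mulVf// scale1r opprB subrK.
  by apply: V0_lin; [exact: VV0|apply: V0_lin => //; exact: V0_0].
exfalso; have V0_1 : V0 (cst 1).
  have [c1 Vc1] := Ve (cst 1) (BV_cst 1).
  have -> : cst 1 = c1 *: e + (cst 1 - c1 *: e) by rewrite addrC subrK.
  by apply: V0_lin => //; exact: VV0.
by move: V0_1 => [_]; rewrite (@Ex_cst R 1) => /eqP; rewrite oner_eq0.
Qed.

Variables (sigma : Omega -> Omega) (eps1 eps2 : Omega -> R) (kappa : R).
Hypothesis eps1_itv : forall omega, 0 <= eps1 omega <= 1.
Hypothesis eps2_itv : forall omega, 0 <= eps2 omega <= 1.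
Hypothesis kappa_itv : 0 < kappa <= (100 ^+ 2)^-1.
Local Notation PFc := (PF_cocycle sigma eps1 eps2 kappa).

(** The mean is preserved by the cocycle and bounded by the norm, so the images of [f] cannot
    decay. *)
Lemma growth_rate_ge0 omega V f : closed_hyperplane V -> V f -> Ex f != 0 ->
  (0 <= growth_rate sigma eps1 eps2 kappa omega V)%E.
Proof.
move=> hV Vf f0; have Bf := hyperplane_sub hV Vf.
have [M M0 fM] : exists2 M : R, 0 < M & (BVnorm f <= M%:E)%E.
  have := BVnorm_fin Bf; have := BVnorm_ge0 f.
  by case: (BVnorm f) => // r; rewrite lee_fin => r0 _; exists (r + 1); rewrite ?lee_fin; lra.
pose f' := M^-1 *: f + cst 0.
have Vf' : V f' by apply: hyperplane_lin => //; exact: hyperplane0.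
have Bf' := hyperplane_sub hV Vf'.
have f'E : f' = (fun x => M^-1 * f x) by apply/funext => x; rewrite /f' /= /GRing.add /= addr0.
have f'1 : (BVnorm f' <= 1)%E.
  rewrite f'E; apply: le_trans (BVnorm_scale _ (BV_Lfun Bf)) _; first by rewrite invr_gt0.
  by rewrite lee_pdivrMl// mule1.
have c0 : 0 < `|Ex f'|.
  rewrite normr_gt0 /f' Ex_lin; [|exact: BV_Lfun|exact: BV_Lfun (BV_cst 0)].
  by rewrite (@Ex_cst R 0) addr0 mulf_neq0// invr_eq0 gt_eqF.
apply: (@exp_growth_ge _ _ 0 (ln `|Ex f'|)) => n; rewrite mul0r add0r lnK ?posrE//.
have [Ln <-] := Ex_PF_cocycle sigma eps1_itv eps2_itv kappa_itv n omega Bf'.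
apply: le_trans (Ex_le_BVnorm Ln) _.
by apply: ereal_sup_ubound; exists f'.
Qed.

Lemma opnorm_V0_ge0 n omega : (0 <= opnorm_on V0 (PFc n omega))%E.
Proof.
apply: (@le_trans _ _ (BVnorm (PFc n omega (cst 0)))); first exact: BVnorm_ge0.
apply: ereal_sup_ubound; exists (cst 0) => //; split; first exact: V0_0.
rewrite /=; have -> : cst 0 = (glue (cst 0) (cst 0) : R -> R).
  by apply/funext => x; rewrite /glue; case: ifP.
have ov0 : osc2 (fun=> 1) (cst 0 : R -> R) (cst 0) 0.
  by exists 0, 0; split; [exact: osc_cst|exact: osc_cst|rewrite addr0].
have [_ nf] := glue_BV (regular_cst 0) (regular_cst 0) ov0.
by apply: le_trans nf _; rewrite lee_fin normr0; lra.
Qed.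

Lemma second_exponent_eq omega :
  (growth_rate sigma eps1 eps2 kappa omega V0 <= 0)%E ->
  second_exponent_at sigma eps1 eps2 kappa omega =
  growth_rate sigma eps1 eps2 kappa omega V0.
Proof.
move=> g0; apply/eqP; rewrite eq_le; apply/andP; split.
  by apply: ereal_inf_lbound; exists V0 => //; exact: V0_hyperplane.
apply: le_ereal_inf_tmp => _ [V hV <-].
have [->//|[f Vf f0]] := hyperplane_cases hV.
exact: le_trans g0 (growth_rate_ge0 omega hV Vf f0).
Qed.

End second_exponent.

(** * A zero-one law and measurability by countable coding *)

Section ergodic_theory.
Context {d : measure_display} {Omega : measurableType d} {R : realType}.
Variables (mu : probability Omega R) (sigma : Omega -> Omega).
Hypothesis erg : ergodic_automorphism mu sigma.
Implicit Types (A B G : set Omega) (omega : Omega).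

Let msigma : measurable_fun setT sigma. Proof. by case: erg. Qed.

Let inv A : measurable A -> mu (sigma @^-1` A) = mu A.
Proof. by case: erg => _ _ h _; exact: h. Qed.

Let measurable_pre A : measurable A -> measurable (sigma @^-1` A).
Proof. by move=> mA; rewrite -[X in measurable X]setTI; exact: msigma. Qed.

Lemma iter_pre n A : measurable A ->
  measurable (iter n sigma @^-1` A) /\ mu (iter n sigma @^-1` A) = mu A.
Proof.
move=> mA; elim: n => [//|n [mn en]].
have -> : iter n.+1 sigma @^-1` A = sigma @^-1` (iter n sigma @^-1` A).
  by apply/funext => omega; rewrite /preimage /= -iterS iterSr.
by split; [exact: measurable_pre|rewrite inv].
Qed.

(** The iterated preimages of [A] increase and all have its measure. Their union is strictly
    invariant, as ergodicity demands, and has measure [mu A] by continuity from below. *)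
Lemma forward_invariant_zero_one A : measurable A ->
  (forall omega, A omega -> A (sigma omega)) -> mu A = 0%E \/ mu A = 1%E.
Proof.
move=> mA Asig; pose F n := iter n sigma @^-1` A.
have mF n : measurable (F n) by exact: (iter_pre n mA).1.
have mU : measurable (\bigcup_n F n) by exact: bigcup_measurable.
have FS n omega : F n omega -> F n.+1 omega by exact: Asig.
have Fmono : {homo F : n m / (n <= m)%N >-> (n <= m)%O}.
  move=> n m /subnK <-; elim: (m - n)%N => [|k ih]; first by rewrite add0n lexx.
  by apply: le_trans ih _; apply/subsetPset => omega; exact: FS.
have cF := nondecreasing_cvg_mu (mu := mu) mF mU Fmono.
have muU : mu (\bigcup_n F n) = mu A.
  apply: (cvg_unique _ cF) => //=.
  have -> : mu \o F = cst (mu A) by apply/funext => n; rewrite /= (iter_pre n mA).2.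
  exact: cvg_cst.
have : sigma @^-1` (\bigcup_n F n) = \bigcup_n F n.
  apply/seteqP; split => omega [n _ Fn].
    by exists n.+1 => //; rewrite /F /preimage /= -iterS iterSr.
  by exists n => //; have := FS _ _ Fn; rewrite /F /preimage /= -iterS iterSr.
by case: erg => _ _ _ h /(h _ mU); rewrite muU.
Qed.

(* Since eps1 and eps2 have countable range, every finite-time quantity of the cocycle
   is of this kind; its level sets are then measurable whatever X is. *)
Definition discrete_fun (X : Type) (F : Omega -> X) : Prop :=
  exists (N : Omega -> nat) (psi : nat -> X),
    (forall P : set nat, measurable (N @^-1` P)) /\ F = psi \o N.

Lemma discrete_fun_pre X (F : Omega -> X) (P : set X) :
  discrete_fun F -> measurable (F @^-1` P).
Proof. by move=> [N [psi [mN ->]]]; exact: (mN (psi @^-1` P)). Qed.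

Lemma discrete_fun_comp X Y (F : Omega -> X) (psi : X -> Y) :
  discrete_fun F -> discrete_fun (psi \o F).
Proof. by move=> [N [psi' [mN ->]]]; exists N, (psi \o psi'). Qed.

Lemma discrete_fun_pair X Y (F : Omega -> X) (G : Omega -> Y) :
  discrete_fun F -> discrete_fun G -> discrete_fun (fun omega => (F omega, G omega)).
Proof.
move=> [N1 [psi1 [mN1 ->]]] [N2 [psi2 [mN2 ->]]].
exists (fun omega => pickle (N1 omega, N2 omega)).
exists (fun k => if unpickle k is Some (i, j) then (psi1 i, psi2 j) else (psi1 0%N, psi2 0%N)).
split; last by apply/funext => omega; rewrite /= pickleK.
move=> P; rewrite [X in measurable X](_ : _ = \bigcup_i \bigcup_(j in [set j | P (pickle (i, j))])
  (N1 @^-1` [set i] `&` N2 @^-1` [set j])).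
  by apply: bigcup_measurable => i _; apply: bigcup_measurable => j _; exact: measurableI.
apply/seteqP; split => [omega Pom|omega [i _ [j Pij [/= -> ->]]]//].
by exists (N1 omega) => //; exists (N2 omega).
Qed.

Lemma discrete_fun_iter X (F : Omega -> X) n : discrete_fun F -> discrete_fun (F \o iter n sigma).
Proof.
move=> [N [psi [mN ->]]]; exists (N \o iter n sigma), psi; split => // P.
exact: (iter_pre n (mN P)).1.
Qed.

Lemma discrete_fun_cst X (x : X) : discrete_fun (fun=> x).
Proof.
exists (fun=> 0%N), (fun=> x); split => // P.
rewrite preimage_cst; case: ifP => _ //; exact: measurableT.
Qed.

Lemma discrete_fun_set A : measurable A -> discrete_fun (fun omega => omega \in A).
Proof.
move=> mA; exists (fun omega => (omega \in A) : nat), (fun k => k == 1%N).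
split; last by apply/funext => omega /=; case: (omega \in A).
move=> P; rewrite [X in measurable X](_ : _ =
   (A `&` [set omega | P 1%N]) `|` (~` A `&` [set omega | P 0%N])).
  have mP (Q : Prop) : measurable [set omega : Omega | Q].
    have [q|nq] := pselect Q.
      by rewrite [X in measurable X](_ : _ = setT)//; apply/seteqP; split.
    by rewrite [X in measurable X](_ : _ = set0)//; apply/seteqP; split.
  by apply: measurableU; apply: measurableI => //; exact: measurableC.
apply/seteqP; split => omega /=.
  case: (boolP (omega \in A)) => [/set_mem Ao p|/negP nA p]; [by left|right].
  by split => //= Ao; apply: nA; exact: mem_set.
by move=> [[Ao p]|[Ao p]]; [rewrite mem_set|rewrite memNset].
Qed.

Lemma discrete_fun_countable (eps : Omega -> R) : measurable_fun setT eps ->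
  countable (range eps) -> discrete_fun eps.
Proof.
move=> meps /countable_injP[f finj].
exists (f \o eps), (fun k => xget 0 [set x | range eps x /\ f x = k]); split; last first.
  apply/funext => omega /=; case: xgetP => [x _ [rx fx]|/(_ (eps omega))[]].
    apply: finj; [by apply: mem_set; exists omega|exact: mem_set|exact/esym].
  by split => //; exists omega.
move=> P; rewrite [X in measurable X](_ : _ = \bigcup_(k in P) ((f \o eps) @^-1` [set k])).
  apply: bigcup_measurable => k _.
  have [[om fk]|nk] := pselect (exists om, f (eps om) = k).
    rewrite [X in measurable X](_ : _ = eps @^-1` [set eps om]).
      by rewrite -[X in measurable X]setTI; exact: meps.
    apply/seteqP; split => om' /= h; last by rewrite h.
    by apply: finj; [apply: mem_set; exists om'|apply: mem_set; exists om|rewrite h fk].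
  by rewrite [X in measurable X](_ : _ = set0)//; apply/seteqP; split => om' //= h; apply: nk; exists om'.
apply/seteqP; split => [om Pom|om [k Pk /= fk]]; last by rewrite /preimage /= fk.
by exists (f (eps om)).
Qed.

End ergodic_theory.

(** * A lower bound for visit frequencies *)

Section visit_frequency.
Context {d : measure_display} {Omega : measurableType d} {R : realType}.
Variables (mu : probability Omega R) (sigma : Omega -> Omega).
Hypothesis erg : ergodic_automorphism mu sigma.
Implicit Types (A B G : set Omega) (omega : Omega).

Definition visits A n omega : nat := \sum_(i < n) (iter i sigma omega \in A).

Lemma visitsS A n omega : visits A n.+1 omega = ((omega \in A) + visits A n (sigma omega))%N.
Proof.
rewrite /visits big_ord_recl /=; congr (_ + _)%N.
by apply: eq_bigr => i _; rewrite -iterSr.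
Qed.

Lemma visitsD A m n omega :
  visits A (m + n) omega = (visits A m omega + visits A n (iter m sigma omega))%N.
Proof.
elim: m omega => [|m ih] omega; first by rewrite /visits big_ord0 !add0n.
by rewrite addSn !visitsS ih addnA iterSr.
Qed.

Lemma visits_le A n omega : (visits A n omega <= n)%N.
Proof.
rewrite -[leqRHS]card_ord -sum1_card; apply: leq_sum => i _.
by case: (_ \in _).
Qed.

Lemma discrete_visits A n : measurable A -> discrete_fun (visits A n).
Proof.
move=> mA; elim: n => [|n ih].
  have -> : visits A 0 = fun=> 0%N by apply/funext => omega; rewrite /visits big_ord0.
  exact: discrete_fun_cst.
have -> : visits A n.+1 = (fun p : nat * bool => (p.1 + p.2)%N) \o
    (fun omega => (visits A n omega, iter n sigma omega \in A)).
  by apply/funext => omega; rewrite /visits big_ord_recr.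
apply: discrete_fun_comp; apply: discrete_fun_pair => //.
exact: (discrete_fun_iter erg n (discrete_fun_set mA)).
Qed.

Lemma integral_visits A n : measurable A ->
  (\int[mu]_omega (visits A n omega)%:R%:E = (n%:R * fine (mu A))%:E)%E.
Proof.
move=> mA.
transitivity (\int[mu]_omega (\sum_(i < n) (\1_(iter i sigma @^-1` A) omega)%:E))%E.
  apply: eq_integral => omega _; rewrite /visits sumEFin; congr EFin.
  by rewrite natr_sum; apply: eq_bigr => i _; rewrite indicE.
rewrite ge0_integral_sum//; last first.
  move=> i; apply/measurable_EFinP; apply: measurable_indic.
  exact: (iter_pre erg i mA).1.
rewrite (eq_bigr (fun=> (fine (mu A))%:E)) => [|i _]; last first.
  rewrite integral_indic ?setIT//; last exact: (iter_pre erg i mA).1.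
  by rewrite fineK ?fin_num_measure//; exact: (iter_pre erg i mA).2.
by rewrite sumEFin sumr_const card_ord mulr_natl.
Qed.

Lemma measurable_visits A n : measurable A ->
  measurable_fun setT (fun omega => ((visits A n omega)%:R : R)).
Proof.
move=> mA _ Y _; rewrite setTI.
exact: (discrete_fun_pre (fun k : nat => Y (k%:R : R)) (discrete_visits n mA)).
Qed.

(* Keane-Weiss: cut the orbit into pieces of length at most L on which the
   frequency is below beta, up to the visits to bad points. *)
Lemma visits_decomposition G B (beta : R) L : 0 <= beta ->
  (forall omega, ~ B omega ->
     exists2 n, (0 < n <= L)%N & (visits G n omega)%:R <= beta * n%:R) ->
  forall N omega, (visits G N omega)%:R <= beta * N%:R + (visits B N omega)%:R + L%:R.
Proof.
move=> b0 hB; elim/ltn_ind => -[_ omega|N ih omega].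
  by rewrite /visits !big_ord0 mulr0 !add0r.
have [Bo|nBo] := pselect (B omega).
  rewrite !visitsS (mem_set Bo) !natrD.
  have := ih N (ltnSn N) (sigma omega).
  have : ((omega \in G)%:R : R) <= 1 by case: (_ \in _).
  rewrite -natr1 mulrDr mulr1 /=; lra.
have [n /andP[n0 nL] hn] := hB _ nBo.
have [nN|Nn] := leqP n N.+1; last first.
  have h1 : ((visits G N.+1 omega)%:R : R) <= L%:R.
    by rewrite ler_nat (leq_trans (visits_le _ _ _))// (leq_trans (ltnW Nn)).
  have : 0 <= beta * N.+1%:R by rewrite mulr_ge0.
  have : 0 <= ((visits B N.+1 omega)%:R : R) by [].
  lra.
rewrite -(subnKC nN) !visitsD !natrD mulrDr.
have := ih (N.+1 - n)%N _ (iter n sigma omega).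
rewrite ltn_subrL n0 /= => /(_ isT).
have : 0 <= ((visits B n omega)%:R : R) by [].
lra.
Qed.

(** Integrating the decomposition gives N mu(G) <= beta N + N mu(B L) + L. With mu(G) = 3 beta, one
    third goes to the pieces of low frequency, one to the bad points if mu(B L) < beta, and the last
    would force beta N <= L for all N. So every [B L] has measure at least beta, and so has their
    intersection; but it is disjoint from [E], which therefore cannot have full measure. *)
Lemma visits_frequency G : measurable G -> (0 < mu G)%E ->
  exists2 beta : R, 0 < beta &
    \forall omega \ae mu, exists C : R, forall n, beta * n%:R - C <= (visits G n omega)%:R.
Proof.
move=> mG G0; have fG : mu G \is a fin_num by rewrite fin_num_measure.
have m0 : 0 < fine (mu G) by rewrite fine_gt0// G0 /= ltey_eq fG.
have m1 : fine (mu G) <= 1 by rewrite -lee_fin fineK//; exact: probability_le1.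
pose beta := fine (mu G) / 3; have b0 : 0 < beta by rewrite divr_gt0.
exists beta => //.
pose E : set Omega := [set omega | forall C : nat, exists n, (visits G n omega)%:R < beta * n%:R - C%:R].
have mE : measurable E.
  have -> : E = \bigcap_C \bigcup_n (visits G n @^-1` [set k : nat | (k%:R : R) < beta * n%:R - C%:R]).
    apply/seteqP; split => [omega Eo C _|omega Eo C].
      by have [n hn] := Eo C; exists n.
    by have [n _ hn] := Eo C I; exists n.
  apply: bigcap_measurable => // C _; apply: bigcup_measurable => n _.
  exact: discrete_fun_pre (discrete_visits n mG).
have Esig omega : E omega -> E (sigma omega).
  (* The extra unit in [C.+1] absorbs the shift, because [beta <= 1]; it also rules out [n = 0]. *)
  move=> Eo C; have [[|n]] := Eo C.+1.
    by rewrite /visits big_ord0 mulr0 sub0r oppr_gt0 ltrn0.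
  rewrite visitsS natrD => hn; exists n.
  have : 0 <= ((omega \in G)%:R : R) by [].
  move: hn; rewrite -!natr1 mulrDr mulr1 /beta; lra.
have [E0|E1] := forward_invariant_zero_one erg mE Esig.
  exists E; split => // omega /= nC C; apply: contrapT => nE; apply: nC; exists C%:R => n.
  by rewrite leNgt; apply/negP => h; apply: nE; exists n.
exfalso.
(* The bad points of the decomposition: no orbit piece of length at most [L] that starts there has
   frequency below beta. *)
pose B L : set Omega := [set omega | forall n, (0 < n <= L)%N -> beta * n%:R <= (visits G n omega)%:R].
have mB L : measurable (B L).
  have -> : B L = \bigcap_n (visits G n @^-1`
      [set k : nat | (0 < n <= L)%N -> beta * n%:R <= (k%:R : R)]).
    by apply/seteqP; split => omega h n; [move=> _; exact: h|exact: h n I].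
  apply: bigcap_measurable; first by exists 0%N.
  by move=> n _; exact: discrete_fun_pre (discrete_visits n mG).
have low L : (beta%:E <= mu (B L))%E.
  rewrite leNgt; apply/negP => BL.
  have fB : mu (B L) \is a fin_num by rewrite fin_num_measure.
  have mBb : fine (mu (B L)) < beta by rewrite -lte_fin fineK.
  have dec := @visits_decomposition G (B L) beta L (ltW b0).
  have hB omega : ~ B L omega -> exists2 n, (0 < n <= L)%N & (visits G n omega)%:R <= beta * n%:R.
    move=> nB; apply: contrapT => nE; apply: nB => n nL.
    by rewrite leNgt; apply/negP => h; apply: nE; exists n => //; exact: ltW.
  have key (N : nat) : N%:R * beta <= L%:R.
    have : (\int[mu]_omega (visits G N omega)%:R%:E <=
       \int[mu]_omega ((beta * N%:R + L%:R)%:E + (visits (B L) N omega)%:R%:E))%E.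
      apply: ge0_le_integral => //.
      - by apply/measurable_EFinP; exact: measurable_visits.
      - apply: emeasurable_funD; first exact: measurable_cst.
        by apply/measurable_EFinP; exact: measurable_visits.
      - by move=> omega _; rewrite -EFinD lee_fin; have := dec hB N omega; lra.
    rewrite ge0_integralD//; last 2 first.
    - by move=> omega _; rewrite lee_fin addr_ge0// mulr_ge0// ltW.
    - by apply/measurable_EFinP; exact: measurable_visits.
    rewrite !integral_visits// integral_cst//.
    rewrite [X in (_ * X)%E](_ : _ = 1%E) ?mule1; last exact: probability_setT.
    rewrite -EFinD lee_fin.
    have : N%:R * fine (mu (B L)) <= N%:R * beta by rewrite ler_wpM2l// ltW.
    have -> : N%:R * fine (mu G) = 3 * (N%:R * beta) by rewrite /beta; field.
    lra.
  have := key (Num.bound (L%:R / beta)).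
  have : 0 <= L%:R / beta by rewrite divr_ge0// ltW.
  move=> /archi_boundP; rewrite ltr_pdivrMr// => h1 h2.
  by have := lt_le_trans h1 h2; rewrite ltxx.
have Bdec : {homo B : n m / (n <= m)%N >-> (m <= n)%O}.
  move=> n m nm; apply/subsetPset => omega h k /andP[k0 kn].
  by apply: h; rewrite k0 (leq_trans kn).
have mcap : measurable (\bigcap_n B n) by exact: bigcap_measurable.
have B0 : (mu (B 0%N) < +oo)%E by apply: le_lt_trans (probability_le1 _ _) (ltry _).
have cap0 : mu (\bigcap_n B n) = 0%E.
  apply/eqP; rewrite eq_le measure_ge0 andbT.
  have nE0 : mu (~` E) = 0%E by rewrite probability_setC// E1 subee.
  rewrite -nE0; apply: le_measure; rewrite ?inE//; first exact: measurableC.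
  move=> omega h Eo; have [[|n]] := Eo 0%N.
    by rewrite /visits big_ord0 mulr0 subr0 ltxx.
  by rewrite subr0 ltNge => /negP; apply; apply: (h n.+1 I); rewrite leqnn.
have cB := nonincreasing_cvg_mu B0 mB mcap Bdec.
have : (beta%:E <= mu (\bigcap_n B n))%E.
  by apply: (cvge_ge _ cB); apply: nearW => L; exact: low.
by rewrite cap0 lee_fin leNgt b0.
Qed.

End visit_frequency.

(** * Almost sure constancy and the upper bound *)

Section almost_sure_exponent.
Context {d : measure_display} {Omega : measurableType d} {R : realType}.
Variables (mu : probability Omega R) (sigma : Omega -> Omega).
Hypothesis erg : ergodic_automorphism mu sigma.
Variables (eps1 eps2 : Omega -> R).
Hypotheses (meps1 : measurable_fun setT eps1) (meps2 : measurable_fun setT eps2).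
Hypotheses (ceps1 : countable (range eps1)) (ceps2 : countable (range eps2)).
Hypothesis eps1_itv : forall omega, 0 <= eps1 omega <= 1.
Hypothesis eps2_itv : forall omega, 0 <= eps2 omega <= 1.
Implicit Types (omega : Omega) (t : R).

Lemma ae_set_ex (P : set Omega) : (\forall omega \ae mu, P omega) -> exists omega, P omega.
Proof.
move=> [N [mN N0 PN]]; apply: contrapT => nP.
have NT : N = setT by apply/seteqP; split => // omega _; apply: PN => Po; apply: nP; exists omega.
by have := probability_setT mu; rewrite -NT N0 => /eqP; rewrite eq_sym onee_eq0.
Qed.

Section fixed_kappa.
Variable kappa : R.
Hypothesis kappa_itv : 0 < kappa <= (100 ^+ 2)^-1.
Local Notation PFc := (PF_cocycle sigma eps1 eps2 kappa).
Local Notation V0 := (@V0 R).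
Local Notation opn n omega := (opnorm_on V0 (PFc n omega)).
Local Notation growth omega := (growth_rate sigma eps1 eps2 kappa omega V0).

Lemma discrete_PF_cocycle n : discrete_fun (PFc n).
Proof.
elim: n => [|n ih]; first exact: (discrete_fun_cst (fun x : R -> R => x)).
pose step (q : ((R * R) * ((R -> R) -> R -> R))) : (R -> R) -> R -> R :=
  fun f => PF (tent (kappa * q.1.1) (kappa * q.1.2)) (q.2 f).
have -> : PFc n.+1 = step \o (fun omega =>
   ((eps1 \o iter n sigma) omega, (eps2 \o iter n sigma) omega, PFc n omega)).
  by apply/funext.
apply: discrete_fun_comp; apply: discrete_fun_pair => //.
by apply: discrete_fun_pair; apply: (discrete_fun_iter erg); exact: discrete_fun_countable.
Qed.

(** With a free [C] the condition is built from countable operations and carries over from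
    [sigma omega] to [omega]; by [exp_growth_lt] it still determines the growth rate. *)
Definition exponent_le t : set Omega :=
  [set omega | exists C : R, forall n, (opn n omega <= (expR (t * n%:R + C))%:E)%E].

Lemma measurable_exponent_le t : measurable (exponent_le t).
Proof.
have -> : exponent_le t = \bigcup_C \bigcap_n (PFc n @^-1`
    [set L | (opnorm_on V0 L <= (expR (t * n%:R + C%:R))%:E)%E]).
  apply/seteqP; split => [omega [C hC]|omega [C _ hC]]; last first.
    by exists C%:R => n; exact: hC n I.
  exists (Num.bound `|C|) => // n _; apply: (le_trans (hC n)).
  rewrite lee_fin ler_expR lerD2l; apply: le_trans (ler_norm _) _.
  exact: ltW (archi_boundP (normr_ge0 C)).
apply: bigcup_measurable => C _; apply: bigcap_measurable; first by exists 0%N.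
by move=> n _; exact: discrete_fun_pre (discrete_PF_cocycle n).
Qed.

Lemma opnorm0_le1 omega : (opn 0 omega <= 1)%E.
Proof. by apply: ge_ereal_sup => _ [f [_ f1] <-]. Qed.

(** [opnorm_shift] carries a bound at [sigma omega] back to [omega], so it is the complement that is
    forward invariant. *)
Lemma exponent_le_zero_one t : mu (exponent_le t) = 0%E \/ mu (exponent_le t) = 1%E.
Proof.
have mE := measurable_exponent_le t.
have [K K0 hK] := opnorm_shift sigma eps1_itv eps2_itv kappa_itv.
have inv omega : (~` exponent_le t) omega -> (~` exponent_le t) (sigma omega).
  move=> nE [C hC]; apply: nE; exists `|C - t + ln K| => -[|n].
    apply: (le_trans (opnorm0_le1 omega)); rewrite lee_fin mulr0 add0r.
    by rewrite -expR0 ler_expR.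
  apply: (le_trans (hK n omega)).
  apply: (@le_trans _ _ (K%:E * (expR (t * n%:R + C))%:E)%E).
    by rewrite lee_pmul2l.
  rewrite -EFinM lee_fin -[X in X * _](@lnK _ K) ?posrE// -expRD ler_expR.
  by rewrite -natr1 mulrDr mulr1; have := ler_norm (C - t + ln K); lra.
have := forward_invariant_zero_one erg (measurableC mE) inv.
rewrite probability_setC// -[mu _]fineK ?fin_num_measure//.
rewrite -EFinB => -[[h]|[h]]; [right|left]; congr EFin; lra.
Qed.

Lemma opnorm_V0_fin n omega : (opn n omega < +oo)%E.
Proof.
apply: (le_lt_trans (opnorm_upper sigma eps1_itv eps2_itv kappa_itv n omega)).
exact: ltry.
Qed.

(** Rational rates suffice, so only countably many null sets have to be discarded for the rate to be
    almost surely constant. *)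
Lemma growth_rate_inf omega : growth omega =
  ereal_inf [set (ratr q : R)%:E | q in [set q : rat | exponent_le (ratr q) omega]].
Proof.
have a0 n := opnorm_V0_ge0 sigma eps1 eps2 kappa n omega.
apply/eqP; rewrite eq_le; apply/andP; split.
  apply: le_ereal_inf_tmp => _ [q [C hC] <-].
  exact: (exp_growth_le a0 hC).
rewrite leNgt; apply/negP => /[dup] lt1.
(* Two reals in between, even if an end is infinite; a rational separating them gives the
   contradiction. *)
have [x [y [xy gx yi]]] : exists x y : R, [/\ x < y, (growth omega < x%:E)%E &
    (y%:E < ereal_inf [set (ratr q : R)%:E | q in [set q : rat | exponent_le (ratr q) omega]])%E].
  move: lt1; case: (growth omega) => [g| |]; case: (ereal_inf _) => [i| |] //.
  - by rewrite lte_fin => gi; exists ((2 * g + i) / 3), ((g + 2 * i) / 3); rewrite !lte_fin; split; lra.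
  - by move=> _; exists (g + 1), (g + 2); rewrite ltry lte_fin; split => //; lra.
  - by move=> _; exists (i - 2), (i - 1); rewrite ltNyr lte_fin; split => //; lra.
  - by move=> _; exists 0, 1; rewrite ltry ltNyr.
move=> _; have [q] := rat_in_itvoo xy; rewrite in_itv/= => /andP[xq qy].
have gq : (growth omega < (ratr q : R)%:E)%E by apply: lt_trans gx _; rewrite lte_fin.
have [C hC] := exp_growth_lt a0 (fun n => opnorm_V0_fin n omega) gq.
have : (ereal_inf [set (ratr q : R)%:E | q in [set q : rat | exponent_le (ratr q) omega]] <= (ratr q)%:E)%E.
  by apply: ereal_inf_lbound; exists q => //; exists C.
move=> /(lt_le_trans yi); rewrite lte_fin => yq.
by have := lt_trans yq qy; rewrite ltxx.
Qed.

Lemma growth_rate_ae_constant : exists l : \bar R, \forall omega \ae mu, growth omega = l.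
Proof.
exists (ereal_inf [set (ratr q : R)%:E | q in [set q : rat | mu (exponent_le (ratr q)) = 1%E]]).
have : \forall omega \ae mu, forall k : nat, forall q : rat, unpickle k = Some q ->
    (exponent_le (ratr q) omega <-> mu (exponent_le (ratr q)) = 1%E).
  apply: ae_foralln => k; case E : (unpickle k : option rat) => [q|]; last first.
    by exists set0; split => // omega /= h; exfalso; apply: h.
  have mE := measurable_exponent_le (ratr q).
  have [h|h] := exponent_le_zero_one (ratr q).
    exists (exponent_le (ratr q)); split => // omega /= nh; apply: contrapT => nE.
    apply: nh => _ [<-]; split => // h1.
    by move: h1; rewrite h => /eqP; rewrite eq_sym onee_eq0.
  exists (~` exponent_le (ratr q)); split; first exact: measurableC.
    by apply: (etrans (probability_setC mu mE)); rewrite h subee.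
  by move=> omega /= nh hE; apply: nh => _ [<-]; split.
apply: filterS => omega h; rewrite growth_rate_inf; congr ereal_inf.
congr image; apply/seteqP; split => q /= hq.
  by apply/(h (pickle q) q _) => //; rewrite pickleK.
by apply/(h (pickle q) q _) => //; rewrite pickleK.
Qed.

End fixed_kappa.

Lemma ae_positive_set (eps : Omega -> R) : measurable_fun setT eps ->
  (forall omega, 0 <= eps omega) -> ~ (\forall omega \ae mu, eps omega = 0) ->
  exists2 eta : R, 0 < eta & measurable [set omega | eta <= eps omega] /\
    (0 < mu [set omega | (eta <= eps omega)%R])%E.
Proof.
move=> meps eps0 n0; pose F (j : nat) := [set omega | j.+1%:R^-1 <= eps omega].
have mF j : measurable (F j).
  have -> : F j = eps @^-1` `[j.+1%:R^-1, +oo[%classic.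
    by apply/seteqP; split => omega; rewrite /F /= in_itv/= andbT.
  by rewrite -[X in measurable X]setTI; exact: meps.
apply: contrapT => nE; apply: n0.
have F0 j : mu.-negligible (F j).
  exists (F j); split => //; apply/eqP; rewrite eq_le measure_ge0 andbT leNgt.
  by apply/negP => h; apply: nE; exists (j.+1%:R^-1) => //; split => //; exact: (mF j).
have := negligible_bigcup F0; apply: negligibleS => omega /= e0.
have ep : 0 < eps omega by rewrite lt_neqAle eps0 andbT eq_sym; apply/eqP.
exists (Num.bound (eps omega)^-1) => //; rewrite /F /= -[leRHS]invrK lef_pV2 ?posrE ?invr_gt0//.
apply: le_trans (ltW (archi_boundP _)) _; first by rewrite invr_ge0 ltW.
by rewrite ler_nat.
Qed.

Lemma second_exponent_upper : ~ (\forall omega \ae mu, eps1 omega = 0) ->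
  exists2 c : R, 0 < c & exists2 kappa0 : R, 0 < kappa0 &
    forall kappa : R, 0 < kappa <= 1 -> kappa < kappa0 ->
      exists2 lambda2 : \bar R, is_lambda2 mu sigma eps1 eps2 kappa lambda2 &
        (lambda2 <= (- (c * kappa))%:E)%E.
Proof.
move=> n0.
have [eta eta0 [mG G0]] := ae_positive_set meps1 (fun omega => proj1 (andP (eps1_itv omega))) n0.
set G := [set omega | eta <= eps1 omega] in mG G0.
have [beta beta0 freq] := visits_frequency erg mG G0.
(* As e / (1 + e) >= e / 2, a visit to [G] contributes at most - kappa eta / 2 to the logarithm,
   which at frequency [beta] amounts to - 2 c kappa per step. The bound (c / 200)^2 on [kappa] keeps
   the error 200 kappa^(3/2) below c kappa. *)
pose c := eta * beta / 4; have c0 : 0 < c by rewrite divr_gt0// mulr_gt0.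
exists c => //; exists (Num.min ((100 ^+ 2)^-1) ((c / 200) ^+ 2)).
  have cc : 0 < c / 200 by apply: divr_gt0; lra.
  by rewrite lt_min (exprn_gt0 2 cc) andbT expr2; lra.
move=> kappa /andP[k0 k1]; rewrite lt_min => /andP[kb kc].
have kappa_itv : 0 < kappa <= (100 ^+ 2)^-1 by rewrite k0 ltW.
have zc : 200 * Num.sqrt kappa <= c.
  have : Num.sqrt kappa <= c / 200.
    have cc : 0 <= c / 200 by lra.
    by rewrite -[leRHS](ger0_norm cc) -sqrtr_sqr ler_wsqrtr// ltW.
  lra.
have z3 : 200 * Num.sqrt kappa ^+ 3 <= c * kappa.
  have -> : 200 * Num.sqrt kappa ^+ 3 = 200 * Num.sqrt kappa * kappa.
    by rewrite exprS sqr_sqrtr ?mulrA// ltW.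
  by apply: ler_wpM2r zc; exact: ltW.
have z30 : 0 <= 200 * Num.sqrt kappa ^+ 3 by apply: mulr_ge0; [lra|apply: exprn_ge0].
have [l hl] := growth_rate_ae_constant kappa_itv.
have [K K0 hK] : exists2 K : R, 0 < K & forall n omega,
    (opnorm_on (@V0 R) (PF_cocycle sigma eps1 eps2 kappa n omega) <= (K *
     \prod_(k < n) (decay eps1 eps2 kappa (iter k sigma omega) + 200 * Num.sqrt kappa ^+ 3))%:E)%E.
  exists (536 / kappa ^+ 2); first by apply: divr_gt0; [lra|exact: exprn_gt0].
  by move=> n omega; exact: (opnorm_upper sigma eps1_itv eps2_itv kappa_itv n omega).
have gl : \forall omega \ae mu, (growth_rate sigma eps1 eps2 kappa omega (@V0 R) <= (- (c * kappa))%:E)%E.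
  apply: filterS freq => omega [C hC].
  apply: (@exp_growth_le _ _ _ (kappa * eta / 2 * C + ln K)).
    by move=> n; exact: opnorm_V0_ge0.
  move=> n; apply: (le_trans (hK n omega)).
  rewrite lee_fin addrA expRD lnK ?posrE// [leLHS]mulrC ler_wpM2r ?(ltW K0)//.
  have h2 : expR (- (kappa * eta / 2) * (visits sigma G n omega)%:R +
      200 * Num.sqrt kappa ^+ 3 * n%:R) <= expR (- (c * kappa) * n%:R + kappa * eta / 2 * C).
    rewrite ler_expR; have := hC n.
    have n0' : 0 <= n%:R :> R by [].
    move: z3 => /(ler_wpM2r n0') z3n hn.
    have : kappa * eta / 2 * (beta * n%:R - C) <= kappa * eta / 2 * (visits sigma G n omega)%:R.
      by rewrite ler_wpM2l// divr_ge0// mulr_ge0// ltW.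
    move: z3n; rewrite /c; lra.
  apply: le_trans h2.
  have -> : - (kappa * eta / 2) * (visits sigma G n omega)%:R + 200 * Num.sqrt kappa ^+ 3 * n%:R =
    \sum_(k < n) (- (kappa * eta / 2) * (iter k sigma omega \in G)%:R + 200 * Num.sqrt kappa ^+ 3).
    by rewrite [X in _ + X = _]mulr_natr big_split /= -mulr_sumr sumr_const card_ord /visits natr_sum.
  rewrite expR_sum; apply: ler_prod => k _.
  set omega' := iter k sigma omega.
  have dk := decay_itv eps1_itv eps2_itv kappa_itv omega'.
  apply/andP; split; first by move: kb; rewrite expr2; lra.
  apply: le_trans (expR_ge1Dx _); rewrite addrA lerD2r /decay.
  have /andP[p1 p1'] := eps1_itv omega'; have /andP[p2 p2'] := eps2_itv omega'.
  have q1 : 0 <= kappa * eps1 omega' <= 1 by rewrite mulr_ge0 ?mulr_ile1// ltW.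
  have q2 : 0 <= kappa * eps2 omega' / (1 + kappa * eps2 omega').
    by have := mulr_ge0 (ltW k0) p2 => h; apply: divr_ge0; lra.
  have q3 : kappa * eps1 omega' / 2 <= kappa * eps1 omega' / (1 + kappa * eps1 omega').
    by apply: ler_wpM2l; [lra|rewrite lef_pV2 ?posrE; lra].
  have q4 : kappa * eta / 2 * (omega' \in G)%:R <= kappa * eps1 omega' / 2.
    case: (boolP (omega' \in G)) => [/set_mem Go|_]; last by rewrite mulr0 divr_ge0//; lra.
    by rewrite mulr1 ler_wpM2r// ler_wpM2l// ltW.
  lra.
exists l; last first.
  have [omega [h1 h2]] : exists omega, growth_rate sigma eps1 eps2 kappa omega (@V0 R) = l /\
     (growth_rate sigma eps1 eps2 kappa omega (@V0 R) <= (- (c * kappa))%:E)%E.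
    by apply: ae_set_ex; apply: filterS2 hl gl => omega; split.
  by rewrite -h1.
apply: filterS2 hl gl => omega <- hg; apply: second_exponent_eq => //.
by apply: le_trans hg _; rewrite lee_fin oppr_le0 mulr_ge0// ltW.
Qed.

End almost_sure_exponent.

(** * Markov partitions from affine pieces *)

Section markov_partition.
Context {R : realType}.
Implicit Types (T : R -> R) (x y c s : R).

Definition cut_point N (a b : 'I_N -> R) c : Prop := forall j, b j <= c \/ c <= a j.

Lemma affine_piece T c d k l : c < d -> k != 0 -> (forall x, c < x < d -> T x = k * x + l) ->
  let I := [set` `]c, d[] in
  [/\ {in I, continuous T}, monotone_on I T &
   T @` I = [set` `](if 0 < k then k * c + l else k * d + l),
                    (if 0 < k then k * d + l else k * c + l)[] ].
Proof.
move=> cd k0 TE I.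
have inI x : x \in I -> c < x < d by rewrite mem_setE in_itv.
split.
- move=> x /inI xcd.
  have nT : \forall y \near x, k * y + l = T y.
    have : x \in `]c, d[ by rewrite in_itv.
    move=> /near_in_itvoo; apply: filterS => y; rewrite in_itv/= => ycd.
    by rewrite TE.
  rewrite /continuous_at TE//; apply: cvg_trans (near_eq_cvg nT) _.
  by apply: cvgD; [apply: cvgM; [exact: cvg_cst|exact: cvg_id]|exact: cvg_cst].
- case: (ltP 0 k) => hk; [left|right] => x y /inI xI /inI yI xy; rewrite !TE// lerD2r.
    by rewrite ler_pM2l.
  by rewrite ler_nM2l// lt_neqAle k0.
apply/seteqP; split => y /=.
  move=> [x xI <-]; move: xI; rewrite /I /= in_itv/= => xI; rewrite in_itv/= TE//.
  case: (ltP 0 k) => hk; first by rewrite !ltrD2r !ltr_pM2l.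
  have hk' : k < 0 by rewrite lt_neqAle k0.
  by rewrite !ltrD2r !ltr_nM2l// andbC.
rewrite in_itv/= => yI; have xI : c < (y - l) / k < d.
  move: yI; case: (ltP 0 k) => hk.
    by rewrite ltr_pdivlMr// ltr_pdivrMr// ![_ * k]mulrC; lra.
  have hk' : k < 0 by rewrite lt_neqAle k0.
  by rewrite ltr_ndivlMr// ltr_ndivrMr// ![_ * k]mulrC; lra.
exists ((y - l) / k); first by rewrite /I /= in_itv.
by rewrite TE//; field.
Qed.

(** If the image of a piece ends at cut points, no partition interval straddles an end, so image and
    union of intervals differ at most at two points. The ends are the one-sided limits [k * a i + l]
    and [k * b i + l], since [T] may jump at an endpoint. *)
Lemma Markov_of_pieces T N (a b : 'I_N -> R) :
  (forall x, -1 <= x <= 1 -> -1 <= T x <= 1) ->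
  (forall i, a i < b i) -> injective a ->
  (forall i, -1 <= a i /\ b i <= 1) ->
  (forall x, -1 <= x <= 1 -> exists i, a i <= x <= b i) ->
  (forall i, cut_point a b (a i)) ->
  (forall i, exists k l, [/\ k != 0, (forall x, a i < x < b i -> T x = k * x + l),
     cut_point a b (k * a i + l) & cut_point a b (k * b i + l)]) ->
  Markov T.
Proof.
move=> T11 ab ainj ab1 cover cuta pieces; split.
  by move=> x; rewrite !in_itv/=; exact: T11.
exists N, a, b; split => //.
- apply/seteqP; split => x /=.
    by move=> [i _]; rewrite /= !in_itv/= => xi; have := ab1 i; lra.
  by rewrite in_itv/= => /cover[i xi]; exists i => //=; rewrite in_itv.
- apply/trivIsetP => i j _ _ ij; apply/seteqP; split => // x /=.
  rewrite !in_itv/= => -[xi xj]; move/eqP: ij; apply; apply: ainj.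
  have := cuta i j; have := cuta j i; lra.
move=> i I; have [k [l [k0 TE ck cl]]] := pieces i.
have [cT mT imT] := affine_piece (ab i) k0 TE.
split => //; rewrite -/I in imT.
set c := (if 0 < k then k * a i + l else k * b i + l) in imT.
set d := (if 0 < k then k * b i + l else k * a i + l) in imT.
have cc : cut_point a b c by rewrite /c; case: ifP.
have cd : cut_point a b d by rewrite /d; case: ifP.
have sub y : c < y < d -> -1 <= y <= 1.
  move=> ycd; have : [set` `]c, d[] y by rewrite /= in_itv.
  rewrite -imT => -[x]; rewrite /I /= in_itv/= => xi <-; apply: T11.
  by have := ab1 i; lra.
exists [set j | c <= a j /\ b j <= d]; split.
  rewrite [X in finite_set X](_ : _ = set0)//; apply/seteqP; split => // y.
  rewrite imT /= in_itv/= => -[ycd]; apply.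
  have [j yj] := cover y (sub y ycd); exists j; last by rewrite /= in_itv.
  by rewrite /=; have := cc j; have := cd j; lra.
apply: (@sub_finite_set _ _ [set c; d]); last exact: finite_set2.
move=> y [[j [cj dj]]]; rewrite imT /= !in_itv/= => yj ny.
have [/eqP h|h1] := boolP (y == c); [by left|right].
apply/eqP; rewrite eq_le; apply/andP; split; first lra.
rewrite leNgt; apply/negP => h2; apply: ny; apply/andP; split => //.
by rewrite lt_neqAle eq_sym h1; lra.
Qed.

(** Intermediate value theorem on [0, 1/2]. Since 2 (1 + kappa) >= 2, the equation yields 2^n kappa
    <= 1/2, hence the decay in [n]. *)
Lemma exists_markov_kappa n : (0 < n)%N ->
  exists kappa : R, [/\ 0 < kappa, kappa <= 2^-1 ^+ n.+1 & (2 * (1 + kappa)) ^+ n * kappa = 2^-1].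
Proof.
move=> n0; pose f (x : R) := (2 * (1 + x)) ^+ n * x.
have cf : continuous f.
  move=> x; apply: cvgM; last exact: cvg_id.
  apply: (continuous_comp (f := fun x : R => 2 * (1 + x)) (g := fun x : R => x ^+ n)).
    by apply: cvgM; [exact: cvg_cst|apply: cvgD; [exact: cvg_cst|exact: cvg_id]].
  exact: exprn_continuous.
have f0 : f 0 = 0 by rewrite /f mulr0.
have f1 : 2^-1 <= f 2^-1.
  rewrite /f ler_peMl//.
  by apply: exprn_ege1; lra.
have [|||k kb fk] := @IVT R f 0 2^-1 2^-1 _ _ _.
- lra.
- exact: continuous_subspaceT.
- rewrite f0; apply/andP; split; first by rewrite ge_min; apply/orP; left; lra.
  by rewrite le_max f1 orbT.
move: kb; rewrite in_itv/= => /andP[k0 k1]; exists k.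
have kp : 0 < k.
  rewrite lt_neqAle k0 andbT; apply/eqP => k00.
  by move: fk; rewrite -k00 f0 => /eqP; rewrite eq_sym invr_eq0 pnatr_eq0.
split => //.
have h : 2 ^+ n * k <= 2^-1.
  by rewrite -[leRHS]fk ler_wpM2r//; apply: lerXn2r; rewrite ?nnegrE//; lra.
have e : k = 2^-1 ^+ n * (2 ^+ n * k).
  by rewrite mulrA -exprMn mulVf ?expr1n ?mul1r// pnatr_eq0.
by rewrite exprSr [leLHS]e ler_wpM2l// exprn_ge0// invr_ge0.
Qed.

End markov_partition.

(** * The Markov partition of the symmetric tent map *)

Section tent_markov.
Context {R : realType}.
Variables (n : nat) (kappa : R).
Hypothesis n0 : (0 < n)%N.
Hypothesis kappa_itv : 0 < kappa <= 4^-1.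
Local Notation s := (2 * (1 + kappa)).
Hypothesis kappa_eq : s ^+ n * kappa = 2^-1.
Implicit Types (i j k : nat) (x c l : R).

(* Cut points in [0, 1]: 0, kappa, the forward orbit 1 - s^j kappa of kappa
   (which ends at the critical point 1/2 when j = n), and 1. *)
Definition cut i : R :=
  if i == 0%N then 0 else if i == 1%N then kappa else
  if i == n.+2 then 1 else 1 - s ^+ (n.+2 - i) * kappa.

Let s_bounds : 2 < s <= 5 / 2.
Proof. by move: kappa_itv; lra. Qed.

Let p_pos j : 0 < s ^+ j * kappa.
Proof. by rewrite mulr_gt0 ?exprn_gt0//; [have := s_bounds|have := kappa_itv]; lra. Qed.

Let cut_mid i : (2 <= i <= n.+1)%N -> cut i = 1 - s ^+ (n.+2 - i) * kappa.
Proof.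
move=> /andP[i2 i1]; rewrite /cut gtn_eqF ?(leq_trans _ i2)// gtn_eqF//.
by rewrite ltn_eqF.
Qed.

Let cut2 : cut 2 = 2^-1.
Proof. by rewrite cut_mid//= !subSS subn0 kappa_eq; field. Qed.

Let cut_last : cut n.+2 = 1.
Proof. by rewrite /cut !eqSS eqxx; case: n n0. Qed.

Let cut_n1 : cut n.+1 = 1 - s * kappa.
Proof. by rewrite cut_mid ?ltnS ?n0 ?leqnn// subSnn expr1. Qed.

Let cut_lt i : (i < n.+2)%N -> cut i < cut i.+1.
Proof.
case: i => [_|[_|i]].
- by rewrite /cut/=; have := kappa_itv; lra.
- by rewrite cut2 {1}/cut/=; have := kappa_itv; lra.
rewrite !ltnS => i_n; rewrite [X in X < _]cut_mid; last by rewrite !ltnS /= i_n.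
have := i_n; rewrite leq_eqVlt => /predU1P[->|i_n1].
  by rewrite cut_last ltrBlDr ltrDl p_pos.
rewrite cut_mid; last by rewrite !ltnS /= i_n1.
rewrite ltrD2l ltrN2 ltr_pM2r; last by have := kappa_itv; lra.
rewrite !subSS ltr_eXn2l; last by have := s_bounds; lra.
by rewrite ltn_sub2l.
Qed.

Let cut_le i j : (i <= j)%N -> (j <= n.+2)%N -> cut i <= cut j.
Proof.
move=> /subnK <-; elim: (j - i)%N => [//|k ih] h; rewrite addSn in h *.
by apply: le_trans (ih (ltnW h)) (ltW (cut_lt h)).
Qed.

Let cut_ge0 i : (i <= n.+2)%N -> 0 <= cut i.
Proof. exact: (@cut_le 0). Qed.

Let cut_le1 i : (i <= n.+2)%N -> cut i <= 1.
Proof. by move=> h; rewrite -cut_last; exact: cut_le. Qed.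

Let cut_inj i j : (i <= n.+2)%N -> (j <= n.+2)%N -> cut i = cut j -> i = j.
Proof.
move=> im jm e; have [ij|ji|//] := ltngtP i j.
  have := lt_le_trans (cut_lt (leq_trans ij jm)) (cut_le ij jm); rewrite e ltxx //.
by have := lt_le_trans (cut_lt (leq_trans ji im)) (cut_le ji im); rewrite e ltxx.
Qed.

Let cut_cover x : 0 <= x <= 1 -> exists2 i, (i < n.+2)%N & cut i <= x <= cut i.+1.
Proof.
move=> /andP[x0 x1].
have step m : (m <= n.+2)%N -> x <= cut m ->
    exists2 i, (i < n.+2)%N & cut i <= x <= cut i.+1.
  elim: m => [_ xm|m ih mn xm].
    exists 0%N => //; have h : cut 0 < cut 1 by exact: cut_lt.
    by have c0 : cut 0 = 0 by []; rewrite c0 in xm h *; lra.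
  by have [xc|xc] := leP x (cut m); [exact: ih (ltnW mn) xc|exists m => //; rewrite (ltW xc)].
by apply: (step n.+2) => //; rewrite cut_last.
Qed.

Local Notation N := (n.+2 + n.+2)%N.

Definition cut_left (i : 'I_N) : R :=
  match fintype.split i with inl j => cut j | inr j => - cut j.+1 end.
Definition cut_right (i : 'I_N) : R :=
  match fintype.split i with inl j => cut j.+1 | inr j => - cut j end.

Let good c := exists2 k, (k <= n.+2)%N & c = cut k \/ c = - cut k.

Let goodN c : good c -> good (- c).
Proof. by move=> [k kn [->|->]]; exists k => //; [right|left; rewrite opprK]. Qed.

Let good_cut c : good c -> cut_point cut_left cut_right c.
Proof.
move=> [k kn hc] i; rewrite /cut_left /cut_right.
case: (fintype.split i) => j; have jn := ltn_ord j.
  have j0 := cut_ge0 (ltnW jn); have k0 := cut_ge0 kn.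
  case: hc => ->; last by right; lra.
  by have [kj|jk] := leqP k j; [right; exact: cut_le (ltnW jn)|left; exact: cut_le].
have j0 := cut_ge0 (ltnW jn); have k0 := cut_ge0 kn.
case: hc => ->; first by left; lra.
by rewrite !lerN2; have [kj|jk] := leqP k j; [left; exact: cut_le (ltnW jn)|right; exact: cut_le].
Qed.

(** Cells 0 and 1 lie left of the turning point 1/2, the others right of it. One-sided limits at cut
    points are again cut points up to sign: 0 goes to 1, kappa to 1 - s kappa, 1/2 to - kappa, 1 to
    itself, and any other [cut i] to [cut i.-1]. The map is odd, so the mirrored cell has the same
    slope and the opposite intercept. *)
Let right_piece j : (j < n.+2)%N -> exists c l,
  [/\ c != 0, (forall x, cut j < x < cut j.+1 -> tent kappa kappa x = c * x + l),
      (forall x, - cut j.+1 < x < - cut j -> tent kappa kappa x = c * x - l),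
      good (c * cut j + l) & good (c * cut j.+1 + l)].
Proof.
move=> jn; have sb := s_bounds; have kb := kappa_itv; have j0 := cut_ge0 (ltnW jn).
have [j2|j2] := ltnP j 2.
  have jh : cut j.+1 <= 2^-1 by rewrite -cut2; apply: cut_le.
  exists (- s), 1; split.
  - by rewrite oppr_eq0; apply/eqP; lra.
  - move=> x xj; rewrite /tent; have -> : (x == 0) = false by apply/negP => /eqP; lra.
    have -> : (x <= - 2^-1) = false by apply/negP; lra.
    have -> : (x < 0) = false by apply/negP; lra.
    by have -> : (x <= 2^-1) = true by [apply/idP; lra]; ring.
  - move=> x xj; rewrite /tent; have -> : (x == 0) = false by apply/negP => /eqP; lra.
    have -> : (x <= - 2^-1) = false by apply/negP; lra.
    by have -> : (x < 0) = true by [apply/idP; lra]; ring.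
  - case: j j2 {jn j0 jh} => [|[|//]] _.
      by exists n.+2 => //; left; rewrite cut_last /cut/=; ring.
    by exists n.+1 => //; left; rewrite cut_n1 /cut/=; ring.
  case: j j2 {jn j0 jh} => [|[|//]] _.
    by exists n.+1 => //; left; rewrite cut_n1 /cut/=; ring.
  by exists 1%N => //; right; rewrite cut2 /cut/=; field.
have jh : 2^-1 <= cut j by rewrite -cut2; apply: cut_le => //; exact: ltnW.
have val i : (2 <= i <= n.+1)%N -> good (s * cut i + (1 - s)).
  move=> /andP[i2 i1]; rewrite leq_eqVlt in i2; case/predU1P: i2 => [<-|i3].
    by exists 1%N => //; right; rewrite cut2 /cut/=; field.
  exists i.-1; first by rewrite (leq_trans (leq_pred _))// ltnW.
  left; rewrite (@cut_mid i) ?(ltnW i3)// (@cut_mid i.-1); last first.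
    by case: i i3 i1 => [|i] i3 i1 //; apply/andP; split; [exact: i3|exact: ltnW].
  have -> : (n.+2 - i.-1 = (n.+2 - i).+1)%N by case: i i3 i1 => // i _ i1; rewrite subSS subSn// ltnW.
  by rewrite exprS; ring.
exists s, (1 - s); split.
- by apply/eqP; lra.
- move=> x xj; rewrite /tent; have -> : (x == 0) = false by apply/negP => /eqP; lra.
  have -> : (x <= - 2^-1) = false by apply/negP; lra.
  have -> : (x < 0) = false by apply/negP; lra.
  by have -> : (x <= 2^-1) = false by [apply/negP; lra]; ring.
- move=> x xj; rewrite /tent; have -> : (x == 0) = false by apply/negP => /eqP; lra.
  by have -> : (x <= - 2^-1) = true by [apply/idP; lra]; ring.
- by apply: val; rewrite j2.
have := jn; rewrite ltnS leq_eqVlt => /predU1P[->|jn1].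
  by exists n.+2 => //; left; rewrite cut_last; ring.
by apply: val; rewrite ltnS (ltnW j2).
Qed.

Lemma tent_Markov : Markov (tent kappa kappa).
Proof.
have sb := s_bounds; have kb := kappa_itv.
apply: (@Markov_of_pieces R _ N cut_left cut_right).
- move=> x xb; rewrite /tent; case: eqP => [_|_]; first lra.
  have prod t : 0 <= t <= 2^-1 -> 0 <= s * t <= 2.
    move=> tb; have : 0 <= kappa * t by rewrite mulr_ge0; lra.
    have : kappa * t <= 4^-1 * t by rewrite ler_wpM2r; lra.
    lra.
  case: (leP x (- 2^-1)) => h1.
    by have := prod (x + 1) ltac:(lra); lra.
  case: (ltP x 0) => h2; first by have := prod (- x) ltac:(lra); lra.
  case: (leP x 2^-1) => h3; first by have := prod x ltac:(lra); lra.
  by have := prod (1 - x) ltac:(lra); lra.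
- move=> i; rewrite /cut_left /cut_right; case: (fintype.split i) => j; first exact: cut_lt.
  by rewrite ltrN2; exact: cut_lt.
- move=> i1 i2; rewrite /cut_left => e; apply: (can_inj (@splitK _ _)); move: e.
  case: (fintype.split i1) => j1; case: (fintype.split i2) => j2 e;
    have b1 := ltn_ord j1; have b2 := ltn_ord j2.
  + by congr inl; apply/val_inj/cut_inj => //; exact: ltnW.
  + exfalso; have := cut_ge0 (ltnW b1); have := cut_lt b2; have := cut_ge0 (ltnW b2); lra.
  + exfalso; have := cut_ge0 (ltnW b2); have := cut_lt b1; have := cut_ge0 (ltnW b1); lra.
  + congr inr; apply/val_inj; apply: succn_inj; apply: cut_inj => //.
    exact: oppr_inj.
- move=> i; rewrite /cut_left /cut_right; case: (fintype.split i) => j; have jn := ltn_ord j.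
    have := cut_ge0 (ltnW jn); have := cut_le1 jn; lra.
  have := cut_ge0 (ltnW jn); have := cut_le1 jn; lra.
- move=> x xb; case: (leP 0 x) => x0.
    have [i im xi] := @cut_cover x ltac:(lra).
    exists (unsplit (inl (Ordinal im))).
    by rewrite /cut_left /cut_right unsplitK.
  have [i im xi] := @cut_cover (- x) ltac:(lra).
  exists (unsplit (inr (Ordinal im))).
  rewrite /cut_left /cut_right unsplitK /=; lra.
- move=> i; apply: good_cut; rewrite /cut_left; case: (fintype.split i) => j.
    by exists j; [exact: ltnW|left].
  by apply: goodN; exists j.+1 => //; left.
move=> i; rewrite /cut_left /cut_right; case: (fintype.split i) => j.
  have [c [l [c0 h1 _ g1 g2]]] := right_piece (ltn_ord j).
  by exists c, l; split => //; exact: good_cut.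
have [c [l [c0 _ h1 g1 g2]]] := right_piece (ltn_ord j).
exists c, (- l); split => //; apply: good_cut.
  by have := goodN g2; congr good; ring.
by have := goodN g1; congr good; ring.
Qed.

End tent_markov.

(** * Asymptotics for the constant cocycle *)

Section sharpness.
Context {d : measure_display} {Omega : measurableType d} {R : realType}.
Variables (mu : probability Omega R) (sigma : Omega -> Omega).
Implicit Types (omega : Omega) (kappa : R).
Local Notation one := (fun=> 1 : R).
Local Notation growth kappa omega := (growth_rate sigma one one kappa omega (@V0 R)).

Let one_itv : forall omega, 0 <= (one omega : R) <= 1.
Proof. by move=> omega; rewrite ler01 lexx. Qed.

Let decay_one kappa omega : decay one one kappa omega = 1 - 2 * (kappa / (1 + kappa)).
Proof. by rewrite /decay mulr1; ring. Qed.

(** The rate lies between the logarithms of the per-step factors [lo] and [hi]. The threshold is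
    stricter than before because the upper bound - 2 kappa + 202 z kappa must be negative for
    [second_exponent_eq] to apply, which z <= 1/100 would not ensure. *)
Lemma growth_rate_bounds kappa omega : 0 < kappa <= (150 ^+ 2)^-1 ->
  exists r : R, [/\ second_exponent_at sigma one one kappa omega = r%:E &
     `|r / (- 2 * kappa) - 1| <= 200 * Num.sqrt kappa].
Proof.
rewrite expr2 => kb; set z := Num.sqrt kappa.
have k0 : 0 < kappa by lra.
have kappa_itv : 0 < kappa <= (100 ^+ 2)^-1 by rewrite expr2; lra.
have zz : z ^+ 2 = kappa by rewrite sqr_sqrtr// ltW.
have zb : 0 <= z <= 150^-1.
  rewrite sqrtr_ge0 /=; have -> : 150^-1 = Num.sqrt ((150 ^+ 2)^-1) :> R.
    by rewrite -exprVn sqrtr_sqr ger0_norm// invr_ge0.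
  by rewrite ler_wsqrtr// expr2; lra.
have zk : kappa <= z * 150^-1 by rewrite -[leLHS]zz expr2 ler_wpM2l//; lra.
have z3E : z ^+ 3 = z * kappa by rewrite exprS zz.
have zkb : 0 <= z * kappa <= 150^-1 * kappa.
  by apply/andP; split; [apply: mulr_ge0|apply: ler_wpM2r]; lra.
set w := kappa / (1 + kappa).
have w1 : kappa - z * kappa <= w <= kappa.
  rewrite /w ler_pdivlMr ?ler_pdivrMr; [|lra..].
  have : 0 <= kappa * kappa by apply: mulr_ge0; lra.
  have : kappa * kappa <= z * kappa by apply: ler_wpM2r; lra.
  have : 0 <= z * kappa * kappa by apply: mulr_ge0; lra.
  lra.
pose lo := 1 - 2 * w - 240 * (z * kappa); pose hi := 1 - 2 * w + 200 * (z * kappa).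
have lo0 : 1 - 3 * z <= lo by rewrite /lo; lra.
have lop : 0 < lo by lra.
have hip : 0 < hi by rewrite /hi; lra.
have prodE (c : R) n : \prod_(k < n) (decay one one kappa (iter k sigma omega) + c) = (1 - 2 * w + c) ^+ n.
  rewrite (eq_bigr (fun=> 1 - 2 * w + c)) => [|k _]; last by rewrite decay_one.
  by rewrite prodr_const card_ord.
have expE (x : R) n C : 0 < x -> 0 < C -> C * x ^+ n = expR (ln x * n%:R + ln C).
  move=> x0 C0; rewrite expRD lnK ?posrE// mulrC; congr (_ * _).
  by rewrite expRM_natr lnK.
have up : (growth kappa omega <= (ln hi)%:E)%E.
  pose K : R := 536 / kappa ^+ 2.
  have K0 : 0 < K by apply: divr_gt0; [lra|exact: exprn_gt0].
  apply: (@exp_growth_le _ _ _ (ln K)) => n; first exact: opnorm_V0_ge0.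
  apply: le_trans (opnorm_upper sigma one_itv one_itv kappa_itv n omega) _.
  by rewrite prodE z3E -expE// lexx.
have low : ((ln lo)%:E <= growth kappa omega)%E.
  apply: (@exp_growth_ge _ _ _ (ln 8^-1)) => n.
  apply: le_trans (opnorm_lower sigma one_itv one_itv kappa_itv n omega).
  by rewrite prodE z3E -expE// ?invr_gt0// lexx.
have lnhi : ln hi <= - 2 * w + 200 * (z * kappa).
  have -> : hi = 1 + (- 2 * w + 200 * (z * kappa)) by rewrite /hi; ring.
  by apply: le_ln1Dx; rewrite /hi in hip; lra.
have lnlo : (lo - 1) / lo <= ln lo.
  have : - ln lo <= lo^-1 - 1.
    rewrite -lnV ?posrE//; have {1}-> : lo^-1 = 1 + (lo^-1 - 1) by ring.
    by apply: le_ln1Dx; rewrite ltrBrDl subrr invr_gt0.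
  have -> : (lo - 1) / lo = 1 - lo^-1 by field; rewrite gt_eqF.
  lra.
have g0 : (growth kappa omega <= 0)%E.
  apply: le_trans up _; rewrite lee_fin; apply: le_trans lnhi _; lra.
rewrite (second_exponent_eq one_itv one_itv kappa_itv g0).
have [r gr] : exists r : R, growth kappa omega = r%:E.
  move: up low; case: (growth kappa omega) => [r _ _| |]; first by exists r.
    by rewrite leye_eq.
  by rewrite leeNy_eq.
rewrite gr in up low *; rewrite !lee_fin in up low; exists r; split => //.
have nk : 0 < 2 * kappa by lra.
have lolow : - (2 * kappa * (1 + 200 * z)) <= (lo - 1) / lo.
  rewrite ler_pdivlMr//.
  have h1 : 2 * kappa * (1 + 200 * z) * (1 - 3 * z) <= 2 * kappa * (1 + 200 * z) * lo.
    by apply: ler_wpM2l lo0; apply: mulr_ge0; lra.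
  (* Half of the margin 2 kappa (1 + 200 z)(1 - 3 z) - (2 kappa + 240 z kappa). *)
  have h2 : 0 <= (z * kappa) * (77 - 600 * z) by apply: mulr_ge0; lra.
  rewrite [in leRHS]/lo; lra.
have -> : r / (- 2 * kappa) - 1 = - (r + 2 * kappa) / (2 * kappa) by field; lra.
rewrite normf_div (gtr0_norm nk) ler_pdivrMr// normrN ler_norml.
lra.
Qed.

Lemma second_exponent_at_indep kappa omega omega' :
  second_exponent_at sigma one one kappa omega = second_exponent_at sigma one one kappa omega'.
Proof.
have E n : PF_cocycle sigma one one kappa n omega = PF_cocycle sigma one one kappa n omega'.
  apply/funext => f; elim: n => [//|n ih].
  by rewrite /PF_cocycle /= -!/(PF_cocycle _ _ _ _ _ _) ih.
have G V : growth_rate sigma one one kappa omega V = growth_rate sigma one one kappa omega' V.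
  by rewrite /growth_rate; under eq_fun do rewrite E.
exact: (f_equal (@ereal_inf R) (eq_imagel (fun V _ => G V))).
Qed.

Lemma second_exponent_sharp : exists kappa : nat -> R,
     [/\ forall n, 0 < kappa n < 2^-1,
         kappa n @[n --> \oo] --> (0 : R),
         forall n, Markov (tent (kappa n) (kappa n))
       & exists lambda2 : nat -> R,
           (forall n, is_lambda2 mu sigma (fun=> 1) (fun=> 1) (kappa n)
                        (lambda2 n)%:E) /\
           (lambda2 n / (- 2 * kappa n)) @[n --> \oo] --> (1 : R)].
Proof.
(* The shift by 14 gives kappa <= 2^-15, which is below 1 / 150^2 from the first term on. *)
have /choice[kappa hk] n := @exists_markov_kappa R (n + 14) ltac:(by rewrite addnS).
have k0 n : 0 < kappa n by have [] := hk n.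
have half : 0 <= (2^-1 : R) <= 1 by lra.
have kn n : kappa n <= 2^-1 ^+ n.
  have [_ h _] := hk n; apply: le_trans h _.
  by apply: ler_wiXn2l; [lra|lra|rewrite -addnS leq_addr].
have kb n : kappa n <= (150 ^+ 2)^-1.
  have [_ h _] := hk n; apply: le_trans h _.
  apply: (@le_trans _ _ (2^-1 ^+ 15)).
    by apply: ler_wiXn2l; [lra|lra|rewrite -addnS leq_addl].
  by rewrite !exprS expr0; lra.
have kc : kappa n @[n --> \oo] --> (0 : R).
  apply: (@squeeze_cvgr _ _ _ _ (cst 0) (fun n => 2^-1 ^+ n)); last 2 first.
  - exact: cvg_cst.
  - by apply: cvg_expr; rewrite ger0_norm; lra.
  by apply: nearW => n; rewrite /= kn ltW.
have [omega0 _] : exists omega : Omega, True.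
  apply: (@ae_set_ex _ _ _ mu (fun=> True)); exact: aeW.
have /choice[lambda2 hl] n := @growth_rate_bounds (kappa n) omega0 ltac:(by rewrite k0 kb).
exists kappa; split => //.
- by move=> n; rewrite k0 /=; apply: le_lt_trans (kb n) _; rewrite expr2; lra.
- move=> n; have [_ h e] := hk n.
  apply: (@tent_Markov _ (n + 14)) => //; first by rewrite addnS.
  by rewrite k0 /=; apply: le_trans (kb n) _; rewrite expr2; lra.
exists lambda2; split.
  by move=> n; apply: aeW => omega; rewrite (second_exponent_at_indep _ omega omega0); have [] := hl n.
have zc : (200 * Num.sqrt (kappa n)) @[n --> \oo] --> (0 : R).
  rewrite -(mulr0 200); apply: cvgM; first exact: cvg_cst.
  rewrite -[X in _ --> X]sqrtr0.
  by apply: cvg_comp kc _; exact: sqrt_continuous.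
apply/cvgrPdist_le => e e0.
have /cvgrPdist_le/(_ e e0) := zc; apply: filterS => n.
rewrite sub0r normrN ger0_norm ?mulr_ge0 ?sqrtr_ge0// => h.
by rewrite distrC; apply: le_trans h; have [] := hl n.
Qed.

End sharpness.

Theorem theoremC (R : realType) (d : measure_display)
    (Omega : measurableType d) (mu : probability Omega R)
    (sigma : Omega -> Omega) (sigma_erg : ergodic_automorphism mu sigma) :
  (forall eps1 eps2 : Omega -> R,
     measurable_fun setT eps1 -> measurable_fun setT eps2 ->
     (forall omega, 0 <= eps1 omega <= 1) ->
     (forall omega, 0 <= eps2 omega <= 1) ->
     ~ (\forall omega \ae mu, eps1 omega = 0) ->
     ~ (\forall omega \ae mu, eps2 omega = 0) ->
     countable (range eps1) -> countable (range eps2) ->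
     exists2 c : R, 0 < c &
       exists2 kappa0 : R, 0 < kappa0 &
         forall kappa : R, 0 < kappa <= 1 -> kappa < kappa0 ->
           exists2 lambda2 : \bar R,
             is_lambda2 mu sigma eps1 eps2 kappa lambda2 &
             (lambda2 <= (- (c * kappa))%:E)%E)
  /\
  (exists kappa : nat -> R,
     [/\ forall n, 0 < kappa n < 2^-1,
         kappa n @[n --> \oo] --> (0 : R),
         forall n, Markov (tent (kappa n) (kappa n))
       & exists lambda2 : nat -> R,
           (forall n, is_lambda2 mu sigma (fun=> 1) (fun=> 1) (kappa n)
                        (lambda2 n)%:E) /\
           (lambda2 n / (- 2 * kappa n)) @[n --> \oo] --> (1 : R)]).
Proof.
split.
  move=> eps1 eps2 m1 m2 b1 b2 n1 _ c1 c2.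
  exact: (second_exponent_upper sigma_erg m1 m2 c1 c2 b1 b2 n1).
exact: second_exponent_sharp.
Qed.
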